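(* Let $\varphi$ be a hyperbolic automorphism of the unit disc $\mathbb{D}$ and $C_\varphi f = f\circ\varphi$ the induced composition operator. Then $C_\varphi$ does not have the single-valued extension property on $H^p(\mathbb{D})$ for any $1 \le p < \infty$, and for every $1 < p < \infty$ the adjoint $C_\varphi^*$ acting on $H^p(\mathbb{D})^*$ has Dunford's property $(C)$.
   Context: $H^p(\mathbb{D})$ ($1\le p<\infty$) is the Hardy space of analytic $f$ on $\mathbb{D}$ with $\sup_{r<1}\frac{1}{2\pi}\int_0^{2\pi}|f(re^{i\theta})|^p\,d\theta<\infty$. A hyperbolic automorphism of $\mathbb{D}$ is a conformal automorphism of $\mathbb{D}$ (a linear fractional map) having two distinct fixed points, both on the unit circle $\mathbb{T}$; every such map is conjugate by an automorphism to $\varphi_r(z) = \frac{z+r}{1+rz}$ for some $0<r<1$. $C_\varphi^*$ denotes the Banach-space adjoint. An operator $T$ on a Banach space $X$ has the single-valued extension property (SVEP) if for every open $U\subseteq\mathbb{C}$ and analytic $f:U\to X$ with $(T-zI)f(z)=0$ on $U$, $f\equiv 0$. The local spectrum $\sigma_T(x)$ is the complement of the union of all open $U$ on which there is an analytic $f:U\to X$ with $(T-zI)f(z)=x$; $X_T(F)=\{x:\sigma_T(x)\subseteq F\}$; $T$ has Dunford's property $(C)$ if $X_T(F)$ is closed for every closed $F\subseteq\mathbb{C}$. *)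

(* Defs.v *)
From HB Require Import structures.
From mathcomp Require Import all_boot all_order all_algebra.
From mathcomp Require Import all_classical all_reals all_analysis.
From mathcomp Require Import complex.
Set Implicit Arguments. Unset Strict Implicit. Unset Printing Implicit Defensive.
Import Order.TTheory GRing.Theory Num.Theory.
Import numFieldNormedType.Exports.
Local Open Scope classical_set_scope.
Local Open Scope ring_scope.

Section Defs.
Variable R : realType.
Local Notation C := R[i].

Definition cabs (z : C) : R := ComplexField.Normc.normc z.

Definition copen (U : set C) : Prop :=
  forall z, U z -> exists2 e : R, 0 < e & forall w, cabs (w - z) < e -> U w.
Definition cclosed (F : set C) : Prop := copen (~` F).

Definition disc : set C := [set z | cabs z < 1].

Definition cdifferentiable (g : C -> C) (z : C) : Prop :=
  exists l : C, forall e : R, 0 < e -> exists2 d : R, 0 < d &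
    forall h : C, cabs h < d -> cabs (g (z + h) - g z - l * h) <= e * cabs h.
Definition analytic_on (U : set C) (g : C -> C) : Prop :=
  forall z, U z -> cdifferentiable g z.

Definition expi (t : R) : C := Complex (cos t) (sin t).

Definition int_mean (p : R) (f : C -> C) (r : R) : \bar R :=
  ((2 * pi)^-1)%:E *
  (\int[lebesgue_measure]_(t in `[0, (pi : R) *+ 2]%classic%R)
      ((cabs (f (real_complex R r * expi t))) `^ p)%:E)%E.

(* the Hardy space H^p(D), as a set of functions (only values on D matter) *)
Definition Hardy (p : R) : set (C -> C) :=
  [set f | analytic_on disc f /\
     exists M : R, forall r : R, 0 <= r < 1 -> (int_mean p f r <= M%:E)%E].

(* the H^p norm  sup_{0<=r<1} M_p(f,r)^{1/p}  (meaningful for f in H^p);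
   two elements are identified when their difference has norm 0, i.e. when
   they agree on D *)
Definition hardy_norm (p : R) (f : C -> C) : R :=
  (fine (ereal_sup [set int_mean p f r | r in `[0, 1[%classic])) `^ p^-1.

Definition comp_op (phi : C -> C) (f : C -> C) : C -> C := f \o phi.

(* the Banach dual H^p(D)^*: bounded linear functionals on H^p(D);
   two functionals are identified when they agree on H^p (dual norm 0) *)
Definition Hardy_dual (p : R) : set ((C -> C) -> C) :=
  [set L | (forall (a : C) f g, Hardy p f -> Hardy p g ->
              L (a *: f + g) = a * L f + L g) /\
           exists M : R, forall f, Hardy p f -> cabs (L f) <= M * hardy_norm p f].
Definition dual_norm (p : R) (L : (C -> C) -> C) : R :=
  sup [set cabs (L f) | f in [set f | Hardy p f /\ hardy_norm p f <= 1]].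

Definition adjoint (T : (C -> C) -> (C -> C)) (L : (C -> C) -> C) : (C -> C) -> C :=
  L \o T.

Definition hyperbolic_automorphism (phi : C -> C) : Prop :=
  [/\ exists a b c d : C, a * d - b * c != 0 /\
                          forall z, phi z = (a * z + b) / (c * z + d),
      forall z, disc z -> disc (phi z),
      forall w, disc w -> exists z, disc z /\ phi z = w,
      forall z1 z2, disc z1 -> disc z2 -> phi z1 = phi z2 -> z1 = z2 &
      exists z1 z2 : C, z1 != z2 /\ cabs z1 = 1 /\ cabs z2 = 1 /\
         phi z1 = z1 /\ phi z2 = z2 /\
         (forall z, cabs z <= 1 -> phi z = z -> z = z1 \/ z = z2)].

(* ---- local spectral theory for an operator T on a complex normed space,
   presented concretely: the space is the set S of vectors of an
   lmodType over C, with norm nrm; vectors of norm 0 count as 0. ---- *)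

Definition vanalytic (V : lmodType C) (S : set V) (nrm : V -> R)
    (U : set C) (F : C -> V) : Prop :=
  forall z, U z -> exists2 G : V, S G & forall e : R, 0 < e ->
    exists2 d : R, 0 < d & forall h : C, cabs h < d -> U (z + h) ->
      nrm (F (z + h) - F z - h *: G) <= e * cabs h.

Definition SVEP (V : lmodType C) (S : set V) (nrm : V -> R) (T : V -> V) : Prop :=
  forall (U : set C) (F : C -> V), copen U ->
    (forall z, U z -> S (F z)) -> vanalytic S nrm U F ->
    (forall z, U z -> nrm (T (F z) - z *: F z) = 0) ->
    forall z, U z -> nrm (F z) = 0.

Definition local_resolvent (V : lmodType C) (S : set V) (nrm : V -> R)
    (T : V -> V) (x : V) : set C :=
  [set z | exists (U : set C) (F : C -> V),
     [/\ copen U, U z, forall w, U w -> S (F w), vanalytic S nrm U F &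
         forall w, U w -> nrm (T (F w) - w *: F w - x) = 0]].
Definition local_spectrum (V : lmodType C) (S : set V) (nrm : V -> R)
    (T : V -> V) (x : V) : set C := ~` local_resolvent S nrm T x.

Definition local_spectral_subspace (V : lmodType C) (S : set V) (nrm : V -> R)
    (T : V -> V) (F : set C) : set V :=
  [set x | S x /\ local_spectrum S nrm T x `<=` F].

Definition property_C (V : lmodType C) (S : set V) (nrm : V -> R) (T : V -> V) : Prop :=
  forall F : set C, cclosed F -> forall x, S x ->
    (forall e : R, 0 < e -> exists2 y, local_spectral_subspace S nrm T F y &
                                        nrm (x - y) < e) ->
    local_spectral_subspace S nrm T F x.

End Defs.

(* Main.v *)
Require Import Defs.
From HB Require Import structures.
From mathcomp Require Import all_boot all_order all_algebra.
From mathcomp Require Import all_classical all_reals all_analysis.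
From mathcomp Require Import complex.
From mathcomp Require Import ring lra.
Set Implicit Arguments. Unset Strict Implicit. Unset Printing Implicit Defensive.
Import Order.TTheory GRing.Theory Num.Theory.
Import numFieldNormedType.Exports.
Local Open Scope classical_set_scope.
Local Open Scope ring_scope.
Local Notation Re := (@complex.Re _).
Local Notation Im := (@complex.Im _).

(** With [z1, z2] the fixed points and [W z = (z1 - z) / (z - z2)], the map [phi] is
    conjugate to [W |-> k W] with [k = exp tau > 0]; let [ell = log W] on the disc, so that
    [ell (phi z) = ell z + tau] and [Im ell] ranges in an interval [[-kap, kap]], [kap < pi].
    The functions [e_s = exp (s * ell)], [|Re s| < 1/p], lie in [H^p] and satisfy
    [e_s (phi z) = exp (s * tau) * e_s z]. They are an analytic family of eigenvectors, so SVEP fails.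

    For the adjoint, every nonzero functional [L] has as local spectrum the whole annulus
    [{|log |z|| <= |tau| / p}], so that the spectral subspaces are [0] or everything. Outside
    the annulus the resolvent is a Neumann series, because [||f o phi_t|| <= K exp (|t| / p) ||f||].
    If the local resolvent set meets the open annulus, then [L (e_s) = 0] for [s] in an open set,
    hence on the strip [|Re s| < 1/p]. Then [g s = L (e_s * (z - z2) * q)] satisfies
    [g (s + 1) + g s = (z1 - z2) * L (e_s * q)], as [W + 1 = (z1 - z2) / (z - z2)]; by induction on
    the degree of [q] the right-hand side vanishes, and an antiperiodic function of
    exponential type [kap < pi] is zero. So [L] kills the polynomials, which are dense by
    uniform convexity of [x |-> x^p]. *)

(** * Complex numbers, limits and derivatives *)

Section ComplexModulus.
Variable R : realType.
Local Notation C := R[i].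
Implicit Types (z w : C) (x y : R).

(** No boundary values are used: norms are suprema of means over circles of radius less than 1,
    which grow with the radius. The exponent [1/p] occurs twice and has to agree. On one side
    [exp (s * ell)] has modulus comparable to [|W| ^ Re s], and [|W| ^ a] has bounded circular means
    when [|a| < 1]; hence the strip [|Re s| < 1/p]. On the other side the norm of composition with
    [phi_t] is governed by the Poisson kernel at [phi_t 0], a point whose distance to the circle is
    at least of order [exp (- |t|)]. Since the maps form a group, iterating costs the constant [K]
    only once, so the Neumann series converge right up to the annulus swept by the eigenvalues
    [exp (s * tau)]. The factor [z - z2] in [g] is what permits the shift: [exp ((s + 1) * ell)] may
    leave [H^p], but [(z - z2) * W = z1 - z] is bounded, so [g] is analytic on
    [- 1/p < Re s < 1 + 1/p]. The bound [kap < pi] is critical, because [exp (i pi s)] is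
    antiperiodic of type [pi]. *)

Lemma cabsE z : cabs z = Num.sqrt (Re z ^+ 2 + Im z ^+ 2).
Proof. by case: z. Qed.
Lemma cabs_ge0 z : 0 <= cabs z.
Proof. by rewrite cabsE sqrtr_ge0. Qed.
Lemma sqr_cabs z : cabs z ^+ 2 = Re z ^+ 2 + Im z ^+ 2.
Proof. by rewrite cabsE sqr_sqrtr// addr_ge0// sqr_ge0. Qed.
Lemma cabsM z w : cabs (z * w) = cabs z * cabs w.
Proof. exact: ComplexField.Normc.normcM. Qed.
Lemma cabsV z : cabs z^-1 = (cabs z)^-1.
Proof. exact: ComplexField.Normc.normcV. Qed.
Lemma cabsD z w : cabs (z + w) <= cabs z + cabs w.
Proof. exact: le_normcD. Qed.
Lemma cabsN z : cabs (- z) = cabs z.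
Proof. exact: normcN. Qed.
Lemma cabsB z w : cabs (z - w) <= cabs z + cabs w.
Proof. by rewrite -(cabsN w) cabsD. Qed.
Lemma cabsBC z w : cabs (z - w) = cabs (w - z).
Proof. by rewrite -cabsN opprB. Qed.
Lemma cabs0 : cabs (0 : C) = 0.
Proof. exact: ComplexField.Normc.normc0. Qed.
Lemma cabs1 : cabs (1 : C) = 1.
Proof. exact: ComplexField.Normc.normc1. Qed.
Lemma cabs_eq0 z : (cabs z == 0) = (z == 0).
Proof.
apply/eqP/eqP => [|->]; last exact: cabs0.
exact: ComplexField.Normc.eq0_normc.
Qed.
Lemma cabs_gt0 z : (0 < cabs z) = (z != 0).
Proof. by rewrite lt_def cabs_ge0 andbT cabs_eq0. Qed.
Lemma cabsX z n : cabs (z ^+ n) = cabs z ^+ n.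
Proof. by elim: n => [|n IH]; rewrite ?expr0 ?cabs1// !exprS cabsM IH. Qed.
Lemma cabs_real x : cabs x%:C%C = `|x|.
Proof. by rewrite cabsE /= expr0n addr0 sqrtr_sqr. Qed.
Lemma ler_Re_cabs z : `|Re z| <= cabs z.
Proof.
rewrite cabsE -sqrtr_sqr ler_wsqrtr// lerDl sqr_ge0 //.
Qed.
Lemma ler_Im_cabs z : `|Im z| <= cabs z.
Proof.
rewrite cabsE -sqrtr_sqr ler_wsqrtr// lerDr sqr_ge0 //.
Qed.
Lemma ler_cabs_ReIm z : cabs z <= `|Re z| + `|Im z|.
Proof.
rewrite -(@ler_pXn2r _ 2) ?nnegrE ?cabs_ge0 ?addr_ge0// sqr_cabs.
rewrite sqrrD !real_normK ?num_real// lerD2r lerDl mulrn_wge0// mulr_ge0//.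
Qed.
Lemma ler_cabs_sub z w : cabs z - cabs w <= cabs (z - w).
Proof. by rewrite lerBlDr -{1}(subrK w z) cabsD. Qed.
Lemma cabs_sum (I : Type) (r : seq I) (P : pred I) (f : I -> C) :
  cabs (\sum_(i <- r | P i) f i) <= \sum_(i <- r | P i) cabs (f i).
Proof.
elim/big_ind2: _ => [|a b c d h k|//]; first by rewrite cabs0.
by rewrite (le_trans (cabsD _ _))// lerD.
Qed.
Lemma cReD z w : Re (z + w) = Re z + Re w. Proof. by case: z w => ? ? []. Qed.
Lemma cImD z w : Im (z + w) = Im z + Im w. Proof. by case: z w => ? ? []. Qed.
Lemma cReN z : Re (- z) = - Re z. Proof. by case: z. Qed.
Lemma cImN z : Im (- z) = - Im z. Proof. by case: z. Qed.
Lemma cReM z w : Re (z * w) = Re z * Re w - Im z * Im w.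
Proof. by case: z w => ? ? []. Qed.
Lemma cImM z w : Im (z * w) = Re z * Im w + Im z * Re w.
Proof. by case: z w => ? ? []. Qed.
Definition ReImE := (cReD, cImD, cReN, cImN, cReM, cImM).
Lemma complexP z w : Re z = Re w -> Im z = Im w -> z = w.
Proof. by case: z w => ? ? [? ?] /= -> ->. Qed.
Lemma Rec x : Re x%:C%C = x. Proof. by []. Qed.
Lemma Imc x : Im x%:C%C = 0. Proof. by []. Qed.
Lemma real_complexD x y : (x + y)%:C%C = x%:C%C + y%:C%C.
Proof. exact: rmorphD. Qed.
Lemma real_complexM x y : (x * y)%:C%C = x%:C%C * y%:C%C.
Proof. exact: rmorphM. Qed.

End ComplexModulus.

Section ComplexLimits.
Variable R : realType.
Local Notation C := R[i].

(** The statement measures distances by the real-valued [cabs]; a filter in these terms makes the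
    [near] tactics available for it. *)
Definition cnbhs (z : C) : set_system C :=
  [set A | exists2 d : R, 0 < d & forall w, cabs (w - z) < d -> A w].

Global Instance cnbhs_filter z : ProperFilter (cnbhs z).
Proof.
apply: Build_ProperFilter_ex.
  by move=> P [d d0 h]; exists z; apply: h; rewrite subrr cabs0.
split.
- by exists 1.
- move=> P Q [d d0 h] [e e0 k]; exists (Num.min d e); first by rewrite lt_min d0.
  by move=> w; rewrite lt_min => /andP[? ?]; split; [apply: h|apply: k].
- by move=> P Q PQ [d d0 h]; exists d => // w /h /PQ.
Qed.

Definition clim (T : Type) (F : set_system T) (g : T -> C) (l : C) :=
  forall e : R, 0 < e -> \forall x \near F, cabs (g x - l) < e.

Section Filter.
Variables (T : Type) (F : set_system T).
Context {FF : Filter F}.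
Implicit Types (f g : T -> C) (l m : C).

Lemma clim_cst l : clim F (fun=> l) l.
Proof. by move=> e e0; apply: nearW => x; rewrite subrr cabs0. Qed.

Lemma climD f g l m : clim F f l -> clim F g m -> clim F (fun x => f x + g x) (l + m).
Proof.
move=> fl gm e e0; have e20 : 0 < e / 2 by lra.
near=> x; have -> : f x + g x - (l + m) = (f x - l) + (g x - m) by ring.
apply: le_lt_trans (cabsD _ _) _.
have : cabs (f x - l) < e / 2 by near: x; apply: fl.
have : cabs (g x - m) < e / 2 by near: x; apply: gm.
lra.
Unshelve. all: by end_near. Qed.

Lemma climN f l : clim F f l -> clim F (fun x => - f x) (- l).
Proof.
move=> fl e e0; near=> x; rewrite -opprD cabsN; near: x; exact: fl.
Unshelve. all: by end_near. Qed.

Lemma climB f g l m : clim F f l -> clim F g m -> clim F (fun x => f x - g x) (l - m).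
Proof. by move=> ? /climN; apply: climD. Qed.

Lemma climM f g l m : clim F f l -> clim F g m -> clim F (fun x => f x * g x) (l * m).
Proof.
move=> fl gm e e0.
pose B := cabs l + cabs m + 1.
have l0 := cabs_ge0 l; have m0 := cabs_ge0 m.
have B0 : 0 < B by rewrite /B; lra.
pose d := Num.min 1 (e / (2 * B)).
have d0 : 0 < d by rewrite lt_min ltr01 divr_gt0// mulr_gt0.
near=> x.
have h1 : cabs (f x - l) < d by near: x; apply: fl.
have h2 : cabs (g x - m) < d by near: x; apply: gm.
have -> : f x * g x - l * m = (f x - l) * (g x - m) + (f x - l) * m + l * (g x - m) by ring.
apply: le_lt_trans (cabsD _ _) _.
apply: le_lt_trans (lerD (cabsD _ _) (lexx _)) _; rewrite !cabsM.
have a0 := cabs_ge0 (f x - l); have b0 := cabs_ge0 (g x - m).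
have d1 : d <= 1 by rewrite ge_min lexx.
have d2 : d * (2 * B) <= e by rewrite -ler_pdivlMr ?mulr_gt0// ge_min lexx orbT.
have : cabs (f x - l) * cabs (g x - m) <= d * 1.
  by apply: ler_pM => //; apply: ltW => //; apply: lt_le_trans d1.
have : cabs (f x - l) * cabs m <= d * cabs m by rewrite ler_wpM2r// ltW.
have : cabs l * cabs (g x - m) <= cabs l * d by rewrite ler_wpM2l// ltW.
have : 0 < d * B by rewrite mulr_gt0.
rewrite /B in d2 *; nra.
Unshelve. all: by end_near. Qed.

Lemma climV f l : l != 0 -> clim F f l -> clim F (fun x => (f x)^-1) l^-1.
Proof.
rewrite -cabs_gt0 => l0 fl e e0.
have d0 : 0 < Num.min (cabs l / 2) (e * (cabs l * cabs l / 2)).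
  by rewrite lt_min !(mulr_gt0, divr_gt0)// invr_gt0.
near=> x.
have : cabs (f x - l) < Num.min (cabs l / 2) (e * (cabs l * cabs l / 2)).
  by near: x; exact: fl.
rewrite lt_min => /andP[h1 h2].
have fx : cabs l / 2 < cabs (f x).
  have := ler_cabs_sub l (f x); rewrite cabsBC; lra.
have fx0 : 0 < cabs (f x) by apply: lt_trans fx; lra.
have -> : (f x)^-1 - l^-1 = (l - f x) * ((f x)^-1 * l^-1).
  by field; rewrite -!cabs_gt0 fx0 l0.
rewrite !cabsM !cabsV cabsBC -invfM ltr_pdivrMr ?mulr_gt0//.
apply: lt_le_trans h2 _; rewrite ler_wpM2l// ?(ltW e0)//.
rewrite mulrAC ler_wpM2r// ltW//.
Unshelve. all: by end_near. Qed.

Lemma clim_near f g l : (\forall x \near F, f x = g x) -> clim F f l -> clim F g l.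
Proof.
move=> fg fl e e0; near=> x.
have <- : f x = g x by near: x.
by near: x; exact: fl.
Unshelve. all: by end_near. Qed.

Lemma clim_Re f l : clim F f l -> (fun x => Re (f x)) @ F --> Re l.
Proof.
move=> fl; apply/cvgrPdist_lt => e e0; near=> x.
rewrite -cReN -cReD; apply: le_lt_trans (ler_Re_cabs _) _.
by rewrite cabsBC; near: x; exact: fl.
Unshelve. all: by end_near. Qed.

Lemma clim_Im f l : clim F f l -> (fun x => Im (f x)) @ F --> Im l.
Proof.
move=> fl; apply/cvgrPdist_lt => e e0; near=> x.
rewrite -cImN -cImD; apply: le_lt_trans (ler_Im_cabs _) _.
by rewrite cabsBC; near: x; exact: fl.
Unshelve. all: by end_near. Qed.

Lemma clim_ReIm f l : (fun x => Re (f x)) @ F --> Re l ->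
  (fun x => Im (f x)) @ F --> Im l -> clim F f l.
Proof.
move=> /cvgrPdist_lt fr /cvgrPdist_lt fi e e0.
have e20 : 0 < e / 2 by lra.
near=> x; apply: le_lt_trans (ler_cabs_ReIm _) _.
rewrite !ReImE distrC [X in _ + X]distrC [ltRHS](splitr e) ltrD//; near: x.
  exact: fr.
exact: fi.
Unshelve. all: by end_near. Qed.

Lemma clim_cabs f l : clim F f l -> (fun x => cabs (f x)) @ F --> cabs l.
Proof.
move=> fl; apply/cvgrPdist_lt => e e0; near=> x.
apply: le_lt_trans (_ : cabs (f x - l) < _); last by near: x; exact: fl.
by rewrite ler_norml; have := ler_cabs_sub (f x) l; have := ler_cabs_sub l (f x);
   rewrite [cabs (l - _)]cabsBC; lra.
Unshelve. all: by end_near. Qed.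

Lemma clim_comp f (g : C -> C) l m : clim F f l -> clim (cnbhs l) g m -> g l = m ->
  clim F (g \o f) m.
Proof.
move=> fl gm glm e e0.
have [d d0 h] := gm e e0; near=> x; apply: h; near: x; exact: fl.
Unshelve. all: by end_near. Qed.

End Filter.

Lemma clim_unique (T : Type) (F : set_system T) {FF : ProperFilter F} (f : T -> C) l m :
  clim F f l -> clim F f m -> l = m.
Proof.
move=> fl fm; apply/eqP; rewrite -subr_eq0 -cabs_eq0; apply/negPn/negP => n0.
have e0 : 0 < cabs (l - m) by rewrite lt_def n0 cabs_ge0.
have e20 : 0 < cabs (l - m) / 2 by lra.
have [x [/= h1 h2]] : exists x, cabs (f x - l) < cabs (l - m) / 2 /\ cabs (f x - m) < cabs (l - m) / 2.
  by apply: (@filter_ex _ F); apply: filterI; [exact: fl|exact: fm].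
have := cabsD (l - f x) (f x - m).
have -> : l - f x + (f x - m) = l - m by ring.
rewrite (cabsBC l (f x)); lra.
Qed.

Definition ccts (g : C -> C) (z : C) := clim (cnbhs z) g (g z).

Lemma ccts_id z : ccts id z.
Proof. by move=> e e0; exists e. Qed.

Lemma ccts_near_neq0 (g : C -> C) z : ccts g z -> g z != 0 ->
  \forall w \near cnbhs z, g w != 0.
Proof.
move=> gz; rewrite -cabs_gt0 => g0; have := gz _ g0.
apply: filterS => w h; rewrite -cabs_gt0.
have := ler_cabs_sub (g z) (g w); rewrite cabsBC; lra.
Qed.

(* Caratheodory's form of differentiability: the difference quotient, completed
   by [l] at [z], is continuous at [z]. *)
Definition cder (g : C -> C) (z l : C) :=
  exists q : C -> C, [/\ q z = l, clim (cnbhs z) q l &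
    forall x, g x = g z + q x * (x - z)].

Lemma cderP g z l : cder g z l <-> forall e : R, 0 < e -> exists2 d : R, 0 < d &
    forall h : C, cabs h < d -> cabs (g (z + h) - g z - l * h) <= e * cabs h.
Proof.
split=> [[q [qz ql gq]] e e0|H].
  have [d d0 h] := ql e e0; exists d => // k kd.
  have -> : g (z + k) - g z - l * k = (q (z + k) - l) * k by rewrite (gq (z + k)); ring.
  rewrite cabsM ler_wpM2r ?cabs_ge0// ltW// h//.
  by have -> : z + k - z = k by ring.
exists (fun x => if x == z then l else (g x - g z) / (x - z)); split.
- by rewrite eqxx.
- move=> e e0; have e20 : 0 < e / 2 by lra.
  have [d d0 h] := H _ e20; exists d => // w wd.
  have [_|wz] := eqVneq; first by rewrite subrr cabs0.
  have wz' : w - z != 0 by rewrite subr_eq0.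
  have := h _ wd; have -> : z + (w - z) = w by ring.
  have -> : (g w - g z) / (w - z) - l = (g w - g z - l * (w - z)) / (w - z).
    by field.
  rewrite cabsM cabsV => hh; rewrite ltr_pdivrMr ?cabs_gt0//.
  apply: le_lt_trans hh _; rewrite ltr_pM2r ?cabs_gt0//; lra.
- move=> x; have [->|xz] := eqVneq; first by rewrite subrr mulr0 addr0.
  by field; rewrite subr_eq0.
Qed.

Lemma cdifferentiableP g z : cdifferentiable g z <-> exists l, cder g z l.
Proof. by split=> -[l /cderP]; exists l. Qed.

Lemma cder_ccts g z l : cder g z l -> ccts g z.
Proof.
move=> [q [qz ql gq]].
have -> : g = fun x => g z + q x * (x - z) by apply/funext => x; exact: gq.
rewrite /ccts; set m := (X in clim _ _ X).
have -> : m = g z + l * (z - z) by rewrite /m !subrr !mulr0.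
apply: climD; first exact: clim_cst.
by apply: climM => //; apply: climB; [exact: ccts_id|exact: clim_cst].
Qed.

Lemma cder_cst c z : cder (fun=> c) z 0.
Proof.
exists (fun=> 0); split=> //; first exact: clim_cst.
by move=> x; rewrite mul0r addr0.
Qed.

Lemma cder_id z : cder id z 1.
Proof. by exists (fun=> 1); split=> // [|x]; [exact: clim_cst|rewrite /=; ring]. Qed.

Lemma cderD f g z l m : cder f z l -> cder g z m -> cder (fun x => f x + g x) z (l + m).
Proof.
move=> [p [pz pl fp]] [q [qz ql gq]]; exists (fun x => p x + q x); split.
- by rewrite pz qz.
- exact: climD.
- by move=> x; rewrite (fp x) (gq x); ring.
Qed.

Lemma cderM f g z l m : cder f z l -> cder g z m ->
  cder (fun x => f x * g x) z (l * g z + f z * m).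
Proof.
move=> df dg; have cg := cder_ccts dg.
move: df dg => [p [pz pl fp]] [q [qz ql gq]].
exists (fun x => p x * g x + f z * q x); split.
- by rewrite pz qz.
- apply: climD; apply: climM => //; exact: clim_cst.
- by move=> x; rewrite (fp x) (gq x); ring.
Qed.

Lemma cderZ c f z l : cder f z l -> cder (fun x => c * f x) z (c * l).
Proof.
by move=> /(cderM (cder_cst c z)); rewrite mul0r add0r.
Qed.

Lemma cderN f z l : cder f z l -> cder (fun x => - f x) z (- l).
Proof.
move=> /(cderZ (-1)); rewrite mulN1r.
by under [X in cder X]eq_fun do rewrite mulN1r.
Qed.

Lemma cderB f g z l m : cder f z l -> cder g z m -> cder (fun x => f x - g x) z (l - m).
Proof. by move=> ? /cderN; apply: cderD. Qed.

Lemma cderV f z l : f z != 0 -> cder f z l ->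
  cder (fun x => (f x)^-1) z (- l / f z ^+ 2).
Proof.
move=> fz df; have cf := cder_ccts df.
have [q [qz ql fq]] := df.
(* Where [f x = 0] the convention [0^-1 = 0] forces the raw difference quotient, since the
   factorisation must hold at every [x]. Such points stay away from [z], so the limit only sees the
   last branch. *)
exists (fun x => if f x == 0 then if x == z then 0 else ((f x)^-1 - (f z)^-1) / (x - z) else
   - q x / (f x * f z)); split.
- by rewrite (negPf fz) qz.
- apply: (@clim_near _ (cnbhs z) _ (fun x => - q x / (f x * f z))).
    by apply: filterS (ccts_near_neq0 cf fz) => x /negPf ->.
  apply: climM; first exact: climN.
  apply: climV; first by rewrite expf_neq0.
  by apply: climM => //; exact: clim_cst.
- move=> x; have [fx0|fx0] := eqVneq (f x) 0.
    have [xz|xz] := eqVneq x z; first by rewrite xz mul0r addr0.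
    by rewrite divfK ?subr_eq0// addrC subrK.
  have qx : q x * (x - z) = f x - f z by rewrite (fq x); ring.
  have -> : - q x / (f x * f z) * (x - z) = - (q x * (x - z)) / (f x * f z) by ring.
  by rewrite qx; field; rewrite fx0 fz.
Qed.

Lemma cder_comp f g z l m : cder f z l -> cder g (f z) m -> cder (g \o f) z (m * l).
Proof.
move=> df dg; have cf := cder_ccts df.
move: df dg => [p [pz pl fp]] [q [qz ql gq]].
exists (fun x => q (f x) * p x); split.
- by rewrite pz qz.
- by apply: climM => //; apply: clim_comp cf ql qz.
- by move=> x /=; rewrite (gq (f x)) {2}(fp x); ring.
Qed.

Lemma cder_eq f g z l : (\forall w \near cnbhs z, f w = g w) -> cder f z l -> cder g z l.
Proof.
move=> [d d0 h] /cderP H; apply/cderP => e e0.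
have [d' d'0 k] := H e e0; exists (Num.min d d'); first by rewrite lt_min d0.
move=> x; rewrite lt_min => /andP[xd xd'].
rewrite -!h; first exact: k.
  by rewrite subrr cabs0.
by have -> : z + x - z = x by ring.
Qed.

Lemma cder_affine a b z : cder (fun x => a * x + b) z a.
Proof.
have := cderD (cderZ a (cder_id z)) (cder_cst b z).
by rewrite mulr1 addr0.
Qed.

(** With [E] in Caratheodory form, [w - z = q (lam w) * (lam w - lam z)], so the quotient of the
    continuous inverse [lam] is [1 / q (lam w)]. The other branches of the witness only extend the
    factorisation to all [w]. This gives the derivative of the logarithm. *)
Lemma cder_inv E lam z m : (\forall w \near cnbhs z, E (lam w) = w) -> ccts lam z ->
  cder E (lam z) m -> m != 0 -> cder lam z m^-1.
Proof.
move=> EK cl [q [qz ql Eq]] m0.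
have Ez : E (lam z) = z by case: EK => d d0; apply; rewrite subrr cabs0.
have cq : clim (cnbhs z) (q \o lam) m by apply: clim_comp cl ql qz.
have qn : \forall w \near cnbhs z, q (lam w) != 0.
  by apply: (@ccts_near_neq0 (q \o lam)); rewrite /ccts /= qz.
exists (fun w => if (E (lam w) == w) && (q (lam w) != 0) then (q (lam w))^-1
   else if w == z then m^-1 else (lam w - lam z) / (w - z)); split.
- by rewrite Ez eqxx /= qz m0.
- apply: (@clim_near _ (cnbhs z) _ (fun w => (q (lam w))^-1)).
    by apply: filterS2 EK qn => w -> ->; rewrite eqxx.
  exact: climV.
- move=> w; case: ifP => [/andP[/eqP Ew qw]|_].
    have -> : w - z = q (lam w) * (lam w - lam z) by rewrite -{1}Ew (Eq (lam w)) Ez; ring.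
    by rewrite mulKf// addrC subrK.
  by have [->|wz] := eqVneq w z; [rewrite subrr mulr0 addr0|field; rewrite subr_eq0].
Qed.

End ComplexLimits.

(** * The complex exponential and its derivative *)

Section ComplexExponential.
Variable R : realType.
Local Notation C := R[i].
Implicit Types (z w h : C) (x y : R).

Definition cexp z : C := Complex (expR (Re z) * cos (Im z)) (expR (Re z) * sin (Im z)).

Lemma cexpD z w : cexp (z + w) = cexp z * cexp w.
Proof.
by apply: complexP; rewrite /cexp !ReImE /= expRD ?cosD ?sinD; ring.
Qed.
Lemma cexp0 : cexp 0 = 1 :> C.
Proof. by rewrite /cexp /= expR0 cos0 sin0 mulr1 mulr0. Qed.
Lemma cabs_cexp z : cabs (cexp z) = expR (Re z).
Proof.
rewrite cabsE /= !exprMn -mulrDr cos2Dsin2 mulr1 sqrtr_sqr ger0_norm// expR_ge0 //.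
Qed.
Lemma cexp_neq0 z : cexp z != 0.
Proof. by rewrite -cabs_gt0 cabs_cexp expR_gt0. Qed.
Lemma cexpN z : cexp (- z) = (cexp z)^-1.
Proof. by apply: (mulIf (cexp_neq0 z)); rewrite -cexpD addNr cexp0 mulVf// cexp_neq0. Qed.
Lemma cexpi y : cexp (Complex 0 y) = expi y.
Proof. by rewrite /cexp /= expR0 !mul1r. Qed.
Lemma cexp_real x : cexp x%:C%C = (expR x)%:C%C.
Proof. by rewrite /cexp /= sin0 cos0 mulr1 mulr0. Qed.
Lemma cexpMn z n : cexp (z *+ n) = cexp z ^+ n.
Proof. by elim: n => [|n IH]; rewrite ?cexp0 ?expr0// mulrS cexpD IH exprS. Qed.

Lemma norm_sin_le y : `|sin y| <= `|y|.
Proof.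
wlog y0 : y / 0 <= y => [H|].
  have [/H//|/ltW] := leP 0 y.
  by rewrite -oppr_ge0 => /H; rewrite sinN !normrN.
have [c _] := @MVT_segment R sin cos 0 y y0 (fun x _ => is_derive_sin x)
  (continuous_subspaceT (@continuous_sin R)).
rewrite sin0 !subr0 => ->; rewrite normrM ler_piMl// ler_norml cos_le1 cos_geN1//.
Qed.

Lemma cos_ge_sqr y : 1 - cos y <= y ^+ 2 / 2.
Proof.
have -> : y = (y / 2) *+ 2 by rewrite mulr2n -splitr.
rewrite cos_mulr2n cos2sin2.
have : sin (y / 2) ^+ 2 <= (y / 2) ^+ 2.
  by rewrite -[leLHS]real_normK ?num_real// -[leRHS]real_normK ?num_real// lerXn2r ?nnegrE// norm_sin_le.
have -> : (y / 2 *+ 2) ^+ 2 / 2 = 2 * (y / 2) ^+ 2 by rewrite mulr2n; field.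
by rewrite !mulr2n; move: (sin _ ^+ 2) ((y / 2) ^+ 2) => S T; lra.
Qed.

Lemma norm_sinB_le y : `|sin y - y| <= y ^+ 2.
Proof.
wlog y0 : y / 0 <= y => [H|].
  have [/H//|/ltW] := leP 0 y.
  by rewrite -oppr_ge0 => /H; rewrite sinN -opprD normrN sqrrN.
have [c /andP[c0 cy]] := @MVT_segment R sin cos 0 y y0 (fun x _ => is_derive_sin x)
  (continuous_subspaceT (@continuous_sin R)).
rewrite sin0 !subr0 => ->; rewrite !bnd_simp in c0 cy.
have -> : cos c * y - y = - ((1 - cos c) * y) by ring.
rewrite normrN normrM (ger0_norm y0) expr2 ler_wpM2r// ger0_norm ?subr_ge0 ?cos_le1//.
have h1 := cos_geN1 c; have h2 := cos_ge_sqr c.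
(* For [c >= 2] use [1 - cos c <= 2 <= c]; for [c < 2] use [1 - cos c <= c^2 / 2 <= c]. *)
by have [h|h] := lerP 2 c; nra.
Qed.

(** This bound and the second-order one below come from [1 + x <= exp x], applied to [x] and [- x],
    together with [exp x * exp (- x) = 1]. *)
Lemma expR_sub1_le x : `|expR x - 1| <= `|x| * expR `|x|.
Proof.
have e1 := expR_ge1Dx x; have e2 := expR_ge1Dx (- x); have p := expR_gt0 x.
have p' := expR_gt0 (- x).
have ee : expR x * expR (- x) = 1 by rewrite -expRD subrr expR0.
have [x0|x0] := leP 0 x.
  rewrite (ger0_norm x0) ger0_norm; last by lra.
  nra.
rewrite (ltr0_norm x0) ltr0_norm ?subr_lt0 ?expR_lt1//.
have : 1 <= expR (- x) by lra.
nra.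
Qed.

Lemma expR_sub1x_le x : `|expR x - 1 - x| <= x ^+ 2 * expR `|x|.
Proof.
have e1 := expR_ge1Dx x; have e2 := expR_ge1Dx (- x); have p := expR_gt0 x.
have p' := expR_gt0 (- x).
have ee : expR x * expR (- x) = 1 by rewrite -expRD subrr expR0.
have h : expR x - 1 <= x * expR x by nra.
rewrite ger0_norm; last by lra.
have [x0|x0] := leP 0 x.
  by rewrite (ger0_norm x0); nra.
rewrite (ltr0_norm x0).
have : 1 <= expR (- x) by lra.
have : x * (expR x - 1) <= x * x by nra.
nra.
Qed.

(** With [h = x + i y], the real part is split as [exp x (cos y - 1) + (exp x - 1 - x)] and the
    imaginary part as [(exp x - 1) sin y + (sin y - y)]. The four bounds add up to at most
    [2 (x^2 + y^2) exp |h|]; the constant 3 leaves room. *)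
Lemma cexp_sub1_le h : cabs (cexp h - 1 - h) <= 3 * cabs h ^+ 2 * expR (cabs h).
Proof.
move: (ler_Re_cabs h) (ler_Im_cabs h) (sqr_cabs h) (cabs_ge0 h); move: (cabs h) => r; move=> xr yr re r0; apply: le_trans (ler_cabs_ReIm _) _; rewrite !ReImE.
case: h xr yr re => x y /= xr yr re.
have -> : expR x * cos y - 1 - x = expR x * (cos y - 1) + (expR x - 1 - x) by ring.
have -> : expR x * sin y + - 0 - y = (expR x - 1) * sin y + (sin y - y) by ring.
have E1 : 1 <= expR r by have := expR_ge1Dx r; lra.
have Ex : expR x <= expR r by rewrite ler_expR; apply: le_trans xr; exact: ler_norm.
have Exx : expR `|x| <= expR r by rewrite ler_expR.
have p := expR_gt0 x.
apply: le_trans (lerD (ler_normD _ _) (ler_normD _ _)) _; rewrite !normrM.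
have h1 : `|expR x| * `|cos y - 1| <= expR r * (y ^+ 2 / 2).
  apply: ler_pM => //; first by rewrite gtr0_norm.
  by rewrite distrC ger0_norm ?subr_ge0 ?cos_le1// cos_ge_sqr.
have h2 : `|expR x - 1 - x| <= x ^+ 2 * expR r.
  by apply: le_trans (expR_sub1x_le x) _; rewrite ler_wpM2l// sqr_ge0.
have h3 : `|expR x - 1| * `|sin y| <= (`|x| * expR r) * `|y|.
  apply: ler_pM => //; last exact: norm_sin_le.
  by apply: le_trans (expR_sub1_le x) _; rewrite ler_wpM2l.
have h4 : `|sin y - y| <= y ^+ 2 * expR r.
  by apply: le_trans (norm_sinB_le y) _; rewrite ler_peMr// sqr_ge0.
have h5 : `|x| * `|y| <= (x ^+ 2 + y ^+ 2) / 2.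
  rewrite -[x ^+ 2]real_normK ?num_real// -[y ^+ 2]real_normK ?num_real//.
  by have := sqr_ge0 (`|x| - `|y|); nra.
apply: le_trans (lerD (lerD h1 h2) (lerD h3 h4)) _.
rewrite re.
have y2 := sqr_ge0 y; have x2 := sqr_ge0 x.
have : `|x| * `|y| * expR r <= (x ^+ 2 + y ^+ 2) / 2 * expR r by rewrite ler_wpM2r// ltW// expR_gt0.
have : 0 <= x ^+ 2 * expR r by rewrite mulr_ge0// expR_ge0.
have : 0 <= y ^+ 2 * expR r by rewrite mulr_ge0// expR_ge0.
lra.
Qed.

Lemma cder_cexp z : cder cexp z (cexp z).
Proof.
apply/cderP => e e0.
have c0 : 0 < cabs (cexp z) by rewrite cabs_gt0 cexp_neq0.
have E0 := expR_gt0 (1 : R).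
have K0 : 0 < 3 * cabs (cexp z) * expR 1 by rewrite !mulr_gt0.
exists (Num.min 1 (e / (3 * cabs (cexp z) * expR 1))).
  by rewrite lt_min ltr01 divr_gt0.
move=> h; rewrite lt_min => /andP[h1 h2].
have -> : cexp (z + h) - cexp z - cexp z * h = cexp z * (cexp h - 1 - h).
  by rewrite cexpD; ring.
rewrite cabsM; have g0 := cabs_ge0 h.
apply: le_trans (ler_wpM2l (ltW c0) (cexp_sub1_le h)) _.
have E1 : expR (cabs h) <= expR 1 by rewrite ler_expR ltW.
rewrite ltr_pdivlMr// in h2.
apply: (@le_trans _ _ (cabs h * (3 * cabs (cexp z) * expR 1) * cabs h)); last by rewrite ler_wpM2r// ltW.
have -> : cabs (cexp z) * (3 * cabs h ^+ 2 * expR (cabs h)) =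
  3 * cabs (cexp z) * cabs h ^+ 2 * expR (cabs h) by ring.
have -> : cabs h * (3 * cabs (cexp z) * expR 1) * cabs h =
  3 * cabs (cexp z) * cabs h ^+ 2 * expR 1 by ring.
by rewrite ler_wpM2l// !mulr_ge0// ltW.
Qed.

End ComplexExponential.

(** * Integrals of continuous functions over segments *)

Section Integral.
Variable R : realType.
Local Notation C := R[i].
Local Notation mu := (@lebesgue_measure R).
Implicit Types (a b x : R) (u v : R -> R) (f g : R -> C).

Definition rint a b u : R := Rintegral mu `[a, b]%classic u.
(** Continuity is two-sided even at [a] and [b]: all integrands here are continuous on a
    neighbourhood of the segment, and no subspace topology has to be carried along. *)
Definition rcts a b u := forall x, a <= x <= b -> u y @[y --> x] --> u x.

Lemma rcts_integrable a b u : rcts a b u -> mu.-integrable `[a, b]%classic (EFin \o u).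
Proof.
move=> cu; apply: continuous_compact_integrable; first exact: segment_compact.
by apply: continuous_in_subspaceT => x; rewrite inE /= in_itv /= => /cu.
Qed.

Lemma rintD a b u v : rcts a b u -> rcts a b v ->
  rint a b (fun x => u x + v x) = rint a b u + rint a b v.
Proof. by move=> cu cv; apply: RintegralD => //; exact: rcts_integrable. Qed.

Lemma rintZ a b c u : rcts a b u -> rint a b (fun x => c * u x) = c * rint a b u.
Proof. by move=> cu; apply: RintegralZl => //; exact: rcts_integrable. Qed.

Lemma rint_le a b u v : rcts a b u -> rcts a b v ->
  (forall x, a <= x <= b -> u x <= v x) -> rint a b u <= rint a b v.
Proof.
move=> cu cv uv; apply: le_Rintegral => //; exact: rcts_integrable.
Qed.

Lemma eq_rint a b u v : (forall x, a <= x <= b -> u x = v x) -> rint a b u = rint a b v.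
Proof. by move=> uv; apply: eq_Rintegral => x; rewrite inE /= in_itv; exact: uv. Qed.

Lemma rint_cst a b c : a <= b -> rint a b (fun=> c) = c * (b - a).
Proof.
move=> ab; rewrite /rint Rintegral_cst//=; have -> := @lebesgue_measure_itv R `[a, b]; rewrite /=.
rewrite lte_fin; have [//|ba] := ltP a b; rewrite (_ : a = b) ?subrr//; lra.
Qed.

Lemma rint_split a m b u : a <= m <= b -> rcts a b u ->
  rint a b u = rint a m u + rint m b u.
Proof.
move=> /andP[am mb] cu; have iu := rcts_integrable cu.
have := @Rintegral_itvB R u (BLeft a) (BRight b) m iu.
rewrite !bnd_simp => /(_ am mb) h.
rewrite /rint -[LHS](subrK (Rintegral mu `[a, m]%classic u)) h addrC.
rewrite Rintegral_itv_obnd_cbnd//.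
by apply: integrableS iu => //; apply: subset_itvr; rewrite bnd_simp.
Qed.

Definition cint a b f : C := Complex (rint a b (Re \o f)) (rint a b (Im \o f)).
Definition icts a b f := forall x, a <= x <= b -> clim (nbhs x) f (f x).

Lemma icts_Re a b f : icts a b f -> rcts a b (Re \o f).
Proof. by move=> cf x /cf /clim_Re. Qed.
Lemma icts_Im a b f : icts a b f -> rcts a b (Im \o f).
Proof. by move=> cf x /cf /clim_Im. Qed.
Lemma ictsD a b f g : icts a b f -> icts a b g -> icts a b (fun x => f x + g x).
Proof. by move=> cf cg x xab; apply: climD; [exact: cf|exact: cg]. Qed.
Lemma ictsM a b f g : icts a b f -> icts a b g -> icts a b (fun x => f x * g x).
Proof. by move=> cf cg x xab; apply: climM; [exact: cf|exact: cg]. Qed.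
Lemma icts_cst a b (c : C) : icts a b (fun=> c).
Proof. by move=> x _; exact: clim_cst. Qed.
Lemma ictsN a b f : icts a b f -> icts a b (fun x => - f x).
Proof. by move=> cf x xab; apply: climN; exact: cf. Qed.
Lemma ictsB a b f g : icts a b f -> icts a b g -> icts a b (fun x => f x - g x).
Proof. by move=> cf cg; apply: ictsD => //; exact: ictsN. Qed.
Lemma ictsV a b f : (forall x, a <= x <= b -> f x != 0) -> icts a b f ->
  icts a b (fun x => (f x)^-1).
Proof. by move=> f0 cf x xab; apply: climV; [exact: f0|exact: cf]. Qed.

Lemma eq_cint a b f g : (forall x, a <= x <= b -> f x = g x) -> cint a b f = cint a b g.
Proof. by move=> fg; apply: complexP; apply: eq_rint => x /fg /= ->. Qed.

Lemma cintD a b f g : icts a b f -> icts a b g ->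
  cint a b (fun x => f x + g x) = cint a b f + cint a b g.
Proof.
move=> cf cg; apply: complexP; rewrite !ReImE /= -rintD; try exact: icts_Re; try exact: icts_Im.
  by apply: eq_rint => x _ /=; rewrite cReD.
by apply: eq_rint => x _ /=; rewrite cImD.
Qed.

Lemma cintZ a b (c : C) f : icts a b f -> cint a b (fun x => c * f x) = c * cint a b f.
Proof.
move=> cf; have cr := icts_Re cf; have ci := icts_Im cf.
have cZ u k : rcts a b u -> rcts a b (fun x => k * u x).
  by move=> cu x xab; apply: cvgMr; exact: cu.
apply: complexP; rewrite !ReImE /=.
  rewrite -mulNr -!rintZ// -rintD; [|exact: cZ..].
  by apply: eq_rint => x _; rewrite mulNr; rewrite [LHS]/=; set Q := f x; rewrite /comp -/Q; case: c Q => ? ? [].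
rewrite -!rintZ// -rintD; [|exact: cZ..].
by apply: eq_rint => x _; rewrite [LHS]/=; set Q := f x; rewrite /comp -/Q; case: c Q => ? ? [].
Qed.

Lemma cintN a b f : icts a b f -> cint a b (fun x => - f x) = - cint a b f.
Proof.
move=> cf; rewrite -mulN1r -cintZ//; apply: eq_cint => x _; by rewrite mulN1r.
Qed.

Lemma cintB a b f g : icts a b f -> icts a b g ->
  cint a b (fun x => f x - g x) = cint a b f - cint a b g.
Proof. by move=> cf cg; rewrite cintD ?cintN//; exact: ictsN. Qed.

Lemma cint_cst a b (c : C) : a <= b -> cint a b (fun=> c) = c * (b - a)%:C%C.
Proof. by move=> ab; apply: complexP; rewrite !ReImE /= rint_cst//; ring. Qed.

Lemma cint_split a m b f : a <= m <= b -> icts a b f ->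
  cint a b f = cint a m f + cint m b f.
Proof.
move=> amb cf; apply: complexP; rewrite !ReImE /=; apply: rint_split => //.
  exact: icts_Re.
exact: icts_Im.
Qed.

Lemma norm_rint a b u K : a <= b -> rcts a b u -> (forall x, a <= x <= b -> `|u x| <= K) ->
  `|rint a b u| <= K * (b - a).
Proof.
move=> ab cu uK; rewrite ler_norml -mulNr -!rint_cst//.
have cc k : rcts a b (fun=> k) by move=> x _; exact: cvg_cst.
by apply/andP; split; apply: rint_le => // x /uK; rewrite ler_norml => /andP[].
Qed.

(** The factor 2 comes from bounding real and imaginary parts separately. It is harmless, as every
    use only needs the order of magnitude. *)
Lemma cabs_cint a b f K : a <= b -> icts a b f -> (forall x, a <= x <= b -> cabs (f x) <= K) ->
  cabs (cint a b f) <= 2 * K * (b - a).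
Proof.
move=> ab cf fK; apply: le_trans (ler_cabs_ReIm _) _ => /=.
have -> : 2 * K * (b - a) = K * (b - a) + K * (b - a) by ring.
apply: lerD; apply: norm_rint => //.
- exact: icts_Re.
- by move=> x /fK; apply: le_trans; exact: ler_Re_cabs.
- exact: icts_Im.
- by move=> x /fK; apply: le_trans; exact: ler_Im_cabs.
Qed.

Lemma cint_point a f : cint a a f = 0.
Proof. by apply: complexP; rewrite /= /rint set_itv1 Rintegral_set1. Qed.

End Integral.

(** * Cauchy's theorem *)

Section Goursat.
Variable R : realType.
Local Notation C := R[i].
Local Notation ii := (Complex 0 1 : C).
Implicit Types (F G : C -> C) (x y w h : R) (z : C).

Lemma clim_horizontal (y x : R) : clim (nbhs x) (fun t => Complex t y) (Complex x y).
Proof. by apply: clim_ReIm; [exact: cvg_id|exact: cvg_cst]. Qed.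
Lemma clim_vertical (x y : R) : clim (nbhs y) (fun t => Complex x t) (Complex x y).
Proof. by apply: clim_ReIm; [exact: cvg_cst|exact: cvg_id]. Qed.

Definition rect x y w h : set C := [set z | x <= Re z <= x + w /\ y <= Im z <= y + h].

(** The counterclockwise contour integral along the boundary of the rectangle, with [dz = dt] on
    horizontal sides and [dz = i dt] on vertical ones. *)
Definition rectint F x y w h : C :=
  (cint x (x + w) (fun t => F (Complex t y)) - cint x (x + w) (fun t => F (Complex t (y + h)))) +
  ii * (cint y (y + h) (fun t => F (Complex (x + w) t)) - cint y (y + h) (fun t => F (Complex x t))).

Definition ctsr F x y w h := forall z, rect x y w h z -> ccts F z.

Lemma icts_horizontal F a b s : (forall t, a <= t <= b -> ccts F (Complex t s)) ->
  icts a b (fun t => F (Complex t s)).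
Proof.
move=> cF t tab; apply: (@clim_comp _ _ _ _ (fun t => Complex t s) F (Complex t s)) => //.
  exact: clim_horizontal.
exact: cF.
Qed.
Lemma icts_vertical F a b s : (forall t, a <= t <= b -> ccts F (Complex s t)) ->
  icts a b (fun t => F (Complex s t)).
Proof.
move=> cF t tab; apply: (@clim_comp _ _ _ _ (fun t => Complex s t) F (Complex s t)) => //.
  exact: clim_vertical.
exact: cF.
Qed.

Lemma ctsr_h F x y w h s : ctsr F x y w h -> y <= s <= y + h ->
  icts x (x + w) (fun t => F (Complex t s)).
Proof. by move=> cF yh; apply: icts_horizontal => t tx; apply: cF. Qed.
Lemma ctsr_v F x y w h s : ctsr F x y w h -> x <= s <= x + w ->
  icts y (y + h) (fun t => F (Complex s t)).
Proof. by move=> cF yh; apply: icts_vertical => t tx; apply: cF. Qed.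

Lemma rect_sub x y w h x' y' w' h' : x <= x' -> x' + w' <= x + w -> y <= y' -> y' + h' <= y + h ->
  rect x' y' w' h' `<=` rect x y w h.
Proof. by move=> a b c d z [/andP[e f] /andP[g k]]; split; apply/andP; split; lra. Qed.

Lemma rectint_splitx F x y w1 w2 h : 0 <= w1 -> 0 <= w2 -> 0 <= h -> ctsr F x y (w1 + w2) h ->
  rectint F x y (w1 + w2) h = rectint F x y w1 h + rectint F (x + w1) y w2 h.
Proof.
move=> w10 w20 h0 cF; rewrite /rectint addrA.
have m : x <= x + w1 <= x + (w1 + w2) by apply/andP; split; lra.
have e : x + w1 + w2 = x + (w1 + w2) by rewrite addrA.
rewrite -e in m; rewrite !(cint_split m) -?e; first by ring.
  by rewrite e; apply: ctsr_h cF _; rewrite lerDl h0 lexx.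
by rewrite e; apply: ctsr_h cF _; rewrite lerDl h0 lexx.
Qed.

Lemma rectint_splity F x y w h1 h2 : 0 <= h1 -> 0 <= h2 -> 0 <= w -> ctsr F x y w (h1 + h2) ->
  rectint F x y w (h1 + h2) = rectint F x y w h1 + rectint F x (y + h1) w h2.
Proof.
move=> w10 w20 h0 cF; rewrite /rectint.
have e : y + h1 + h2 = y + (h1 + h2) by rewrite addrA.
have m : y <= y + h1 <= y + h1 + h2 by apply/andP; split; lra.
rewrite -!e !(cint_split m); first by ring.
  by rewrite e; apply: ctsr_v cF _; rewrite lerDl h0 lexx.
by rewrite e; apply: ctsr_v cF _; rewrite lerDl h0 lexx.
Qed.

Lemma rectintB F G x y w h : 0 <= w -> 0 <= h -> ctsr F x y w h -> ctsr G x y w h ->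
  rectint (fun z => F z - G z) x y w h = rectint F x y w h - rectint G x y w h.
Proof.
move=> w0 h0 cF cG; rewrite /rectint.
have a1 : y <= y <= y + h by rewrite lexx lerDl.
have a2 : y <= y + h <= y + h by rewrite lexx lerDl h0.
have a3 : x <= x <= x + w by rewrite lexx lerDl.
have a4 : x <= x + w <= x + w by rewrite lexx lerDl w0.
rewrite !cintB; first by ring.
all: by [apply: (ctsr_h cF)|apply: (ctsr_h cG)|apply: (ctsr_v cF)|apply: (ctsr_v cG)].
Qed.

(** On opposite sides the integrand differs by the constants [- c1 i h] and [c1 w], whose
    contributions cancel; no primitive is involved. *)
Lemma rectint_affine (c0 c1 : C) x y w h : 0 <= w -> 0 <= h ->
  rectint (fun z => c0 + c1 * z) x y w h = 0.
Proof.
move=> w0 h0; rewrite /rectint.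
have ca z : ccts (fun z => c0 + c1 * z) z.
  by apply: climD; [exact: clim_cst|apply: climM; [exact: clim_cst|exact: ccts_id]].
have cr : ctsr (fun z => c0 + c1 * z) x y w h by move=> z _.
have a1 : y <= y <= y + h by rewrite lexx lerDl.
have a2 : y <= y + h <= y + h by rewrite lexx lerDl h0.
have a3 : x <= x <= x + w by rewrite lexx lerDl.
have a4 : x <= x + w <= x + w by rewrite lexx lerDl w0.
rewrite -!cintB; try (exact: (ctsr_h cr)); try (exact: (ctsr_v cr)).
rewrite (@eq_cint _ _ _ _ (fun=> - (c1 * (ii * h%:C%C)))); last first.
  move=> t _; have -> : Complex t (y + h) = Complex t y + ii * h%:C%C.
    by apply: complexP; rewrite !ReImE /=; ring.
  ring.
rewrite (@eq_cint _ y _ _ (fun=> c1 * w%:C%C)); last first.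
  move=> t _; have -> : Complex (x + w) t = Complex x t + w%:C%C.
    by apply: complexP; rewrite !ReImE /=; ring.
  ring.
rewrite !cint_cst ?lerDl//.
have -> : x + w - x = w by ring.
have -> : y + h - y = h by ring.
ring.
Qed.

Lemma cabs_rectint F x y w h K : 0 <= w -> 0 <= h -> ctsr F x y w h ->
  (forall z, rect x y w h z -> cabs (F z) <= K) ->
  cabs (rectint F x y w h) <= 4 * K * (w + h).
Proof.
move=> w0 h0 cF FK; rewrite /rectint.
have a1 : y <= y <= y + h by rewrite lexx lerDl.
have a2 : y <= y + h <= y + h by rewrite lexx lerDl h0.
have a3 : x <= x <= x + w by rewrite lexx lerDl.
have a4 : x <= x + w <= x + w by rewrite lexx lerDl w0.
apply: le_trans (cabsD _ _) _; rewrite cabsM.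
have -> : cabs ii = 1 by rewrite cabsE /= expr0n add0r expr1n sqrtr1.
rewrite mul1r; apply: le_trans (lerD (cabsB _ _) (cabsB _ _)) _.
have hh s : y <= s <= y + h -> cabs (cint x (x + w) (fun t => F (Complex t s))) <= 2 * K * w.
  move=> sy; apply: le_trans (cabs_cint (K := K) _ _ _) _.
  - by rewrite lerDl.
  - exact: (ctsr_h cF sy).
  - by move=> t tx; apply: FK.
  - by have -> : x + w - x = w by ring.
have vv s : x <= s <= x + w -> cabs (cint y (y + h) (fun t => F (Complex s t))) <= 2 * K * h.
  move=> sy; apply: le_trans (cabs_cint (K := K) _ _ _) _.
  - by rewrite lerDl.
  - exact: (ctsr_v cF sy).
  - by move=> t tx; apply: FK.
  - by have -> : y + h - y = h by ring.
have := hh _ a1; have := hh _ a2; have := vv _ a3; have := vv _ a4; lra.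
Qed.

Lemma rectint_w0 F x y h : rectint F x y 0 h = 0.
Proof. by rewrite /rectint addr0 !cint_point !subrr mulr0 addr0. Qed.
Lemma rectint_h0 F x y w : rectint F x y w 0 = 0.
Proof. by rewrite /rectint addr0 !cint_point !subrr mulr0 addr0. Qed.

Lemma ctsr_sub F x y w h x' y' w' h' : x <= x' -> x' + w' <= x + w -> y <= y' -> y' + h' <= y + h ->
  ctsr F x y w h -> ctsr F x' y' w' h'.
Proof. by move=> a b c d cF z zr; apply: cF; apply: rect_sub zr. Qed.

Lemma rectint_quarter F x y w h : 0 <= w -> 0 <= h -> ctsr F x y w h ->
  exists s : R * R, [/\ x <= s.1, s.1 + w / 2 <= x + w, y <= s.2, s.2 + h / 2 <= y + h &
    cabs (rectint F x y w h) <= 4 * cabs (rectint F s.1 s.2 (w / 2) (h / 2))].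
Proof.
move=> w0 h0 cF.
have w20 : 0 <= w / 2 by lra.
have h20 : 0 <= h / 2 by lra.
have ew : w / 2 + w / 2 = w by lra.
have eh : h / 2 + h / 2 = h by lra.
pose J x' y' := rectint F x' y' (w / 2) (h / 2).
have sy x' : x <= x' -> x' + w / 2 <= x + w ->
    rectint F x' y (w / 2) h = J x' y + J x' (y + h / 2).
  move=> a b; rewrite -[in LHS]eh rectint_splity// eh.
  by apply: ctsr_sub cF => //; lra.
have e : rectint F x y w h =
  J x y + J x (y + h / 2) + (J (x + w / 2) y + J (x + w / 2) (y + h / 2)).
  by rewrite -[in LHS]ew rectint_splitx ?ew// !sy//; lra.
have x1 : x + w / 2 <= x + w by lra.
have x2 : x <= x + w / 2 by lra.
have x3 : x + w / 2 + w / 2 <= x + w by lra.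
have y1 : y + h / 2 <= y + h by lra.
have y2 : y <= y + h / 2 by lra.
have y3 : y + h / 2 + h / 2 <= y + h by lra.
have : cabs (rectint F x y w h) <=
    cabs (J x y) + cabs (J x (y + h / 2)) + (cabs (J (x + w / 2) y) + cabs (J (x + w / 2) (y + h / 2))).
  by rewrite e (le_trans (cabsD _ _))// lerD// cabsD.
set N := cabs (rectint F x y w h) => NJ.
have [h1|h1] := leP N (4 * cabs (J x y)); first by exists (x, y); split.
have [h2|h2] := leP N (4 * cabs (J x (y + h / 2))); first by exists (x, y + h / 2); split.
have [h3|h3] := leP N (4 * cabs (J (x + w / 2) y)); first by exists (x + w / 2, y); split.
have [h4|h4] := leP N (4 * cabs (J (x + w / 2) (y + h / 2))).
  by exists (x + w / 2, y + h / 2); split.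
exfalso; move: NJ h1 h2 h3 h4; move: N (cabs (J x y)) (cabs (J x (y + h / 2))) (cabs (J (x + w / 2) y)) (cabs (J (x + w / 2) (y + h / 2))).
clear; move=> *; lra.
Qed.

Lemma nested_intervals (s d : R ^nat) : (forall n, 0 <= d n) -> (forall n, s n <= s n.+1) ->
  (forall n, s n.+1 + d n.+1 <= s n + d n) -> exists x, forall n, s n <= x <= s n + d n.
Proof.
move=> d0 s1 s2.
have sm m n : (m <= n)%N -> s m <= s n.
  move=> /subnK <-; elim: (n - m)%N => [|k IH]; first by rewrite add0n.
  by rewrite addSn (le_trans IH).
have dm m n : (m <= n)%N -> s n + d n <= s m + d m.
  move=> /subnK <-; elim: (n - m)%N => [|k IH]; first by rewrite add0n.
  by rewrite addSn (le_trans _ IH).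
have sd m n : s m <= s n + d n.
  have := sm _ _ (leq_maxl m n); have := dm _ _ (leq_maxr m n); have := d0 (maxn m n); lra.
exists (sup (range s)) => n; apply/andP; split.
  by apply: ub_le_sup; [exists (s 0%N + d 0%N) => _ [k _ <-]|exists n].
by apply: ge_sup; [exists (s 0%N), 0%N|move=> _ [k _ <-]].
Qed.

Lemma exists_expn2_lt (c e : R) : 0 < e -> exists n, c / 2 ^+ n < e.
Proof.
move=> e0; have [n _ H] : \forall n \near \oo, `|c| / e < n%:R.
  by exact: nbhs_infty_gtr.
exists n; have hn : `|c| / e < n%:R by exact: H n (leqnn n).
rewrite ltr_pdivrMr ?exprn_gt0//.
rewrite ltr_pdivrMr// in hn.
apply: le_lt_trans (ler_norm c) _; apply: lt_le_trans hn _.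
by rewrite mulrC ler_pM2l// -natrX ler_nat ltnW// ltn_expl.
Qed.

(** Repeated quartering costs a factor [4^n]. Around the limit point [F] is affine up to
    [e |z - z0|]; the affine part integrates to zero, and the remainder contributes [e] times
    diameter times perimeter, which is of order [e 4^-n]. *)
Theorem goursat F x y w h : 0 <= w -> 0 <= h ->
  (forall z, rect x y w h z -> cdifferentiable F z) -> rectint F x y w h = 0.
Proof.
move=> w0 h0 dF.
have cF : ctsr F x y w h by move=> z /dF /cdifferentiableP[l /cder_ccts].
pose W n := w / 2 ^+ n; pose H n := h / 2 ^+ n.
have W0 n : 0 <= W n by rewrite divr_ge0// exprn_ge0.
have H0 n : 0 <= H n by rewrite divr_ge0// exprn_ge0.
have WS n : W n / 2 = W n.+1 by rewrite /W exprSr invfM mulrA.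
have HS n : H n / 2 = H n.+1 by rewrite /H exprSr invfM mulrA.
pose inr n (s : R * R) := [/\ x <= s.1, s.1 + W n <= x + w, y <= s.2 & s.2 + H n <= y + h].
(* The condition of lying inside the big rectangle is a premise of the conclusion, so that the
   choice yields a total function that can be iterated. *)
have st_ex (p : nat * (R * R)) : exists s' : R * R, inr p.1 p.2 ->
   [/\ p.2.1 <= s'.1, s'.1 + W p.1.+1 <= p.2.1 + W p.1,
       p.2.2 <= s'.2, s'.2 + H p.1.+1 <= p.2.2 + H p.1 &
   cabs (rectint F p.2.1 p.2.2 (W p.1) (H p.1)) <=
    4 * cabs (rectint F s'.1 s'.2 (W p.1.+1) (H p.1.+1))].
  case: p => n s.
  have [[/= a b c d]|nin] := pselect (inr n s); last by exists s.
  have [|s' P] := @rectint_quarter F s.1 s.2 (W n) (H n) (W0 n) (H0 n).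
    exact: ctsr_sub cF.
  by exists s' => _ /=; rewrite -WS -HS.
have [st stP] := boolp.choice st_ex.
pose sq := fix sq n := if n is m.+1 then st (m, sq m) else (x, y).
have inS n : inr n (sq n).
  elim: n => [|n IH]; first by split=> //=; rewrite /W /H expr0 divr1.
  by have [/= a b c d _] := stP (n, sq n) IH; case: IH => ? ? ? ?; split=> /=; lra.
have big n : cabs (rectint F x y w h) <= 4 ^+ n * cabs (rectint F (sq n).1 (sq n).2 (W n) (H n)).
  elim: n => [|n IH]; first by rewrite expr0 mul1r /W /H expr0 !divr1.
  apply: le_trans IH _; rewrite exprSr -mulrA ler_pM2l ?exprn_gt0//.
  by have [] := stP (n, sq n) (inS n).
have [a aP] : exists a, forall n, (sq n).1 <= a <= (sq n).1 + W n.
  by apply: nested_intervals => // n; have [] := stP (n, sq n) (inS n).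
have [b bP] : exists b, forall n, (sq n).2 <= b <= (sq n).2 + H n.
  by apply: nested_intervals => // n; have [] := stP (n, sq n) (inS n).
have [l /cderP dl] : exists l, cder F (Complex a b) l.
  apply/cdifferentiableP/dF; split => /=.
    by have := aP 0%N; rewrite /W /= expr0 divr1.
  by have := bP 0%N; rewrite /H /= expr0 divr1.
have small e : 0 < e -> cabs (rectint F x y w h) <= 4 * e * (w + h) ^+ 2.
  move=> e0; have [d d0 hd] := dl e e0.
  have [n wn] := exists_expn2_lt (w + h) d0.
  have wnE : (w + h) / 2 ^+ n = W n + H n by rewrite mulrDl.
  apply: le_trans (big n) _.
  have [i1 i2 i3 i4] := inS n.
  have cFn : ctsr F (sq n).1 (sq n).2 (W n) (H n) by apply: ctsr_sub cF.
  pose A z := F (Complex a b) - l * Complex a b + l * z.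
  have cA : ctsr A (sq n).1 (sq n).2 (W n) (H n).
    move=> z _; apply: climD; first exact: clim_cst.
    by apply: climM; [exact: clim_cst|exact: ccts_id].
  have -> : rectint F (sq n).1 (sq n).2 (W n) (H n) =
      rectint (fun z => F z - A z) (sq n).1 (sq n).2 (W n) (H n).
    by rewrite rectintB// /A rectint_affine// subr0.
  have := @cabs_rectint (fun z => F z - A z) (sq n).1 (sq n).2 (W n) (H n) (e * (W n + H n))
     (W0 n) (H0 n).
  have p4 : 0 < 4 ^+ n :> R by rewrite exprn_gt0.
  move=> HH; apply: le_trans (ler_wpM2l (ltW p4) (HH _ _)) _.
  - by move=> z zr; apply: climB; [exact: cFn|exact: cA].
  - move=> z [/andP[z1 z2] /andP[z3 z4]].
    have /andP[a1 a2] := aP n; have /andP[b1 b2] := bP n.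
    have zd : cabs (z - Complex a b) <= W n + H n.
      apply: le_trans (ler_cabs_ReIm _) _; rewrite !ReImE /=.
      by apply: lerD; rewrite ler_norml; apply/andP; split; lra.
    have := hd (z - Complex a b); rewrite -wnE in zd * => /(_ (le_lt_trans zd wn)).
    have -> : Complex a b + (z - Complex a b) = z by ring.
    have -> : F z - F (Complex a b) - l * (z - Complex a b) = F z - A z by rewrite /A; ring.
    by move=> /le_trans; apply; rewrite ler_wpM2l// ltW.
  - rewrite -wnE le_eqVlt; apply/orP; left; apply/eqP.
    have -> : 4 = 2 ^+ 2 :> R by rewrite expr2; ring.
    rewrite -exprM mulnC exprM; field.
    by rewrite expf_neq0// pnatr_eq0.
apply/eqP; rewrite -cabs_eq0; apply/negPn/negP => n0.
have N0 : 0 < cabs (rectint F x y w h) by rewrite lt_def n0 cabs_ge0.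
have q0 : 0 < 8 * ((w + h) ^+ 2 + 1) by rewrite mulr_gt0// ltr_wpDl// sqr_ge0.
have := small _ (divr_gt0 N0 q0); apply/negP; rewrite -ltNge.
set N := cabs _ in N0 *.
have -> : 4 * (N / (8 * ((w + h) ^+ 2 + 1))) * (w + h) ^+ 2 =
   N * (4 * (w + h) ^+ 2) / (8 * ((w + h) ^+ 2 + 1)) by ring.
rewrite ltr_pdivrMr// ltr_pM2l//; have := sqr_ge0 (w + h); lra.
Qed.

(** The device for all limits [e -> 0] below: a modulus bounded by a fixed multiple of every small
    [e] is zero. *)
Lemma le_epsilon0 (r c d : R) : 0 < d -> (forall e : R, 0 < e -> e < d -> r <= c * e) -> r <= 0.
Proof.
move=> d0 H; rewrite leNgt; apply/negP => r0.
have q0 : 0 < `|c| + 1 by rewrite ltr_wpDl.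
pose e := Num.min (d / 2) (r / (2 * (`|c| + 1))).
have e0 : 0 < e by rewrite lt_min !divr_gt0// mulr_gt0.
have ed : e < d by rewrite gt_min; apply/orP; left; lra.
have := H e e0 ed; apply/negP; rewrite -ltNge.
have er : e * (2 * (`|c| + 1)) <= r by rewrite -ler_pdivlMr ?mulr_gt0// ge_min lexx orbT.
have := ler_wpM2r (ltW e0) (ler_norm c); nra.
Qed.

Lemma rectint_trimx F x y w h x1 x2 : 0 <= h -> ctsr F x y w h ->
  x <= x1 -> x1 <= x2 -> x2 <= x + w -> rectint F x y (x1 - x) h = 0 ->
  rectint F x2 y (x + w - x2) h = 0 -> rectint F x y w h = rectint F x1 y (x2 - x1) h.
Proof.
move=> h0 cF xx1 x12 x2w L0 R0.
have ew : w = (x1 - x) + (x2 - x1 + (x + w - x2)) by ring.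
have cF' : ctsr F x y (x1 - x + (x2 - x1 + (x + w - x2))) h by rewrite -ew.
rewrite [in LHS]ew rectint_splitx//; [|lra..].
rewrite L0 add0r addrC subrK rectint_splitx//; [|lra|lra|]; last by apply: ctsr_sub cF => //; lra.
have -> : x1 + (x2 - x1) = x2 by ring.
by rewrite R0 addr0.
Qed.

Lemma rectint_trimy F x y w h y1 y2 : ctsr F x y w h -> 0 <= w ->
  y <= y1 -> y1 <= y2 -> y2 <= y + h -> rectint F x y w (y1 - y) = 0 ->
  rectint F x y2 w (y + h - y2) = 0 -> rectint F x y w h = rectint F x y1 w (y2 - y1).
Proof.
move=> cF w0 yy1 y12 y2h L0 R0.
have ew : h = (y1 - y) + (y2 - y1 + (y + h - y2)) by ring.
have cF' : ctsr F x y w (y1 - y + (y2 - y1 + (y + h - y2))) by rewrite -ew.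
rewrite [in LHS]ew rectint_splity//; [|lra..].
rewrite L0 add0r addrC subrK rectint_splity//; [|lra|lra|]; last by apply: ctsr_sub cF => //; lra.
have -> : y1 + (y2 - y1) = y2 by ring.
by rewrite R0 addr0.
Qed.

(* The exceptional point is enclosed in a square of side [2 e], on whose boundary
   [F] is bounded; the remaining strips contain no exceptional point. *)
Lemma goursat_except1 F x y w h (a : C) : 0 <= w -> 0 <= h -> ctsr F x y w h ->
  (forall z, rect x y w h z -> z != a -> cdifferentiable F z) -> rectint F x y w h = 0.
Proof.
move=> w0 h0 cF dF.
have [[/andP[xa ax] /andP[ya ay]]|nra] := pselect (rect x y w h a); last first.
  apply: goursat => // z zr; apply: dF => //; apply: contra_not_neq nra; by move=> <-.
have ca : ccts F a by apply: cF; split; apply/andP.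
have [d d0 hd] := ca 1 ltr01.
pose K := cabs (F a) + 1.
apply/eqP; rewrite -cabs_eq0 eq_le cabs_ge0 andbT.
have d40 : 0 < d / 4 by rewrite divr_gt0.
apply: (@le_epsilon0 _ (16 * K) _ d40) => e e0 ed.
pose x1 : R := Num.max x (Re a - e); pose x2 : R := Num.min (x + w) (Re a + e).
pose y1 : R := Num.max y (Im a - e); pose y2 : R := Num.min (y + h) (Im a + e).
have x1P : x <= x1 /\ x1 <= Re a /\ Re a - e <= x1 /\ (x1 = x \/ x1 < Re a).
  rewrite /x1; have [h1|h1] := leP (Re a - e) x; first by do !split=> //; left.
  by do !split => //; [lra|lra|right; lra].
have x2P : x2 <= x + w /\ Re a <= x2 /\ x2 <= Re a + e /\ (x2 = x + w \/ Re a < x2).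
  rewrite /x2; have [h1|h1] := leP (x + w) (Re a + e); first by do !split=> //; left.
  by do !split => //; [lra|lra|right; lra].
have y1P : y <= y1 /\ y1 <= Im a /\ Im a - e <= y1 /\ (y1 = y \/ y1 < Im a).
  rewrite /y1; have [h1|h1] := leP (Im a - e) y; first by do !split=> //; left.
  by do !split => //; [lra|lra|right; lra].
have y2P : y2 <= y + h /\ Im a <= y2 /\ y2 <= Im a + e /\ (y2 = y + h \/ Im a < y2).
  rewrite /y2; have [h1|h1] := leP (y + h) (Im a + e); first by do !split=> //; left.
  by do !split => //; [lra|lra|right; lra].
move: x1 x2 y1 y2 x1P x2P y1P y2P => x1 x2 y1 y2
 [x11 [x12 [x13 x14]]] [x21 [x22 [x23 x24]]] [y11 [y12 [y13 y14]]] [y21 [y22 [y23 y24]]].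
have strip x' y' w' h' : x <= x' -> x' + w' <= x + w -> y <= y' -> y' + h' <= y + h ->
   0 <= w' -> 0 <= h' -> ~ rect x' y' w' h' a -> rectint F x' y' w' h' = 0.
  move=> h1 h2 h3 h4 w'0 h'0 na; apply: goursat => // z zr; apply: dF.
    by apply: rect_sub zr.
  by apply: contra_not_neq na => <-.
have -> : rectint F x y w h = rectint F x1 y (x2 - x1) h.
  apply: rectint_trimx => //; first exact: le_trans x12 x22.
    case: x14 => [->|h1]; first by rewrite subrr rectint_w0.
    by clear -x11 x12 w0 h0 h1 x21 x22 strip; apply: strip => //; [lra|lra|move=> [/andP[? ?] _]; lra].
  case: x24 => [->|h1]; first by rewrite subrr rectint_w0.
  by clear -x11 x12 w0 h0 h1 x21 x22 strip; apply: strip => //; [lra|lra|lra|move=> [/andP[? ?] _]; lra].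
have x1x2 : x1 <= x2 by exact: le_trans x12 x22.
have -> : rectint F x1 y (x2 - x1) h = rectint F x1 y1 (x2 - x1) (y2 - y1).
  apply: rectint_trimy => //; [|by rewrite subr_ge0|exact: le_trans y12 y22| |].
  - by clear -x1x2 x11 x21 h0 cF; apply: ctsr_sub cF => //; lra.
  - case: y14 => [->|h1]; first by rewrite subrr rectint_h0.
    by clear -x1x2 x11 x21 h0 h1 y11 y12 y21 y22 strip; apply: strip => //; [lra|lra|lra|lra|move=> [_ /andP[? ?]]; lra].
  - case: y24 => [->|h1]; first by rewrite subrr rectint_h0.
    by clear -x1x2 x11 x21 h0 h1 y11 y12 y21 y22 strip; apply: strip => //; [lra|lra|lra|lra|lra|move=> [_ /andP[? ?]]; lra].
have y1y2 : y1 <= y2 by exact: le_trans y12 y22.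
clear strip x14 x24 y14 y24 dF.
apply: le_trans (cabs_rectint (K := K) _ _ _ _) _; [lra|lra| | |].
- by apply: ctsr_sub cF => //; lra.
- move=> z [/andP[z1 z2] /andP[z3 z4]].
  have zd : cabs (z - a) < d.
    apply: le_lt_trans (ler_cabs_ReIm _) _; rewrite !ReImE.
    have : `|Re z - Re a| <= e by rewrite ler_norml; apply/andP; split; lra.
    have : `|Im z - Im a| <= e by rewrite ler_norml; apply/andP; split; lra.
    lra.
  have := hd _ zd; have := cabsD (F z - F a) (F a); rewrite subrK /K; lra.
- have K0 : 0 <= K by rewrite addr_ge0// cabs_ge0.
  have : x2 - x1 + (y2 - y1) <= 4 * e by lra.
  move=> /(ler_wpM2l (_ : 0 <= 4 * K)); rewrite mulr_ge0// => /(_ isT); lra.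
Qed.

(** Periodicity makes the vertical sides cancel, so the two horizontal integrals agree. Two
    exceptional points are needed because a bad point on the left side reappears on the right one;
    their abscissas differ, so a vertical cut halfway leaves at most one in each piece. *)
Lemma periodic_cint F x y w h a b : 0 <= w -> 0 <= h -> ctsr F x y w h ->
  Re a < Re b ->
  (forall z, rect x y w h z -> z != a -> z != b -> cdifferentiable F z) ->
  (forall s, y <= s <= y + h -> F (Complex (x + w) s) = F (Complex x s)) ->
  cint x (x + w) (fun t => F (Complex t y)) = cint x (x + w) (fun t => F (Complex t (y + h))).
Proof.
move=> w0 h0 cF ab dF per.
have : rectint F x y w h = 0.
  pose m := (Re a + Re b) / 2.
  have [h1|h1] := leP m x.
    apply: (@goursat_except1 _ _ _ _ _ b) => // z zr zb; apply: dF => //.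
    by case: zr => /andP[? ?] _; apply/eqP => za; move: ab h1; rewrite /m -za; lra.
  have [h2|h2] := leP (x + w) m.
    apply: (@goursat_except1 _ _ _ _ _ a) => // z zr za; apply: dF => //.
    by case: zr => /andP[? ?] _; apply/eqP => zb; move: ab h2; rewrite /m -zb; lra.
  have -> : w = (m - x) + (x + w - m) by ring.
  rewrite rectint_splitx//; [|lra|lra|]; last by apply: ctsr_sub cF => //; lra.
  have -> : x + (m - x) = m by ring.
  rewrite (@goursat_except1 _ _ _ _ _ a)//; [|lra| |]; last 2 first.
  - by apply: ctsr_sub cF => //; lra.
  - move=> z zr za; apply: dF => //; first by apply: rect_sub zr => //; lra.
    by case: zr => /andP[q1 q2] _; apply/eqP => zb; move: ab h1 h2 q1 q2; rewrite /m -zb; lra.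
  rewrite add0r (@goursat_except1 _ _ _ _ _ b)//; [lra| |].
  - by apply: ctsr_sub cF => //; lra.
  - move=> z zr zb; apply: dF => //; first by apply: rect_sub zr => //; lra.
    by case: zr => /andP[q1 q2] _; apply/eqP => za; move: ab h1 h2 q1 q2; rewrite /m -za; lra.
rewrite /rectint (@eq_cint _ y _ _ _ per) subrr mulr0 addr0 => /eqP.
by rewrite subr_eq0 => /eqP.
Qed.

End Goursat.

(** * Means over circles *)

Section CircleMeans.
Variable R : realType.
Local Notation C := R[i].
Local Notation ii := (Complex 0 1 : C).
Local Notation tpi := ((pi : R) *+ 2).
Implicit Types (f g : C -> C) (r s t : R) (z w : C).

Lemma tpi_gt0 : 0 < tpi.
Proof. by rewrite mulrn_wgt0// pi_gt0. Qed.

Lemma expi0 : expi 0 = 1 :> C. Proof. by rewrite /expi cos0 sin0. Qed.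
Lemma cabs_expi t : cabs (expi t) = 1.
Proof. by rewrite -cexpi cabs_cexp expR0. Qed.
Lemma expiD s t : expi (s + t) = expi s * expi t :> C.
Proof.
by rewrite -!cexpi -cexpD; congr cexp; apply: complexP; rewrite !ReImE /=; ring.
Qed.
Lemma expi_tpi : expi tpi = 1 :> C.
Proof. by rewrite /expi cos2pi sin2pi. Qed.
Lemma expiN t : expi (- t) = (expi t)^-1 :> C.
Proof.
rewrite -[LHS]mulr1 -[1](@mulfV _ (expi t)) -?cabs_gt0 ?cabs_expi//.
by rewrite mulrA -expiD addNr expi0 mul1r.
Qed.

Lemma expi_eq1 t : `|t| < tpi -> expi t = 1 -> t = 0.
Proof.
wlog t0 : t / 0 <= t => [H|].
  have [/H//|t0 tt e] := leP 0 t.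
  apply/eqP; rewrite -oppr_eq0; apply/eqP; apply: H; rewrite ?normrN//; first by lra.
  by rewrite expiN e invr1.
rewrite ger0_norm// => tt [c _].
apply/eqP; rewrite eq_le t0 andbT leNgt; apply/negP => tp.
have : 0 < sin (t / 2).
  by apply: sin_gt0_pi; move: tt; rewrite mulr2n => tt; apply/andP; split; lra.
have : cos t = 1 - 2 * sin (t / 2) ^+ 2.
  have e : t = (t / 2) *+ 2 by rewrite mulr2n; lra.
  by rewrite {1}e cos_mulr2n cos2sin2 mulr2n; ring.
rewrite c; move: (sin _) => S; nra.
Qed.

Lemma clim_expi t : clim (nbhs t) (@expi R) (expi t).
Proof. by apply: clim_ReIm; [exact: continuous_cos|exact: continuous_sin]. Qed.

Definition circ r t : C := r%:C%C * expi t.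

Lemma cabs_circ r t : 0 <= r -> cabs (circ r t) = r.
Proof. by move=> r0; rewrite cabsM cabs_expi mulr1 cabs_real ger0_norm. Qed.
Lemma clim_circ r t : clim (nbhs t) (circ r) (circ r t).
Proof. by apply: climM; [exact: clim_cst|exact: clim_expi]. Qed.
Lemma icts_circ a b r : icts a b (circ r).
Proof. by move=> t _; exact: clim_circ. Qed.
Lemma icts_comp_circ a b f r : (forall t, ccts f (circ r t)) -> icts a b (f \o circ r).
Proof.
move=> cf t _; apply: (@clim_comp _ _ _ _ (circ r) f (circ r t)) => //; first exact: clim_circ.
exact: cf.
Qed.
Lemma cdiff_ccts f z : cdifferentiable f z -> ccts f z.
Proof. by move=> /cdifferentiableP[l /cder_ccts]. Qed.
Lemma cder_cdiff f z l : cder f z l -> cdifferentiable f z.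
Proof. by move=> d; apply/cdifferentiableP; exists l. Qed.


Definition ravg (u : R -> R) : R := tpi^-1 * rint 0 tpi u.
Definition cavg (g : R -> C) : C := (tpi^-1)%:C%C * cint 0 tpi g.

Lemma Re_cavg (g : R -> C) : Re (cavg g) = ravg (Re \o g).
Proof. by rewrite /cavg cReM Rec Imc mul0r subr0. Qed.

Lemma ravg_cst c : ravg (fun=> c) = c.
Proof. by rewrite /ravg rint_cst ?ltW ?tpi_gt0// subr0 mulrCA mulVf ?mulr1// gt_eqF ?tpi_gt0. Qed.
Lemma ravg_le u v : rcts 0 tpi u -> rcts 0 tpi v -> (forall t, u t <= v t) -> ravg u <= ravg v.
Proof.
by move=> cu cv uv; rewrite /ravg ler_wpM2l ?invr_ge0 ?(ltW tpi_gt0)//; apply: rint_le => // t _; exact: uv.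
Qed.
Lemma ravgD u v : rcts 0 tpi u -> rcts 0 tpi v ->
  ravg (fun t => u t + v t) = ravg u + ravg v.
Proof. by move=> cu cv; rewrite /ravg rintD// mulrDr. Qed.
Lemma ravgZ c u : rcts 0 tpi u -> ravg (fun t => c * u t) = c * ravg u.
Proof. by move=> cu; rewrite /ravg rintZ// mulrCA. Qed.
Lemma eq_ravg u v : (forall t, u t = v t) -> ravg u = ravg v.
Proof. by move=> uv; congr ravg; apply/funext. Qed.

Lemma cavg_cst c : cavg (fun=> c) = c.
Proof.
rewrite /cavg cint_cst ?ltW ?tpi_gt0// subr0 mulrCA -real_complexM mulVf ?mulr1//.
by rewrite gt_eqF ?tpi_gt0.
Qed.
Lemma cavgD (g h : R -> C) : icts 0 tpi g -> icts 0 tpi h ->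
  cavg (fun t => g t + h t) = cavg g + cavg h.
Proof. by move=> cg ch; rewrite /cavg cintD// mulrDr. Qed.
Lemma cavgB (g h : R -> C) : icts 0 tpi g -> icts 0 tpi h ->
  cavg (fun t => g t - h t) = cavg g - cavg h.
Proof. by move=> cg ch; rewrite /cavg cintB// mulrBr. Qed.
Lemma cavgZ (c : C) (g : R -> C) : icts 0 tpi g -> cavg (fun t => c * g t) = c * cavg g.
Proof. by move=> cg; rewrite /cavg cintZ// mulrCA. Qed.
Lemma eq_cavg (g h : R -> C) : (forall t, g t = h t) -> cavg g = cavg h.
Proof. by move=> uv; congr cavg; apply/funext. Qed.
Lemma cabs_cavg (g : R -> C) K : icts 0 tpi g -> (forall t, 0 <= t <= tpi -> cabs (g t) <= K) ->
  cabs (cavg g) <= 2 * K.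
Proof.
move=> cg gK; rewrite /cavg cabsM cabs_real ger0_norm ?invr_ge0 ?(ltW tpi_gt0)//.
rewrite ler_pdivrMl ?tpi_gt0// mulrC.
by rewrite -[X in _ <= _ * X]subr0; apply: cabs_cint => //; rewrite ltW// tpi_gt0.
Qed.

(* In the coordinate [zeta] with [z = exp (i zeta)] circles are horizontal
   segments, and [zeta |-> f (exp (i zeta))] is periodic. *)
Lemma cavg_circ_const f r1 r2 w : 0 < r1 <= r2 ->
  (forall z, r1 <= cabs z <= r2 -> ccts f z) ->
  (forall z, r1 <= cabs z <= r2 -> z != w -> cdifferentiable f z) ->
  cavg (f \o circ r1) = cavg (f \o circ r2).
Proof.
move=> /andP[r10 r12] cf df; have r20 := lt_le_trans r10 r12.
pose e z := cexp (ii * z).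
pose F := f \o e.
have eE x y : e (Complex x y) = circ (expR (- y)) x.
  rewrite /e /circ -cexp_real -cexpi -cexpD; congr cexp.
  by apply: complexP; rewrite !ReImE /=; ring.
have ae z : cabs (e z) = expR (- Im z).
  by case: z => x y; rewrite eE cabs_circ// expR_ge0.
have de z : exists l, cder e z l.
  exists (cexp (ii * z) * ii).
  have d1 : cder (fun z => ii * z) z ii.
    by have := cder_affine ii 0 z; under [X in cder X]eq_fun do rewrite addr0.
  exact: (cder_comp d1 (cder_cexp (ii * z))).
have ln12 : ln r1 <= ln r2 by rewrite ler_ln ?posrE.
pose y := - ln r2; pose h := ln r2 - ln r1.
have yh : y + h = - ln r1 by rewrite /y /h; ring.
have re z : rect 0 y tpi h z -> r1 <= cabs (e z) <= r2.
  move=> [_]; rewrite yh /y ae => /andP[y1 y2].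
  have <- : expR (ln r1) = r1 by rewrite lnK.
  have <- : expR (ln r2) = r2 by rewrite lnK.
  by rewrite !ler_expR; apply/andP; split; lra.
have cF : ctsr F 0 y tpi h.
  move=> z /re zr; have [l /cder_ccts ce] := de z.
  by apply: clim_comp ce (cf _ zr) erefl.
(* Inside one period [w] has either a single preimage, and then [b = z0 + 1] is a dummy, or
   preimages only on the two vertical sides. *)
have [a [b [ab dF]]] : exists a b, Re a < Re b /\
   forall z, rect 0 y tpi h z -> z != a -> z != b -> e z != w.
  pose y0 := - ln (cabs w).
  have im z : e z = w -> Im z = y0.
    by move=> ew; rewrite /y0 -ew ae expRK opprK.
  have twice x x' : expi x = expi x' -> `|x - x'| < tpi -> x = x'.
    move=> ex /expi_eq1 H; apply/eqP; rewrite -subr_eq0 H//.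
    by rewrite expiD ex -expiD subrr expi0.
  have ex z z' : e z = w -> e z' = w -> expi (Re z) = expi (Re z') :> C.
    move=> ew ew'; have := im _ ew; have := im _ ew'; move: ew; rewrite -ew'.
    case: z => x u; case: z' {ew'} => x' u' ew /= iu' iu; move: ew; rewrite !eE iu iu'.
    move=> /mulfI; apply.
    by rewrite -cabs_gt0 cabs_real gtr0_norm expR_gt0.
  have [[z0 [z0e z0a z0b]]|no] := pselect (exists z, [/\ e z = w, 0 < Re z & Re z < tpi]).
    exists z0, (z0 + 1); split; first by rewrite cReD /= ltrDl.
    move=> z [/andP[xa xb] _] za _; apply: contra_not_neq (negP za) => ew.
    apply/eqP/complexP; last by rewrite !im.
    apply: twice; first exact: ex.
    by rewrite ltr_norml; apply/andP; split; lra.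
  exists (Complex 0 y0), (Complex tpi y0); split; first exact: tpi_gt0.
  move=> z [/andP[xa xb] _] za zb; apply: contra_not_neq no => ew.
  exists z; split => //; rewrite lt_neqAle ?xa ?xb ?andbT.
    by apply: contra za => /eqP z0; apply/eqP/complexP => //=; rewrite im.
  move: xb; rewrite add0r => -> ; rewrite andbT.
  by apply: contra zb => /eqP z0; apply/eqP/complexP => //=; rewrite im.
have h0 : 0 <= h by rewrite /h; lra.
have dF' z : rect 0 y tpi h z -> z != a -> z != b -> cdifferentiable F z.
  move=> zr za zb; have [l dl] := de z.
  have /cdifferentiableP[m dm] := df _ (re _ zr) (dF _ zr za zb).
  by apply/cdifferentiableP; exists (m * l); apply: cder_comp.
have per s : y <= s <= y + h -> F (Complex (0 + tpi) s) = F (Complex 0 s).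
  by move=> _; rewrite add0r /F /= !eE /circ expi_tpi expi0.
have E := periodic_cint (ltW tpi_gt0) h0 cF ab dF' per.
rewrite add0r yh in E; rewrite /cavg; congr (_ * _).
rewrite (@eq_cint _ _ _ _ (fun t => F (Complex t (- ln r1)))); last first.
  by move=> t _; rewrite /F /= eE opprK lnK.
rewrite -E; apply: eq_cint => t _.
by rewrite /F /= eE /y opprK lnK.
Qed.

(** The mean does not depend on the radius and tends to [f 0] as the circle shrinks. The exceptional
    point allows difference quotients at [w], as in Cauchy's formula. *)
Lemma mean_value_except1 f r w : 0 <= r ->
  (forall z, cabs z <= r -> ccts f z) ->
  (forall z, cabs z <= r -> z != w -> cdifferentiable f z) ->
  cavg (f \o circ r) = f 0.
Proof.
rewrite le_eqVlt => /predU1P[<- cf df|r0 cf df].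
  rewrite -[RHS]cavg_cst; apply: eq_cavg => t /=.
  by rewrite /circ (_ : 0%:C%C = 0)// mul0r.
apply/eqP; rewrite -subr_eq0 -cabs_eq0 eq_le cabs_ge0 andbT.
apply: (@le_epsilon0 _ _ 2 1) => // e e0 _.
have [d d0 hd] : \forall z \near cnbhs 0, cabs (f z - f 0) < e by apply: cf; rewrite ?cabs0 ?ltW.
pose s := Num.min r (d / 2).
have s0 : 0 < s by rewrite lt_min r0 divr_gt0.
have sr : s <= r by rewrite ge_min lexx.
have sd : s < d by rewrite gt_min; apply/orP; right; lra.
have csn t : cabs (circ s t) <= r by rewrite cabs_circ// ltW.
rewrite -(@cavg_circ_const f s r w); first last.
- by move=> z /andP[_]; exact: df.
- by move=> z /andP[_]; exact: cf.
- by rewrite s0.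
have ci : icts 0 tpi (f \o circ s) by apply: icts_comp_circ => t; exact: cf.
rewrite -[X in _ - X]cavg_cst -cavgB//; last exact: icts_cst.
apply: cabs_cavg; first by apply: ictsB => //; exact: icts_cst.
by move=> t _; rewrite ltW// hd// subr0 cabs_circ// ltW.
Qed.

Lemma mean_value f r : 0 <= r -> (forall z, cabs z <= r -> cdifferentiable f z) ->
  cavg (f \o circ r) = f 0.
Proof.
move=> r0 df; apply: (@mean_value_except1 _ _ 0) => // z zr; last by move=> _; exact: df.
exact/cdiff_ccts/df.
Qed.

Lemma cabs_neq z w : cabs w < cabs z -> z - w != 0.
Proof. by move=> h; rewrite subr_eq0; apply: contraTneq h => ->; rewrite ltxx. Qed.

(** The mean of [z / (z - w)] is the same on all circles of radius larger than [|w|] and tends to 1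
    at infinity. On the radius [2 / e], with [|w| < r < 1 / e], one has [|z - w| >= 1 / e]. *)
Lemma cavg_cauchy1 r w : cabs w < r -> cavg (fun t => circ r t / (circ r t - w)) = 1.
Proof.
move=> wr; have w0 := cabs_ge0 w; have r0 : 0 < r by lra.
apply/eqP; rewrite -subr_eq0 -cabs_eq0 eq_le cabs_ge0 andbT.
have d0 : 0 < r^-1 by rewrite invr_gt0.
apply: (@le_epsilon0 _ _ (4 * cabs w) _ d0) => // e e0 er.
pose s := 2 * e^-1.
have re : r < e^-1 by rewrite -[r]invrK ltf_pV2 ?posrE.
have rs : r < s by rewrite /s; lra.
have s0 : 0 < s by lra.
pose k z := z / (z - w).
have dk z : r <= cabs z -> exists l, cder k z l.
  move=> rz; have zw : z - w != 0 by apply: cabs_neq; lra.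
  exists (1 * (z - w)^-1 + z * (- (1 - 0) / (z - w) ^+ 2)).
  apply: cderM; first exact: cder_id.
  by apply: cderV => //; apply: cderB; [exact: cder_id|exact: cder_cst].
rewrite [X in X - 1](_ : _ = cavg (k \o circ s)); last first.
  apply: (@cavg_circ_const k r s 0); first by rewrite r0 ltW.
    by move=> z /andP[/dk[l /cder_ccts]].
  by move=> z /andP[/dk[l /cder_cdiff]].
have ck : icts 0 tpi (k \o circ s).
  apply: icts_comp_circ => t; have [|l /cder_ccts//] := dk (circ s t).
  by rewrite cabs_circ ltW.
rewrite -[X in _ - X]cavg_cst -cavgB//; last exact: icts_cst.
have : 4 * cabs w * e = 2 * (2 * cabs w * e) by ring.
move=> ->; apply: cabs_cavg; first by apply: ictsB => //; exact: icts_cst.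
move=> t _ /=; rewrite /k.
have zw : circ s t - w != 0 by apply: cabs_neq; rewrite cabs_circ; lra.
have -> : circ s t / (circ s t - w) - 1 = w / (circ s t - w) by field.
rewrite cabsM cabsV ler_pdivrMr ?cabs_gt0//.
have := ler_cabs_sub (circ s t) w; rewrite (cabs_circ _ (ltW s0)) => h.
have h2 : e^-1 <= cabs (circ s t - w) by rewrite /s in h; lra.
apply: (@le_trans _ _ (2 * cabs w * e * e^-1)).
  by rewrite -mulrA mulfV ?gt_eqF// mulr1; lra.
by rewrite ler_wpM2l// !mulr_ge0// ltW.
Qed.

(** The function [q z * z], with [q] the difference quotient of [f] at [w], is differentiable off
    [w] and vanishes at 0, so its mean is zero. The factor [z] arises from
    [dz / (2 pi i) = z dt / (2 pi)]. *)
Lemma cauchy_formula f r w : cabs w < r -> (forall z, cabs z <= r -> cdifferentiable f z) ->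
  cavg (fun t => f (circ r t) * (circ r t / (circ r t - w))) = f w.
Proof.
move=> wr df; have w0 := cabs_ge0 w; have r0 : 0 < r by lra.
have wr' := ltW wr.
have /cdifferentiableP[l [q [qw ql fq]]] := df w wr'.
have qE z : z != w -> q z = (f z - f w) / (z - w).
  by move=> zw; rewrite (fq z); field; rewrite subr_eq0.
pose g z := q z * z.
have cf t : ccts f (circ r t).
  by apply/cdiff_ccts/df; rewrite cabs_circ// ltW.
have gdiff z : cabs z <= r -> z != w -> exists m, cder g z m.
  move=> zr zw; have /cdifferentiableP[m dm] := df z zr.
  have [d d0 hd] : \forall x \near cnbhs z, x - w != 0.
    apply: (@ccts_near_neq0 _ (fun x => x - w)); last by rewrite subr_eq0.
    by apply: climB; [exact: ccts_id|exact: clim_cst].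
  eexists; apply: cderM; last exact: cder_id.
  apply: (@cder_eq _ (fun x => (f x - f w) * (x - w)^-1)).
    by exists d => // x xd; rewrite qE// -subr_eq0 hd.
  apply: cderM; first by apply: cderB; [exact: dm|exact: cder_cst].
  apply: cderV; first by rewrite subr_eq0.
  by apply: cderB; [exact: cder_id|exact: cder_cst].
have cg z : cabs z <= r -> ccts g z.
  move=> zr; have [->|zw] := eqVneq z w.
    by apply: climM; [rewrite /= qw|exact: ccts_id].
  by have [m /cder_ccts] := gdiff z zr zw.
have := @mean_value_except1 g r w (ltW r0) cg.
rewrite (_ : g 0 = 0) => [H|]; last by rewrite /g mulr0.
have /H {H} : forall z, cabs z <= r -> z != w -> cdifferentiable g z.
  by move=> z zr zw; have [m /cder_cdiff] := gdiff z zr zw.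
have zw t : circ r t - w != 0 by apply: cabs_neq; rewrite cabs_circ ?ltW.
have ck : icts 0 tpi (fun t => circ r t / (circ r t - w)).
  apply: ictsM; first exact: icts_circ.
  apply: ictsV => [t _|]; first exact: zw.
  by apply: ictsB; [exact: icts_circ|exact: icts_cst].
have cfi : icts 0 tpi (f \o circ r) by exact: icts_comp_circ.
rewrite (_ : g \o circ r = fun t => f (circ r t) * (circ r t / (circ r t - w)) -
   f w * (circ r t / (circ r t - w))); last first.
  apply/funext => t /=; rewrite /g qE; last by rewrite -subr_eq0 zw.
  by field; exact: zw.
rewrite cavgB; [|by apply: ictsM|by apply: ictsM => //; exact: icts_cst].
by rewrite cavgZ// cavg_cauchy1// mulr1 => /eqP; rewrite subr_eq0 => /eqP.
Qed.

Definition poisson w z : R := (cabs z ^+ 2 - cabs w ^+ 2) / cabs (z - w) ^+ 2.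

Lemma mulcJ z : z * (z^*)%C = (cabs z ^+ 2)%:C%C.
Proof.
by apply: complexP; [rewrite cReM Rec sqr_cabs|rewrite cImM Imc]; case: z => a b /=; ring.
Qed.

Lemma cabsJ z : cabs (z^*)%C = cabs z.
Proof. by case: z => a b; rewrite !cabsE /= sqrrN. Qed.

(* Cauchy's formula combined with the vanishing of the mean of
   [f z * (w^* z / (r^2 - w^* z))]; on [|z| = r] the two kernels add up to the Poisson kernel. *)
Lemma poisson_formula f r w : cabs w < r -> (forall z, cabs z <= r -> cdifferentiable f z) ->
  cavg (fun t => f (circ r t) * (poisson w (circ r t))%:C%C) = f w.
Proof.
move=> wr df; have w0 := cabs_ge0 w; have r0 : 0 < r by lra.
have cf t : ccts f (circ r t).
  by apply/cdiff_ccts/df; rewrite cabs_circ// ltW.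
have zw t : circ r t - w != 0 by apply: cabs_neq; rewrite cabs_circ ?ltW.
pose wb := (w^*)%C; pose r2 := (r ^+ 2)%:C%C : C.
have rw z : cabs z <= r -> r2 - wb * z != 0.
  move=> zr; apply: cabs_neq; rewrite cabsM cabsJ cabs_real ger0_norm ?sqr_ge0// expr2.
  have := ler_wpM2l w0 zr; have : cabs w * r < r * r by rewrite ltr_pM2r.
  lra.
pose k z := f z * (wb * z / (r2 - wb * z)).
have dk z : cabs z <= r -> exists m, cder k z m.
  move=> zr; have /cdifferentiableP[m dm] := df z zr; eexists.
  apply: cderM; first exact: dm.
  have dz : cder (fun z => wb * z) z wb.
    by have := cder_affine wb 0 z; under [X in cder X]eq_fun do rewrite addr0.
  apply: cderM; first exact: dz.
  by apply: cderV; [exact: rw|apply: cderB; [exact: cder_cst|exact: dz]].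
have := @mean_value k r (ltW r0) (fun z zr => let: ex_intro _ d := dk z zr in cder_cdiff d).
rewrite {2}/k mulr0 mul0r mulr0 => E.
have cfi : icts 0 tpi (f \o circ r) by exact: icts_comp_circ.
have ck : icts 0 tpi (fun t => circ r t / (circ r t - w)).
  apply: ictsM; first exact: icts_circ.
  apply: ictsV => [t _|]; first exact: zw.
  by apply: ictsB; [exact: icts_circ|exact: icts_cst].
have ck2 : icts 0 tpi (k \o circ r).
  apply: icts_comp_circ => t; have [|m /cder_ccts//] := dk (circ r t).
  by rewrite cabs_circ// ltW.
rewrite -(cauchy_formula wr df) -[RHS]addr0 -E -cavgD//; last by apply: ictsM.
apply: eq_cavg => t /=; rewrite /k -mulrDr; congr (_ * _).
set z := circ r t.
have zr : cabs z = r by rewrite cabs_circ// ltW.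
have zn : z != 0 by rewrite -cabs_gt0 zr.
have zbw : (z^*)%C - wb != 0.
  by rewrite /wb -rmorphB -cabs_gt0 cabsJ cabs_gt0 zw.
have -> : r2 = z * (z^*)%C by rewrite mulcJ zr.
have zwt : z - w != 0 := zw t.
clearbody z.
have -> : wb * z / (z * (z^*)%C - wb * z) = wb / ((z^*)%C - wb).
  have -> : z * (z^*)%C - wb * z = z * ((z^*)%C - wb) by ring.
  by field; rewrite zbw zn.
have -> : (poisson w z)%:C%C = (z * (z^*)%C - w * wb) / ((z - w) * ((z - w)^*)%C).
  by rewrite !mulcJ /poisson real_complexM fmorphV rmorphB.
rewrite rmorphB /= -/wb.
by field; rewrite zwt zbw.
Qed.

Lemma Re_poisson_kernel z w : z - w != 0 -> Re ((z + w) / (z - w)) = poisson w z.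
Proof.
move=> zw.
have -> : (z + w) / (z - w) = (z + w) * ((z - w)^*)%C * ((cabs (z - w) ^+ 2)^-1)%:C%C.
  have -> : ((cabs (z - w) ^+ 2)^-1)%:C%C = ((z - w) * ((z - w)^*)%C)^-1 by rewrite mulcJ fmorphV.
  have zJ : ((z - w)^*)%C != 0 by rewrite -cabs_gt0 cabsJ cabs_gt0.
  rewrite rmorphB /= in zJ *; by field; rewrite zw zJ.
rewrite cReM Rec Imc mulr0 subr0 /poisson; congr (_ * _).
by rewrite !sqr_cabs; case: z w {zw} => a b [c d] /=; ring.
Qed.

End CircleMeans.

(** * Means of [|f|^p] and subordination *)

Section PowerMeans.
Variable R : realType.
Local Notation C := R[i].
Local Notation tpi := ((pi : R) *+ 2).
Implicit Types (f g : C -> C) (p r s t a : R) (z w : C).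

(** Bernoulli's inequality: write [x^p = x * exp ((p - 1) ln x)] and use [1 + y <= exp y] twice, the
    second time in the form [x ln x >= x - 1]. *)
Lemma powR_sub1_ge (x p : R) : 1 <= p -> 0 <= x -> 1 + p * (x - 1) <= x `^ p.
Proof.
move=> p1; rewrite le_eqVlt => /predU1P[<-|x0].
  by rewrite powR0 ?gt_eqF//; lra.
rewrite /powR gt_eqF//.
have h1 := expR_ge1Dx ((p - 1) * ln x); have h2 := expR_ge1Dx (- ln x).
rewrite expRN lnK// in h2.
have -> : p * ln x = ln x + (p - 1) * ln x by ring.
rewrite expRD lnK//.
have : x * (1 + (p - 1) * ln x) <= x * expR ((p - 1) * ln x) by rewrite ler_pM2l.
have : x * (1 - ln x) <= x * x^-1 by rewrite ler_pM2l.
rewrite mulfV ?gt_eqF//; nra.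
Qed.

Lemma powR_sub1_gt (x p : R) : 1 < p -> 0 <= x -> x != 1 -> 1 + p * (x - 1) < x `^ p.
Proof.
move=> p1; rewrite le_eqVlt => /predU1P[<- _|x0 x1].
  by rewrite powR0 ?gt_eqF//; lra.
have l0 : ln x != 0 by rewrite ln_eq0.
rewrite /powR gt_eqF//.
have h1 := expR_ge1Dx ((p - 1) * ln x).
have h2 : 1 - ln x < expR (- ln x) by apply: expR_gt1Dx; rewrite oppr_eq0.
rewrite expRN lnK// in h2.
have -> : p * ln x = ln x + (p - 1) * ln x by ring.
rewrite expRD lnK//.
have : x * (1 + (p - 1) * ln x) <= x * expR ((p - 1) * ln x) by rewrite ler_pM2l.
have : x * (1 - ln x) < x * x^-1 by rewrite ltr_pM2l.
rewrite mulfV ?gt_eqF//; nra.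
Qed.

Lemma powR_tangent (x a p : R) : 1 <= p -> 0 <= x -> 0 < a ->
  a `^ p + p * a `^ (p - 1) * (x - a) <= x `^ p.
Proof.
move=> p1 x0 a0.
have b0 := divr_ge0 x0 (ltW a0).
have xE : x = x / a * a by rewrite divfK// gt_eqF.
have h := powR_sub1_ge p1 b0; have aE : a * a `^ (p - 1) = a `^ p.
  by rewrite mulr_powRB1 ?(ltW a0)//; lra.
have k0 : 0 <= a `^ p by exact: powR_ge0.
rewrite [in leRHS]xE powRM ?(ltW a0)//.
apply: le_trans (ler_wpM2r k0 h); rewrite -aE le_eqVlt; apply/orP; left; apply/eqP.
by field; rewrite gt_eqF.
Qed.

Lemma cvg_cabs_powR (T : Type) (F : set_system T) {FF : Filter F} (g : T -> C) l p :
  0 < p -> clim F g l -> (fun x => cabs (g x) `^ p) @ F --> cabs l `^ p.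
Proof.
(* The power is differentiable only at positive arguments, so the limit 0 is treated by hand. *)
move=> p0 gl; have [l0|l0] := eqVneq l 0.
  rewrite l0 cabs0 powR0 ?gt_eqF//; apply/cvgrPdist_lt => e e0; near=> x.
  rewrite sub0r normrN ger0_norm ?powR_ge0//.
  have -> : e = (e `^ p^-1) `^ p by rewrite -powRrM mulVf ?gt_eqF// powRr1// ltW.
  apply: gt0_ltr_powR => //; rewrite ?nnegrE ?cabs_ge0 ?powR_ge0//.
  near: x; have := gl _ (powR_gt0 p^-1 e0); apply: filterS => x.
  by rewrite l0 subr0.
have gl' : (fun x => cabs (g x)) @ F --> cabs l by exact: clim_cabs.
have cp : {for cabs l, continuous (fun y : R => y `^ p)}.
  apply: differentiable_continuous; apply/derivable1_diffP.
  by apply: derivable_powR; rewrite in_itv /= andbT cabs_gt0.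
exact: (@cvg_comp _ _ _ (fun x => cabs (g x)) (fun y => y `^ p) F (nbhs (cabs l)) _ gl' cp).
Unshelve. all: by end_near. Qed.

(** The [p]-th power of the [p]-mean over the circle of radius [r], as a real number; [int_meanE]
    identifies it with the extended-real [int_mean]. *)
Definition mp p f r : R := ravg (fun t => cabs (f (circ r t)) `^ p).

Lemma rcts_mp p f r a b : 0 < p -> (forall t, ccts f (circ r t)) ->
  rcts a b (fun t => cabs (f (circ r t)) `^ p).
Proof.
move=> p0 cf t _; apply: cvg_cabs_powR => //.
apply: (@clim_comp _ _ _ _ (circ r) f (circ r t)) => //; [exact: clim_circ|exact: cf].
Qed.

Lemma int_meanE p f r : 0 < p -> (forall t, ccts f (circ r t)) ->
  int_mean p f r = (mp p f r)%:E.
Proof.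
move=> p0 cf; rewrite /int_mean /mp /ravg EFinM; congr (_ * _)%E.
  by rewrite mulr_natl.
rewrite /rint /Rintegral fineK//.
have := rcts_integrable (@rcts_mp p f r 0 tpi p0 cf).
by move=> /integrable_fin_num; apply.
Qed.

Lemma mp_ge0 p f r : 0 <= mp p f r.
Proof.
rewrite /mp /ravg mulr_ge0// ?invr_ge0 ?(ltW (tpi_gt0 _))//.
by apply: Rintegral_ge0 => t _; exact: powR_ge0.
Qed.

Lemma icts_real a b (v : R -> R) : rcts a b v -> icts a b (fun t => (v t)%:C%C).
Proof. by move=> cv t tab; apply: clim_ReIm; [exact: cv|exact: cvg_cst]. Qed.

Lemma rcts_bounded a b (v : R -> R) : a <= b -> rcts a b v ->
  exists2 B : R, 0 < B & forall t, a <= t <= b -> v t <= B.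
Proof.
move=> ab cv; have [|c _ H] := @EVT_max R v a b ab.
  by apply: continuous_in_subspaceT => x; rewrite inE /= in_itv /= => /cv.
exists (Num.max 1 (v c)); first by rewrite lt_max ltr01.
by move=> t tab; rewrite le_max H ?orbT// in_itv.
Qed.

Lemma circle_bounded f r : (forall t, ccts f (circ r t)) ->
  exists2 B : R, 0 < B & forall t, 0 <= t <= tpi -> cabs (f (circ r t)) <= B.
Proof.
move=> cf; apply: rcts_bounded; first exact: ltW (tpi_gt0 _).
move=> t _; apply: clim_cabs.
apply: (@clim_comp _ _ _ _ (circ r) f (circ r t)) => //; [exact: clim_circ|exact: cf].
Qed.

(** The Herglotz integral of boundary data [v]: it is analytic in [w] and its real part is the
    Poisson integral. Harmonic majorants thus occur as real parts of analytic functions, to which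
    the mean value property applies. *)
Definition herglotz r (v : R -> R) w : C :=
  cavg (fun t => (v t)%:C%C * ((circ r t + w) / (circ r t - w))).

Lemma circ_sub_neq0 r t w : cabs w < r -> circ r t - w != 0.
Proof.
by move=> wr; apply: cabs_neq; rewrite cabs_circ// (le_trans (cabs_ge0 w))// ltW.
Qed.

Lemma icts_herglotz r (v : R -> R) w : cabs w < r -> rcts 0 tpi v ->
  icts 0 tpi (fun t => (v t)%:C%C * ((circ r t + w) / (circ r t - w))).
Proof.
move=> wr cv; apply: ictsM; first exact: icts_real.
apply: ictsM; first by apply: ictsD; [exact: icts_circ|exact: icts_cst].
apply: ictsV => [t _|]; first exact: circ_sub_neq0.
by apply: ictsB; [exact: icts_circ|exact: icts_cst].
Qed.

Lemma Re_herglotz r (v : R -> R) w : cabs w < r ->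
  Re (herglotz r v w) = ravg (fun t => v t * poisson w (circ r t)).
Proof.
move=> wr; rewrite /herglotz Re_cavg; apply: eq_ravg => t /=.
by rewrite -Re_poisson_kernel ?circ_sub_neq0//; case: (_ / _) => a b /=; ring.
Qed.

Lemma cder_herglotz r (v : R -> R) w : cabs w < r -> rcts 0 tpi v ->
  exists l, cder (herglotz r v) w l.
Proof.
move=> wr cv; have w0 := cabs_ge0 w; have r0 : 0 < r by lra.
have [B B0 vB] : exists2 B : R, 0 < B & forall t, 0 <= t <= tpi -> `|v t| <= B.
  by apply: rcts_bounded; [exact: ltW (tpi_gt0 _)|move=> t tt; apply: cvg_norm; exact: cv].
pose l := cavg (fun t => (v t)%:C%C * (2 * circ r t / (circ r t - w) ^+ 2)).
exists l; apply/cderP => e e0.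
pose d := r - cabs w; have d0 : 0 < d by rewrite subr_gt0.
(* For [|h| < d / 2] the remainder [2 v z h^2 / ((z - w)^2 (z - w - h))] has modulus at most
   [4 B r |h|^2 / d^3], and [cabs_cavg] doubles it. *)
pose M : R := 8 * B * r / d ^+ 3.
have M0 : 0 < M by rewrite /M !mulr_gt0// invr_gt0 exprn_gt0.
exists (Num.min (d / 2) (e / M)); first by rewrite lt_min (divr_gt0 d0)//= divr_gt0.
move=> h; rewrite lt_min => /andP[h1 h2].
have whr : cabs (w + h) < r by have := cabsD w h; rewrite /d in h1; lra.
have c1 := icts_herglotz whr cv; have c2 := icts_herglotz wr cv.
have c3 : icts 0 tpi (fun t => (v t)%:C%C * (2 * circ r t / (circ r t - w) ^+ 2)).
  apply: ictsM; first exact: icts_real.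
  apply: ictsM; first by apply: ictsM; [exact: icts_cst|exact: icts_circ].
  apply: ictsV => [t _|]; first by rewrite expf_neq0 ?circ_sub_neq0.
  by apply: ictsM; (apply: ictsB; [exact: icts_circ|exact: icts_cst]).
have c4 : icts 0 tpi (fun t => h * ((v t)%:C%C * (2 * circ r t / (circ r t - w) ^+ 2))).
  by apply: ictsM => //; exact: icts_cst.
rewrite mulrC -[h * l]cavgZ// -cavgB// -cavgB//; last exact: ictsB.
have h0 := cabs_ge0 h.
apply: le_trans (_ : 2 * (4 * B * r / d ^+ 3 * cabs h ^+ 2) <= _); last first.
  have -> : 2 * (4 * B * r / d ^+ 3 * cabs h ^+ 2) = M * cabs h * cabs h by rewrite /M; ring.
  by rewrite ler_wpM2r// mulrC -ler_pdivlMr// ltW.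
apply: cabs_cavg; first by apply: ictsB => //; exact: ictsB.
move=> t tt; have z0 := circ_sub_neq0 t wr; have zh := circ_sub_neq0 t whr.
set z := circ r t in z0 zh *.
have -> : (v t)%:C%C * ((z + (w + h)) / (z - (w + h))) - (v t)%:C%C * ((z + w) / (z - w)) -
   h * ((v t)%:C%C * (2 * z / (z - w) ^+ 2)) =
   (v t)%:C%C * (2 * z) * h ^+ 2 / ((z - w) ^+ 2 * (z - (w + h))) by field; rewrite ?z0 ?zh.
have zr : cabs z = r by rewrite cabs_circ// ltW.
have e1 : d <= cabs (z - w) by have := ler_cabs_sub z w; rewrite zr.
have e2 : d / 2 <= cabs (z - (w + h)).
  have := ler_cabs_sub (z - w) h; have -> : z - w - h = z - (w + h) by ring.
  by lra.
clearbody z.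
rewrite cabsM cabsV (cabsM _ (h ^+ 2)) (cabsM _ (2 * z)) (cabsM 2 z) (cabsM (_ ^+ 2)) !cabsX zr cabs_real.
have -> : cabs 2 = 2 :> R.
  by have := cabs_real (2 : R); rewrite ger0_norm// => <-; congr cabs; rewrite rmorph_nat.
have dd : 0 < d ^+ 2 * (d / 2) by rewrite mulr_gt0 ?exprn_gt0// divr_gt0.
have le2 : d ^+ 2 * (d / 2) <= cabs (z - w) ^+ 2 * cabs (z - (w + h)).
  apply: ler_pM => //; rewrite ?exprn_ge0 ?divr_ge0// ?(ltW d0)//.
  by rewrite lerXn2r// nnegrE ?cabs_ge0// ltW.
rewrite ler_pdivrMr; last exact: lt_le_trans le2.
have -> : `|v t| * (2 * r) * cabs h ^+ 2 = `|v t| * (2 * r * cabs h ^+ 2) by ring.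
have n0 : 0 <= 2 * r * cabs h ^+ 2 by rewrite !mulr_ge0 ?exprn_ge0// ltW.
apply: le_trans (ler_wpM2r n0 (vB _ tt)) _.
have n1 : 0 <= 4 * B * r / d ^+ 3 * cabs h ^+ 2.
  by rewrite !mulr_ge0 ?invr_ge0 ?exprn_ge0// ltW.
apply: le_trans (ler_wpM2l n1 le2).
rewrite le_eqVlt; apply/orP; left; apply/eqP; field; rewrite gt_eqF//.
Qed.

Lemma poisson_ge0 r t w : cabs w < r -> 0 <= poisson w (circ r t).
Proof.
move=> wr; have w0 := cabs_ge0 w; rewrite /poisson divr_ge0 ?exprn_ge0 ?cabs_ge0//.
rewrite cabs_circ ?subr_ge0 ?lerXn2r ?nnegrE// ?ltW//; lra.
Qed.

Lemma poisson_le r t w : cabs w < r ->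
  poisson w (circ r t) <= (r + cabs w) / (r - cabs w).
Proof.
move=> wr; have w0 := cabs_ge0 w; have r0 : 0 <= r by lra.
have d0 : 0 < r - cabs w by rewrite subr_gt0.
rewrite /poisson cabs_circ//.
have -> : (r + cabs w) / (r - cabs w) = (r ^+ 2 - cabs w ^+ 2) / (r - cabs w) ^+ 2.
  by field; rewrite gt_eqF.
have h := ler_cabs_sub (circ r t) w; rewrite cabs_circ// in h.
rewrite ler_wpM2l ?subr_ge0 ?lerXn2r ?nnegrE ?(ltW wr)//.
rewrite lef_pV2 ?posrE ?exprn_gt0 ?(lt_le_trans d0)//.
by rewrite lerXn2r ?nnegrE ?cabs_ge0// ltW.
Qed.

Lemma rcts_poisson r (v : R -> R) w : cabs w < r -> rcts 0 tpi v ->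
  rcts 0 tpi (fun t => v t * poisson w (circ r t)).
Proof.
move=> wr cv; have := icts_Re (icts_herglotz wr cv).
rewrite (_ : _ \o _ = fun t => v t * poisson w (circ r t))//.
apply/funext => t /=.
by rewrite -Re_poisson_kernel ?circ_sub_neq0//; case: (_ / _) => a b /=; ring.
Qed.

(* Jensen's inequality for the Poisson kernel: apply the Poisson formula to the
   affine minorant of [x ^ p] at [a = |f w|], whose value at [w] is [a ^ p]. *)
Lemma powR_le_herglotz p f r w : 1 <= p -> cabs w < r ->
  (forall z, cabs z <= r -> cdifferentiable f z) ->
  cabs (f w) `^ p <= Re (herglotz r (fun t => cabs (f (circ r t)) `^ p) w).
Proof.
move=> p1 wr df; have w0 := cabs_ge0 w; have r0 : 0 <= r by lra.
have p0 : 0 < p by lra.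
have cf t : ccts f (circ r t) by apply/cdiff_ccts/df; rewrite cabs_circ.
pose v t := cabs (f (circ r t)) `^ p.
have cv : rcts 0 tpi v by exact: rcts_mp.
rewrite Re_herglotz//; have cvP := rcts_poisson wr cv.
have [fw0|fw0] := eqVneq (f w) 0.
  rewrite fw0 cabs0 powR0 ?gt_eqF// -(ravg_cst (0 : R)); apply: ravg_le => //.
    by move=> t _; exact: cvg_cst.
  by move=> t; rewrite mulr_ge0 ?powR_ge0 ?poisson_ge0.
pose a := cabs (f w); have a0 : 0 < a by rewrite cabs_gt0.
pose u : C := ((f w)^*)%C / a%:C%C.
have u1 : cabs u = 1.
  by rewrite cabsM cabsV cabsJ cabs_real gtr0_norm// mulfV ?gt_eqF.
have uf : u * f w = a%:C%C.
  have an : a%:C%C != 0 :> C by rewrite -cabs_gt0 cabs_real gtr0_norm.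
  have -> : u * f w = f w * ((f w)^*)%C / a%:C%C by rewrite /u; ring.
  by rewrite mulcJ expr2 real_complexM mulfK.
pose k := p * a `^ (p - 1).
pose g z : C := (a `^ p)%:C%C + k%:C%C * (u * f z - a%:C%C).
have dg z : cabs z <= r -> cdifferentiable g z.
  move=> /df /cdifferentiableP[l dl]; apply: cder_cdiff.
  apply: cderD; first exact: cder_cst.
  apply: cderZ; apply: cderB; last exact: cder_cst.
  exact: cderZ dl.
have gw : g w = (a `^ p)%:C%C by rewrite /g uf subrr mulr0 addr0.
have := poisson_formula wr dg; rewrite gw => /(congr1 Re).
rewrite Re_cavg Rec => <-.
have cg t : ccts g (circ r t) by apply/cdiff_ccts/dg; rewrite cabs_circ.
have E t : Re (g (circ r t) * (poisson w (circ r t))%:C%C) =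
  Re (g (circ r t)) * poisson w (circ r t) by rewrite cReM Rec Imc mulr0 subr0.
apply: ravg_le => //.
  rewrite (_ : _ \o _ = fun t => Re (g (circ r t)) * poisson w (circ r t)).
    by apply: rcts_poisson => //; apply: icts_Re; apply: icts_comp_circ.
  by apply/funext => t; rewrite /comp E.
move=> t; rewrite /comp E ler_wpM2r ?poisson_ge0//.
apply: le_trans (powR_tangent p1 (cabs_ge0 (f (circ r t))) a0).
rewrite /g cReD Rec cReM Rec Imc mul0r subr0 cReD cReN Rec lerD2l.
rewrite ler_wpM2l ?mulr_ge0 ?powR_ge0 ?(ltW p0)// lerD2r.
by apply: le_trans (ler_norm _) (le_trans (ler_Re_cabs _) _); rewrite cabsM u1 mul1r.
Qed.

(** Littlewood's subordination: [|f (psi z)|^p] is at most the real part of the analytic function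
    [herglotz o psi], whose circular mean is its value at 0. That value is a Poisson integral at
    [psi 0], and the factor is the maximum of the kernel there. *)
Lemma mp_comp p f psi r rho : 1 <= p -> 0 <= r ->
  (forall z, cabs z <= rho -> cdifferentiable f z) ->
  (forall z, cabs z <= r -> cdifferentiable psi z /\ cabs (psi z) < rho) ->
  mp p (f \o psi) r <= (rho + cabs (psi 0)) / (rho - cabs (psi 0)) * mp p f rho.
Proof.
move=> p1 r0 df dpsi; have p0 : 0 < p by lra.
have psi0 : cabs (psi 0) < rho by apply: (dpsi _ _).2; rewrite cabs0.
have rho0 : 0 <= rho by apply: le_trans (ltW psi0); exact: cabs_ge0.
have cf t : ccts f (circ rho t) by apply/cdiff_ccts/df; rewrite cabs_circ.
pose v t := cabs (f (circ rho t)) `^ p.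
have cv : rcts 0 tpi v by exact: rcts_mp.
pose U := herglotz rho v.
have dU z : cabs z <= r -> cdifferentiable (U \o psi) z.
  move=> zr; have [/cdifferentiableP[l dl] pz] := dpsi z zr.
  have [m dm] := cder_herglotz pz cv.
  by apply: cder_cdiff; apply: cder_comp; [exact: dl|exact: dm].
have cfp t : ccts (f \o psi) (circ r t).
  have [|dp pr] := dpsi (circ r t); first by rewrite cabs_circ.
  apply: (@clim_comp _ _ _ _ psi f (psi (circ r t))) => //; first exact: cdiff_ccts.
  by apply/cdiff_ccts/df; exact: ltW.
have cUp t : ccts (U \o psi) (circ r t) by apply/cdiff_ccts/dU; rewrite cabs_circ.
apply: (@le_trans _ _ (ravg (fun t => Re ((U \o psi) (circ r t))))).
  apply: ravg_le; first exact: rcts_mp.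
    by apply: icts_Re; exact: icts_comp_circ.
  move=> t; have [|_ pr] := dpsi (circ r t); first by rewrite cabs_circ.
  exact: (powR_le_herglotz p1 pr df).
have -> : ravg (fun t => Re ((U \o psi) (circ r t))) = Re (herglotz rho v (psi 0)).
  by rewrite -[LHS](@Re_cavg _ ((U \o psi) \o circ r)) (mean_value r0 dU).
rewrite Re_herglotz//.
rewrite -ravgZ//; apply: ravg_le.
- exact: rcts_poisson.
- by move=> t tt; apply: cvgMr; exact: cv.
- by move=> t; rewrite mulrC ler_wpM2r ?powR_ge0// poisson_le.
Qed.

(** Subordination with [psi = id]: as [psi 0 = 0], the factor is 1. *)
Lemma mp_le p f r rho : 1 <= p -> 0 <= r < rho ->
  (forall z, cabs z <= rho -> cdifferentiable f z) -> mp p f r <= mp p f rho.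
Proof.
move=> p1 /andP[r0 rr] df; have rho0 := le_lt_trans r0 rr.
have H := @mp_comp p f id r rho p1 r0 df.
apply: le_trans (H _) _.
  by move=> z zr; split; [exact: cder_cdiff (cder_id _)|exact: le_lt_trans rr].
by rewrite cabs0 addr0 subr0 (divff (lt0r_neq0 rho0)) mul1r.
Qed.

End PowerMeans.

(** * Hardy spaces and their duals *)

Section HardySpace.
Variable R : realType.
Local Notation C := R[i].
Local Notation tpi := ((pi : R) *+ 2).
Implicit Types (f g : C -> C) (p r s t a : R) (z w : C).

Local Notation analytic := (analytic_on (@disc R)).

Lemma analytic_ccts f z : analytic f -> cabs z < 1 -> ccts f z.
Proof. by move=> af z1; apply/cdiff_ccts/af. Qed.

Lemma analytic_circ f r t : analytic f -> 0 <= r < 1 -> ccts f (circ r t).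
Proof. by move=> af /andP[r0 r1]; apply: analytic_ccts => //; rewrite cabs_circ. Qed.

Lemma HardyI p f M : 0 < p -> analytic f -> (forall r, 0 <= r < 1 -> mp p f r <= M) ->
  Hardy p f.
Proof.
move=> p0 af fM; split=> //; exists M => r r01.
by rewrite int_meanE ?lee_fin ?fM// => t; exact: analytic_circ.
Qed.

(** The norm is the least [K >= 0] with all [mp p f r <= K^p]. Only this property is used
    afterwards, and the definition becomes opaque. *)
Lemma hardy_norm_spec p f : 0 < p -> Hardy p f ->
  (forall r, 0 <= r < 1 -> mp p f r <= hardy_norm p f `^ p) /\
  (forall K : R, 0 <= K -> (forall r, 0 <= r < 1 -> mp p f r <= K `^ p) -> hardy_norm p f <= K).
Proof.
move=> p0 [af [M fM]].
have E r : 0 <= r < 1 -> int_mean p f r = (mp p f r)%:E.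
  by move=> r01; rewrite int_meanE// => t; exact: analytic_circ.
rewrite /hardy_norm; set S := (X in ereal_sup X).
have ubS K : (forall r, 0 <= r < 1 -> mp p f r <= K) -> (ereal_sup S <= K%:E)%E.
  move=> H; apply: ub_ereal_sup => x [r] /=; rewrite in_itv /= => r01 <-.
  by rewrite E// lee_fin H.
have leS r : 0 <= r < 1 -> ((mp p f r)%:E <= ereal_sup S)%E.
  by move=> r01; rewrite -E//; apply: ereal_sup_ubound; exists r.
(* Finiteness matters because [fine] sends an infinite supremum to 0. *)
have fS : ereal_sup S \is a fin_num.
  rewrite fin_numE; apply/andP; split.
    have := leS 0; rewrite lexx ltr01 => /(_ isT) h; apply/eqP => e; rewrite e in h.
    by rewrite leeNy_eq in h.
  have := ubS M; have H : forall r, 0 <= r < 1 -> mp p f r <= M.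
    by move=> r r01; have := fM r r01; rewrite E// lee_fin.
  by move=> /(_ H) h; apply/eqP => e; rewrite e leye_eq in h.
have s0 : 0 <= fine (ereal_sup S).
  by rewrite fine_ge0// (le_trans _ (leS 0 _)) ?lee_fin ?mp_ge0 ?lexx ?ltr01.
split=> [r r01|K K0 H].
  rewrite -powRrM mulVf ?gt_eqF// powRr1// -lee_fin fineK//; exact: leS.
have -> : K = (K `^ p) `^ p^-1 by rewrite -powRrM mulfV ?gt_eqF// powRr1.
apply: ge0_ler_powR; rewrite ?nnegrE ?powR_ge0 ?invr_ge0 ?(ltW p0)//.
by rewrite -lee_fin fineK// ubS.
Qed.

Lemma mp_le_norm p f r : 0 < p -> Hardy p f -> 0 <= r < 1 -> mp p f r <= hardy_norm p f `^ p.
Proof. by move=> p0 Hf r01; apply: (hardy_norm_spec p0 Hf).1. Qed.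

Lemma hardy_norm_le p f (K : R) : 0 < p -> Hardy p f -> 0 <= K ->
  (forall r, 0 <= r < 1 -> mp p f r <= K `^ p) -> hardy_norm p f <= K.
Proof. by move=> p0 Hf K0 H; apply: (hardy_norm_spec p0 Hf).2. Qed.

Lemma hardy_norm_ge0 p f : 0 <= hardy_norm p f.
Proof. exact: powR_ge0. Qed.

Local Opaque hardy_norm.

Lemma ler_powR2 p (a b : R) : 0 < p -> 0 <= a -> a <= b -> a `^ p <= b `^ p.
Proof.
by move=> p0 a0 ab; apply: ge0_ler_powR; rewrite ?nnegrE ?(ltW p0)// (le_trans a0).
Qed.

Lemma powRpK p (y : R) : 0 < p -> 0 <= y -> (y `^ p) `^ p^-1 = y.
Proof. by move=> p0 y0; rewrite -powRrM mulfV ?gt_eqF// powRr1. Qed.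

Lemma mp_dom p f g (K : R) r : 0 < p -> 0 <= K -> 
  (forall t, ccts f (circ r t)) -> (forall t, ccts g (circ r t)) ->
  (forall t, cabs (f (circ r t)) <= K * cabs (g (circ r t))) -> mp p f r <= K `^ p * mp p g r.
Proof.
move=> p0 K0 cf cg fg; rewrite /mp -ravgZ; last exact: rcts_mp.
apply: ravg_le; first exact: rcts_mp.
  by move=> t tt; apply: cvgMr; exact: (@rcts_mp _ p g r 0 tpi).
by move=> t; rewrite -powRM ?cabs_ge0// ler_powR2 ?cabs_ge0.
Qed.

Lemma powR_add_le p (x y : R) : 0 < p -> 0 <= x -> 0 <= y ->
  (x + y) `^ p <= 2 `^ p * (x `^ p + y `^ p).
Proof.
move=> p0; wlog xy : x y / x <= y => [H x0 y0|x0 y0].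
  by have [/H->//|/ltW/H] := leP x y; rewrite addrC [X in _ * X]addrC; apply.
apply: (@le_trans _ _ (2 `^ p * y `^ p)).
  by rewrite -powRM// ler_powR2 ?addr_ge0//; lra.
by rewrite ler_wpM2l ?powR_ge0// lerDr powR_ge0.
Qed.

Lemma mpD p f g r : 0 < p -> (forall t, ccts f (circ r t)) -> (forall t, ccts g (circ r t)) ->
  mp p (fun z => f z + g z) r <= 2 `^ p * (mp p f r + mp p g r).
Proof.
move=> p0 cf cg; have c1 := @rcts_mp _ p f r 0 tpi p0 cf.
have c2 := @rcts_mp _ p g r 0 tpi p0 cg.
have c12 : rcts 0 tpi (fun t => cabs (f (circ r t)) `^ p + cabs (g (circ r t)) `^ p).
  by move=> t tt; apply: cvgD; [exact: c1|exact: c2].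
rewrite /mp -ravgD// -ravgZ//; apply: ravg_le.
- by apply: (@rcts_mp _ p (fun z => f z + g z)) => // t; apply: climD; [exact: cf|exact: cg].
- by move=> t tt; apply: cvgMr; exact: c12.
- move=> t; apply: le_trans (powR_add_le _ _ _); rewrite ?cabs_ge0//.
  by rewrite ler_powR2 ?cabs_ge0// cabsD.
Qed.

Lemma analytic_lin (c : C) f g : analytic f -> analytic g -> analytic (c *: f + g).
Proof.
move=> af ag z zd; have /cdifferentiableP[l dl] := af z zd.
have /cdifferentiableP[m dm] := ag z zd.
by apply: cder_cdiff; apply: cderD; [exact: cderZ dl|exact: dm].
Qed.

Lemma mpZ p (c : C) f r : 0 < p -> (forall t, ccts f (circ r t)) ->
  mp p (fun z => c * f z) r = cabs c `^ p * mp p f r.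
Proof.
move=> p0 cf; rewrite /mp -ravgZ; last exact: rcts_mp.
by apply: eq_ravg => t; rewrite cabsM powRM ?cabs_ge0.
Qed.

Lemma Hardy_lin p (c : C) f g : 0 < p -> Hardy p f -> Hardy p g -> Hardy p (c *: f + g).
Proof.
move=> p0 Hf Hg; have [af _] := Hf; have [ag _] := Hg.
apply: (@HardyI _ _ (2 `^ p * (cabs c `^ p * hardy_norm p f `^ p + hardy_norm p g `^ p))) => //.
  exact: analytic_lin.
move=> r r01; apply: le_trans (@mpD p (c *: f) g r p0 _ _) _.
- by move=> t; apply: climM; [exact: clim_cst|exact: analytic_circ].
- by move=> t; exact: analytic_circ.
rewrite ler_wpM2l ?powR_ge0// lerD ?mp_le_norm//.
rewrite (@mpZ p c f r p0) ?ler_wpM2l ?powR_ge0 ?mp_le_norm//.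
by move=> t; exact: analytic_circ.
Qed.

Lemma mp0 p r : 0 < p -> mp p (0 : C -> C) r = 0.
Proof.
move=> p0; rewrite /mp -[RHS](ravg_cst (0 : R)); apply: eq_ravg => t.
by rewrite cabs0 powR0 ?gt_eqF.
Qed.

Lemma Hardy0 p : 0 < p -> Hardy p (0 : C -> C).
Proof.
move=> p0; apply: (@HardyI _ _ 0) => // [z _|r _]; last by rewrite mp0.
exact: cder_cdiff (cder_cst 0 z).
Qed.

Lemma HardyZ p (c : C) f : 0 < p -> Hardy p f -> Hardy p (c *: f).
Proof. by move=> p0 Hf; have := Hardy_lin c p0 Hf (Hardy0 p0); rewrite addr0. Qed.
Lemma HardyD p f g : 0 < p -> Hardy p f -> Hardy p g -> Hardy p (f + g).
Proof. by move=> p0 Hf Hg; have := Hardy_lin 1 p0 Hf Hg; rewrite scale1r. Qed.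
Lemma HardyB p f g : 0 < p -> Hardy p f -> Hardy p g -> Hardy p (f - g).
Proof. by move=> p0 Hf Hg; rewrite addrC -scaleN1r; apply: Hardy_lin. Qed.

Lemma analytic_eq f g : (forall z, cabs z < 1 -> f z = g z) -> analytic f -> analytic g.
Proof.
move=> fg af z zd; have /cdifferentiableP[l dl] := af z zd.
apply: cder_cdiff; apply: cder_eq dl; exists (1 - cabs z); first by rewrite subr_gt0.
move=> w wz; apply: fg; have := ler_cabs_sub w z; lra.
Qed.

Lemma mp_eq p f g r : 0 <= r < 1 -> (forall z, cabs z < 1 -> f z = g z) -> mp p f r = mp p g r.
Proof.
by move=> /andP[r0 r1] fg; apply: eq_ravg => t; rewrite fg// cabs_circ.
Qed.

Lemma Hardy_eq p f g : 0 < p -> (forall z, cabs z < 1 -> f z = g z) -> Hardy p f -> Hardy p g.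
Proof.
move=> p0 fg Hf; have [af _] := Hf.
apply: (@HardyI _ _ (hardy_norm p f `^ p)) => //; first exact: analytic_eq af.
by move=> r r01; rewrite -(mp_eq _ r01 fg) mp_le_norm.
Qed.

Lemma hardy_norm_dom p f g (K : R) : 0 < p -> analytic f -> Hardy p g -> 0 <= K ->
  (forall z, cabs z < 1 -> cabs (f z) <= K * cabs (g z)) ->
  Hardy p f /\ hardy_norm p f <= K * hardy_norm p g.
Proof.
move=> p0 af Hg K0 fg; have [ag _] := Hg.
have H r : 0 <= r < 1 -> mp p f r <= (K * hardy_norm p g) `^ p.
  move=> r01; rewrite powRM ?hardy_norm_ge0//.
  apply: le_trans (@mp_dom p f g K r p0 K0 _ _ _) _.
  - by move=> t; exact: analytic_circ.
  - by move=> t; exact: analytic_circ.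
  - by move=> t; case/andP: r01 => r0 r1; apply: fg; rewrite cabs_circ.
  - by rewrite ler_wpM2l ?powR_ge0 ?mp_le_norm.
have Hf : Hardy p f by exact: HardyI H.
by split=> //; apply: hardy_norm_le; rewrite ?mulr_ge0 ?hardy_norm_ge0.
Qed.

Lemma hardy_normZ_le p (c : C) f : 0 < p -> Hardy p f ->
  hardy_norm p (c *: f) <= cabs c * hardy_norm p f.
Proof.
move=> p0 Hf; have [af _] := Hf.
have [||//] := @hardy_norm_dom p (c *: f) f (cabs c) p0 _ Hf (cabs_ge0 c).
  by have [] := HardyZ c p0 Hf.
by move=> z _; rewrite cabsM.
Qed.

Lemma hardy_norm_eq0 p f : 0 < p -> (forall z, cabs z < 1 -> f z = 0) -> hardy_norm p f = 0.
Proof.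
move=> p0 f0; apply/eqP; rewrite eq_le hardy_norm_ge0 andbT.
have H0 : Hardy p f by apply: Hardy_eq (Hardy0 p0) => // z /f0 ->.
apply: hardy_norm_le => // r r01; rewrite (@mp_eq p f 0 r)// mp0 ?powR_ge0//.
Qed.

Lemma cabs0_le_hardy_norm p f : 0 < p -> Hardy p f -> cabs (f 0) <= hardy_norm p f.
Proof.
move=> p0 Hf; have := mp_le_norm p0 Hf (_ : 0 <= 0 < 1); rewrite lexx ltr01 => /(_ isT).
have -> : mp p f 0 = cabs (f 0) `^ p.
  rewrite -[RHS]ravg_cst; apply: eq_ravg => t; rewrite /circ.
  by have -> : 0%:C%C * expi t = 0 :> C by rewrite mul0r.
have ip0 : 0 < p^-1 by rewrite invr_gt0.
move=> h; have := ler_powR2 ip0 (powR_ge0 _ _) h.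
by rewrite !powRpK ?cabs_ge0 ?hardy_norm_ge0.
Qed.

(** A quasi-triangle inequality in place of Minkowski's. From [(x + y)^p <= 2^p (x^p + y^p)] and
    [A^p + B^p <= 2 (A + B)^p] the [p]-th root leaves the constant [2 * 2^(1/p)], which is only a
    fixed factor in a differentiability estimate. *)
Lemma hardy_normD_le p f g : 0 < p -> Hardy p f -> Hardy p g -> 
  hardy_norm p (f + g) <= 2 * (2 `^ p^-1) * (hardy_norm p f + hardy_norm p g).
Proof.
move=> p0 Hf Hg; have [af _] := Hf; have [ag _] := Hg.
have nf := hardy_norm_ge0 p f; have ng := hardy_norm_ge0 p g.
have s0 := addr_ge0 nf ng.
have c0 : 0 <= 2 * 2 `^ p^-1 := mulr_ge0 (ler0n R 2) (powR_ge0 2 p^-1).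
apply: (hardy_norm_le p0 (HardyD p0 Hf Hg)); first exact: mulr_ge0 c0 s0.
move=> r r01; apply: le_trans (@mpD p f g r p0 _ _) _.
- by move=> t; exact: analytic_circ.
- by move=> t; exact: analytic_circ.
rewrite (powRM p c0 s0) (powRM p (ler0n R 2) (powR_ge0 2 p^-1)).
rewrite -(powRrM 2) mulVf ?gt_eqF// (powRr1 (ler0n R 2)).
rewrite -mulrA ler_wpM2l ?powR_ge0//.
apply: le_trans (lerD (mp_le_norm p0 Hf r01) (mp_le_norm p0 Hg r01)) _.
move: (hardy_norm p f) (hardy_norm p g) nf ng {c0 s0} => A B A0 B0.
have h1 : A `^ p <= (A + B) `^ p by apply: ler_powR2 => //; rewrite lerDl.
have h2 : B `^ p <= (A + B) `^ p by apply: ler_powR2 => //; rewrite lerDr.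
lra.
Qed.

Definition dbound p (L : (C -> C) -> C) (K : R) :=
  forall f, Hardy p f -> cabs (L f) <= K * hardy_norm p f.
Section Dual.
Variables (p : R) (p0 : 0 < p) (L : (C -> C) -> C).
Hypothesis HL : Hardy_dual p L.

(** The difference has norm 0, so boundedness of [L] forces equal values. This allows functions to
    be replaced by others that agree with them on the disc, as with [phi] and [flow]. *)
Lemma dual_eq f g : Hardy p f -> (forall z, cabs z < 1 -> f z = g z) -> L f = L g.
Proof.
move=> Hf fg; have Hg := Hardy_eq p0 fg Hf; have [lin [M LM]] := HL.
have := lin (-1) f g Hf Hg; rewrite mulN1r => E.
have : cabs (L (-1 *: f + g)) <= M * hardy_norm p (-1 *: f + g).
  by apply: LM; exact: Hardy_lin.
rewrite (@hardy_norm_eq0 p (-1 *: f + g))// ?mulr0; last first.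
  move=> z zd; rewrite -[LHS]/(-1 * f z + g z) fg//; ring.
move=> h; have /eqP : cabs (L (-1 *: f + g)) == 0 by rewrite eq_le h cabs_ge0.
move=> /eqP; rewrite cabs_eq0 E addrC subr_eq0 => /eqP //.
Qed.

Lemma dualD f g : Hardy p f -> Hardy p g -> L (f + g) = L f + L g.
Proof. by move=> Hf Hg; rewrite -[f]scale1r HL.1// mul1r scale1r. Qed.
Lemma dual0 : L 0 = 0.
Proof.
have := dualD (Hardy0 p0) (Hardy0 p0); rewrite addr0 => /eqP.
by rewrite -subr_eq0 opprD addNKr oppr_eq0 => /eqP.
Qed.
Lemma dualZ c f : Hardy p f -> L (c *: f) = c * L f.
Proof.
by move=> Hf; have := HL.1 c f 0 Hf (Hardy0 p0); rewrite dual0 !addr0.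
Qed.
Lemma dualB f g : Hardy p f -> Hardy p g -> L (f - g) = L f - L g.
Proof. by move=> Hf Hg; rewrite addrC -scaleN1r HL.1// mulN1r addrC. Qed.

Lemma dbound_dual_norm : dbound p L (dual_norm p L).
Proof.
have [lin [M LM]] := HL.
have ub : has_ubound [set cabs (L f) | f in [set f | Hardy p f /\ hardy_norm p f <= 1]].
  exists `|M| => _ [f [Hf f1] <-]; apply: le_trans (LM f Hf) _.
  apply: le_trans (ler_wpM2r (hardy_norm_ge0 p f) (ler_norm M)) _.
  by rewrite ler_piMr.
move=> f Hf; have nf := hardy_norm_ge0 p f.
have [nf0|nf0] := eqVneq (hardy_norm p f) 0.
  by have := LM f Hf; rewrite nf0 !mulr0.
have n0 : 0 < hardy_norm p f by rewrite lt_def nf0.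
pose c : C := ((hardy_norm p f)^-1)%:C%C.
have cn : cabs c = (hardy_norm p f)^-1 by rewrite cabs_real ger0_norm// invr_ge0.
have : cabs (L (c *: f)) <= dual_norm p L.
  apply: (ub_le_sup ub); exists (c *: f); last by [].
  split; first exact: HardyZ.
  by apply: le_trans (hardy_normZ_le c p0 Hf) _; rewrite cn mulVf.
by rewrite dualZ// cabsM cn ler_pdivrMl// mulrC.
Qed.

End Dual.

Lemma dual_norm_le p (L : (C -> C) -> C) (K : R) : 0 < p -> 0 <= K -> dbound p L K ->
  dual_norm p L <= K.
Proof.
move=> p0 K0 LK; apply: ge_sup.
  exists (cabs (L 0)), 0 => //; split; first exact: Hardy0.
  by rewrite hardy_norm_eq0.
move=> _ [f [Hf f1] <-]; apply: le_trans (LK f Hf) _.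
by rewrite ler_piMr.
Qed.


Lemma dual_norm_ge0 p (L : (C -> C) -> C) : 0 < p -> Hardy_dual p L -> 0 <= dual_norm p L.
Proof.
move=> p0 HL; have [f1|f1] := pselect (exists2 f, Hardy p f & hardy_norm p f != 0); last first.
  have L0 : dbound p L 0.
    move=> f Hf; have := dbound_dual_norm p0 HL Hf.
    have -> : hardy_norm p f = 0 by apply/eqP/negPn/negP => n; apply: f1; exists f.
    by rewrite !mulr0.
  rewrite /dual_norm; apply: ub_le_sup; last first.
    exists 0; last by rewrite (dual0 p0 HL) cabs0.
    by split; [exact: Hardy0|rewrite hardy_norm_eq0].
  by exists 0 => _ [f [Hf _] <-]; have := L0 f Hf; rewrite mul0r.
case: f1 => f Hf n0; have := le_trans (cabs_ge0 _) (dbound_dual_norm p0 HL Hf).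
by rewrite pmulr_lge0// lt_def n0 hardy_norm_ge0.
Qed.

Lemma dual_norm0 p (L : (C -> C) -> C) : 0 < p -> Hardy_dual p L ->
  (dual_norm p L = 0 <-> forall f, Hardy p f -> L f = 0).
Proof.
move=> p0 HL; split=> [n0 f Hf|L0].
  apply/eqP; rewrite -cabs_eq0 eq_le cabs_ge0 andbT.
  by have := dbound_dual_norm p0 HL Hf; rewrite n0 mul0r.
apply/eqP; rewrite eq_le dual_norm_ge0// andbT.
by apply: dual_norm_le => // f Hf; rewrite L0// cabs0 mul0r.
Qed.

Lemma Hardy_dual_lin p (c : C) (L N : (C -> C) -> C) : 0 < p ->
  Hardy_dual p L -> Hardy_dual p N -> Hardy_dual p (c *: L + N).
Proof.
move=> p0 HL HN; split=> [a f g Hf Hg|].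
  rewrite -[LHS]/(c * L (a *: f + g) + N (a *: f + g)) HL.1// HN.1//.
  by rewrite -[RHS]/(a * (c * L f + N f) + (c * L g + N g)); ring.
exists (cabs c * dual_norm p L + dual_norm p N) => f Hf.
apply: le_trans (cabsD _ _) _; rewrite mulrDl lerD//; last exact: dbound_dual_norm.
by rewrite cabsM -mulrA ler_wpM2l ?cabs_ge0//; exact: dbound_dual_norm.
Qed.

End HardySpace.

(** * Density of polynomials *)

Section PolynomialDensity.
Variable R : realType.
Local Notation C := R[i].
Local Notation tpi := ((pi : R) *+ 2).
Implicit Types (f g : C -> C) (p r s t : R) (z w a b : C).
Local Notation analytic := (analytic_on (@disc R)).

Lemma analytic_closed f r : analytic f -> r < 1 -> forall z, cabs z <= r -> cdifferentiable f z.
Proof. by move=> af r1 z zr; apply: af; exact: le_lt_trans r1. Qed.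

Lemma icts_cauchy_kernel r w : cabs w < r -> icts 0 tpi (fun t => circ r t / (circ r t - w)).
Proof.
move=> wr; apply: ictsM; first exact: icts_circ.
apply: ictsV => [t _|]; first exact: circ_sub_neq0.
by apply: ictsB; [exact: icts_circ|exact: icts_cst].
Qed.

(** Subtract Cauchy's formulas at [w] and [w'] on a circle of radius [s] halfway between [r] and 1;
    both denominators are at least [s - r]. *)
Lemma analytic_lipschitz f r : 0 <= r < 1 -> analytic f ->
  exists2 K : R, 0 < K & forall w w', cabs w <= r -> cabs w' <= r ->
    cabs (f w - f w') <= K * cabs (w - w').
Proof.
move=> /andP[r0 r1] af; pose s := (1 + r) / 2.
have rs : r < s by rewrite /s; lra.
have s1 : s < 1 by rewrite /s; lra.
have s0 : 0 < s by lra.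
have s01 : 0 <= s < 1 by rewrite s1 ltW.
have df := analytic_closed af s1.
have cf t : ccts f (circ s t) by exact: analytic_circ.
have [B B0 fB] := circle_bounded cf.
have d0 : 0 < s - r by rewrite subr_gt0.
exists (2 * (B * s / (s - r) ^+ 2)); first by rewrite mulr_gt0// divr_gt0 ?exprn_gt0// mulr_gt0.
move=> w w' wr wr'; have ws := le_lt_trans wr rs; have ws' := le_lt_trans wr' rs.
rewrite -(cauchy_formula ws df) -(cauchy_formula ws' df).
have c1 : icts 0 tpi (fun t => f (circ s t) * (circ s t / (circ s t - w))).
  by apply: ictsM; [exact: icts_comp_circ|exact: icts_cauchy_kernel].
have c2 : icts 0 tpi (fun t => f (circ s t) * (circ s t / (circ s t - w'))).
  by apply: ictsM; [exact: icts_comp_circ|exact: icts_cauchy_kernel].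
rewrite -cavgB// -mulrA; apply: cabs_cavg; first exact: ictsB.
move=> t tt; have z1 := circ_sub_neq0 t ws; have z2 := circ_sub_neq0 t ws'.
have zs := cabs_circ t (ltW s0); have fz := fB t tt; move: (circ s t) z1 z2 zs fz => z z1 z2 zs fz.
have -> : f z * (z / (z - w)) - f z * (z / (z - w')) = f z * z * (w - w') / ((z - w) * (z - w')).
  by field; rewrite z1 z2.
have h1 : s - r <= cabs (z - w) by have := ler_cabs_sub z w; rewrite zs; lra.
have h2 : s - r <= cabs (z - w') by have := ler_cabs_sub z w'; rewrite zs; lra.
rewrite cabsM cabsV (cabsM _ (w - w')) (cabsM (f z)) (cabsM (z - w)) zs.
have dd : (s - r) ^+ 2 <= cabs (z - w) * cabs (z - w').
  by rewrite expr2; apply: ler_pM => //; exact: ltW.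
rewrite ler_pdivrMr; last by apply: lt_le_trans dd; rewrite exprn_gt0.
have n0 : 0 <= B * s / (s - r) ^+ 2 * cabs (w - w').
  exact: mulr_ge0 (ltW (divr_gt0 (mulr_gt0 B0 s0) (exprn_gt0 2 d0))) (cabs_ge0 _).
apply: le_trans (ler_wpM2l n0 dd).
have -> : B * s / (s - r) ^+ 2 * cabs (w - w') * (s - r) ^+ 2 = B * s * cabs (w - w').
  by field; rewrite gt_eqF.
by rewrite !ler_wpM2r ?cabs_ge0// ltW.
Qed.

Lemma geometric_remainder z w n : z != 0 -> z - w != 0 ->
  z / (z - w) - \sum_(k < n) (w / z) ^+ k = (w / z) ^+ n * (z / (z - w)).
Proof.
move=> z0 zw; elim: n => [|n IH]; first by rewrite big_ord0 subr0 expr0 mul1r.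
rewrite big_ord_recr /= opprD addrA IH exprS.
by field; rewrite z0 zw.
Qed.

Lemma exists_expn_lt (q e : R) : 0 <= q < 1 -> 0 < e -> exists n, q ^+ n < e.
Proof.
move=> /andP[q0 q1] e0.
have /cvgrPdist_lt/(_ e e0)[n _ H] : (fun n => q ^+ n) @ \oo --> (0 : R).
  by apply: cvg_expr; rewrite ger0_norm.
by exists n; have := H n (leqnn n); rewrite /= sub0r normrN ger0_norm// exprn_ge0.
Qed.

Lemma icts_sum (I : Type) (l : seq I) (h : I -> R -> C) x y :
  (forall i, icts x y (h i)) -> icts x y (fun t => \sum_(i <- l) h i t).
Proof.
move=> ch; elim: l => [|i l IH].
  by rewrite (_ : (fun _ => _) = fun=> 0); [exact: icts_cst|apply/funext => t; rewrite big_nil].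
rewrite (_ : (fun _ => _) = fun t => h i t + \sum_(j <- l) h j t).
  by apply: ictsD.
by apply/funext => t; rewrite big_cons.
Qed.

Lemma cavg_sum (I : Type) (l : seq I) (h : I -> R -> C) :
  (forall i, icts 0 tpi (h i)) -> cavg (fun t => \sum_(i <- l) h i t) = \sum_(i <- l) cavg (h i).
Proof.
move=> ch; elim: l => [|i l IH].
  by rewrite big_nil -[RHS]cavg_cst; apply: eq_cavg => t; rewrite big_nil.
rewrite big_cons -IH -cavgD//; first by apply: eq_cavg => t; rewrite big_cons.
exact: icts_sum.
Qed.

(** The coefficients are Cauchy integrals over a radius [s] between [r] and 1, so the tail is of
    order [(r / s)^n]. The first conclusion, vanishing coefficients when [f] vanishes near 0, turns
    the approximation into the identity theorem [analytic_zero]. *)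
Lemma taylor_uniform f r (e : R) : 0 < r < 1 -> analytic f -> 0 < e ->
  exists n (c : nat -> C), (forall d : R, 0 < d -> (forall z, cabs z < d -> f z = 0) ->
      forall k, c k = 0) /\
    forall z, cabs z < 1 -> cabs (f (r%:C%C * z) - \sum_(k < n) c k * z ^+ k) <= e.
Proof.
move=> /andP[r0 r1] af e0; pose s := (1 + r) / 2.
have rs : r < s by rewrite /s; lra.
have s1 : s < 1 by rewrite /s; lra.
have s0 : 0 < s by lra.
have s01 : 0 <= s < 1 by rewrite s1 ltW.
have df := analytic_closed af s1.
have cf t : ccts f (circ s t) by exact: analytic_circ.
have [B B0 fB] := circle_bounded cf.
have d0 : 0 < s - r by rewrite subr_gt0.
have M0 : 0 < 2 * (B * s / (s - r)) by rewrite mulr_gt0// divr_gt0// mulr_gt0.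
have q01 : 0 <= r / s < 1 by rewrite divr_ge0 ?(ltW r0) ?(ltW s0)// ltr_pdivrMr// mul1r.
have [n qn] := exists_expn_lt q01 (divr_gt0 e0 M0).
pose cc (k : nat) := cavg (fun t => f (circ s t) * (circ s t)^-1 ^+ k).
exists n, (fun k => cc k * (r%:C%C) ^+ k); split=> [d d00 fd k|z z1].
  suff -> : cc k = 0 by rewrite mul0r.
  (* The mean of [f z * z^-k] is the same on all circles around 0 up to radius [s], so the circle
     can be shrunk into the zero set of [f]. *)
  pose s' := Num.min s (d / 2).
  have s'0 : 0 < s' by rewrite lt_min s0 divr_gt0.
  have s's : s' <= s by rewrite ge_min lexx.
  have s'd : s' < d by rewrite gt_min; apply/orP; right; lra.
  pose h z := f z * z^-1 ^+ k.
  have dh z : s' <= cabs z <= s -> exists l, cder h z l.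
    move=> /andP[z1 z2]; have zn : z != 0 by rewrite -cabs_gt0; lra.
    have /cdifferentiableP[l dl] := df z z2; have dV := cderV zn (cder_id z).
    have powd (j : nat) : exists m, cder (fun z => z^-1 ^+ j) z m.
      elim: j => [|j [m IH]]; first by exists 0; under [X in cder X]eq_fun do rewrite expr0; exact: cder_cst.
      by eexists; under [X in cder X]eq_fun do rewrite exprS; apply: cderM; [exact: dV|exact: IH].
    have [m dm] := powd k.
    by eexists; apply: cderM; [exact: dl|exact: dm].
  rewrite -[cc k]/(cavg (h \o circ s)) -(@cavg_circ_const _ h s' s 0) ?s'0//.
  - rewrite -[RHS]cavg_cst; apply: eq_cavg => t /=.
    by rewrite /h fd ?mul0r// cabs_circ// ltW.
  - by move=> z /dh[l /cder_ccts].
  - by move=> z /dh[l /cder_cdiff].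
set w : C := r%:C%C * z.
have wr : cabs w <= r by rewrite cabsM cabs_real gtr0_norm// ler_piMr// ltW.
have ws := le_lt_trans wr rs.
have z0 t : circ s t != 0 by rewrite -cabs_gt0 cabs_circ// ltW.
have cfi : icts 0 tpi (f \o circ s) by exact: icts_comp_circ.
have cX (h : R -> C) k : icts 0 tpi h -> icts 0 tpi (fun t => h t ^+ k).
  move=> ch; elim: k => [|k IH]; first by under [X in icts _ _ X]eq_fun do rewrite expr0; exact: icts_cst.
  by under [X in icts _ _ X]eq_fun do rewrite exprS; exact: ictsM.
have cI : icts 0 tpi (fun t => (circ s t)^-1) by apply: ictsV => [t _|]; [exact: z0|exact: icts_circ].
have ck k : icts 0 tpi (fun t => f (circ s t) * (circ s t)^-1 ^+ k) by apply: ictsM => //; exact: cX.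
have ck2 k : icts 0 tpi (fun t => w ^+ k * (f (circ s t) * (circ s t)^-1 ^+ k)).
  by apply: ictsM => //; exact: icts_cst.
have -> : \sum_(k < n) cc k * r%:C%C ^+ k * z ^+ k =
   cavg (fun t => \sum_(k < n) w ^+ k * (f (circ s t) * (circ s t)^-1 ^+ k)).
  rewrite (@cavg_sum 'I_n _ (fun k t => w ^+ k * (f (circ s t) * (circ s t)^-1 ^+ k)))//.
  by apply: eq_bigr => k _; rewrite cavgZ// -/(cc k) /w exprMn; ring.
rewrite -(cauchy_formula ws df) -cavgB; last 2 first.
- by apply: ictsM => //; exact: icts_cauchy_kernel.
- by apply: (@icts_sum 'I_n _ (fun k t => w ^+ k * (f (circ s t) * (circ s t)^-1 ^+ k))) => k; exact: ck2.
apply: (@le_trans _ _ (2 * (B * s / (s - r)) * (r / s) ^+ n)); last first.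
  by rewrite mulrC -ler_pdivlMr// ltW.
rewrite -mulrA; apply: cabs_cavg.
  apply: ictsB; first by apply: ictsM => //; exact: icts_cauchy_kernel.
  by apply: (@icts_sum 'I_n _ (fun k t => w ^+ k * (f (circ s t) * (circ s t)^-1 ^+ k))) => k; exact: ck2.
move=> t tt; have zw := circ_sub_neq0 t ws; have z0t := z0 t.
have zs := cabs_circ t (ltW s0); have fz := fB t tt.
clearbody w s; move: (circ s t) zw zs fz z0t => u zw zs fz u0.
have -> : f u * (u / (u - w)) - \sum_(k < n) w ^+ k * (f u * u^-1 ^+ k) =
    f u * ((w / u) ^+ n * (u / (u - w))).
  rewrite -(geometric_remainder n u0 zw) mulrBr mulr_sumr; congr (_ - _).
  by apply: eq_bigr => k _; have -> : (w / u) ^+ k = w ^+ k * u^-1 ^+ k; [rewrite exprMn|exact: mulrCA].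
rewrite !cabsM cabsX !cabsM !cabsV zs.
have h1 : s - r <= cabs (u - w) by have := ler_cabs_sub u w; rewrite zs; lra.
have -> : B * s / (s - r) * (r / s) ^+ n = B * ((r / s) ^+ n * (s / (s - r))) by ring.
have a1 : 0 <= cabs w / s by rewrite divr_ge0 ?cabs_ge0// ltW.
have a2 : cabs w / s <= r / s by rewrite ler_wpM2r// invr_ge0 ltW.
have a3 : s / cabs (u - w) <= s / (s - r).
  by rewrite ler_wpM2l ?(ltW s0)// lef_pV2 ?posrE ?(lt_le_trans d0).
apply: ler_pM => //; rewrite ?cabs_ge0// ?mulr_ge0 ?exprn_ge0 ?invr_ge0 ?cabs_ge0// ?(ltW s0)//.
apply: ler_pM => //; rewrite ?mulr_ge0 ?exprn_ge0 ?invr_ge0 ?cabs_ge0// ?(ltW s0)//.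
by rewrite lerXn2r// nnegrE (le_trans a1).
Qed.

Lemma analytic_zero f d : analytic f -> 0 < d -> (forall z, cabs z < d -> f z = 0) ->
  forall z, cabs z < 1 -> f z = 0.
Proof.
move=> af d0 fd z z1; have z0 := cabs_ge0 z.
pose r := (1 + cabs z) / 2; have r0 : 0 < r by rewrite /r; lra.
have r1 : r < 1 by rewrite /r; lra.
have r01 : 0 < r < 1 by rewrite r0.
have rz : cabs (z / r%:C%C) < 1.
  by rewrite cabsM cabsV cabs_real gtr0_norm// ltr_pdivrMr// mul1r /r; lra.
apply/eqP; rewrite -cabs_eq0 eq_le cabs_ge0 andbT.
apply: (@le_epsilon0 _ _ 1 1) => // e e0 _.
have [n [c [c0 H]]] := taylor_uniform r01 af e0.
have := H _ rz; rewrite mul1r.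
have -> : r%:C%C * (z / r%:C%C) = z by rewrite mulrC divfK// -cabs_gt0 cabs_real gtr0_norm.
by rewrite big1 ?subr0// => k _; rewrite (c0 d)// mul0r.
Qed.

(* Uniform convexity of the [p]-th power: with [t = |b|] and [u = (1 + t) / 2] the defect
   splits into the radial part [(1 + t^p) / 2 - u^p] and the angular part
   [u^p - |(1 + b) / 2|^p]; one of them is large when [b] is far from [1]. *)
Lemma radial_defect p (eta : R) : 1 < p -> 0 < eta <= 1 -> exists2 d : R, 0 < d &
  forall t : R, 0 <= t <= 1 - eta -> d <= (1 + t `^ p) / 2 - ((1 + t) / 2) `^ p.
Proof.
move=> p1 /andP[eta0 eta1]; have p1' := ltW p1; have p0 : 0 < p by lra.
(* For [t <= 1 - eta] and [u = (1 + t) / 2] one has [1 / u >= x0 > 1]. The tangent of [x^p] at [u]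
   bounds the defect below by [u^p G (1 / u) / 2], with [G] the gap in Bernoulli's inequality, and
   [u >= 1 / 2]. *)
pose x0 := (1 - eta / 2)^-1.
have e1 : 0 < 1 - eta / 2 by lra.
have x01 : 1 < x0 by rewrite /x0 invf_gt1//; lra.
pose G x := x `^ p - (1 + p * (x - 1)).
have G0 : 0 < G x0 by rewrite subr_gt0 powR_sub1_gt// ?gt_eqF//; lra.
have Gm x : x0 <= x -> G x0 <= G x.
  move=> xx; have x00 : 0 < x0 by lra.
  have := powR_tangent p1' (_ : 0 <= x) x00; rewrite (le_trans (ltW x00) xx) => /(_ isT) h.
  have : 1 <= x0 `^ (p - 1).
    have pp : 0 <= p - 1 by lra.
    by have := ler_powR (ltW x01) pp; rewrite powRr0.
  rewrite /G; move: (x0 `^ (p - 1)) (x `^ p) (x0 `^ p) h => A B D h A1.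
  have : 0 <= p * (A - 1) * (x - x0) by rewrite !mulr_ge0 ?subr_ge0// ltW.
  lra.
exists ((1 / 2) `^ p / 2 * G x0).
  by rewrite !mulr_gt0 ?powR_gt0// ?invr_gt0//; lra.
move=> t /andP[t0 t1]; set u := (1 + t) / 2.
have u0 : 0 < u by rewrite /u; lra.
have ux : x0 <= u^-1 by rewrite /x0 lef_pV2 ?posrE// /u; lra.
have h1 := powR_tangent p1' t0 u0.
have h2 : 1 / 2 `^ p <= u `^ p -> True by [].
have h3 : (1 / 2) `^ p <= u `^ p by apply: ler_powR2 => //; rewrite ?/u; lra.
have E : u `^ p * G u^-1 = 1 - u `^ p - p * u `^ (p - 1) * (1 - u).
  have uE : u `^ p = u * u `^ (p - 1) by rewrite mulr_powRB1// ltW.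
  have : u `^ p * (u^-1) `^ p = 1 by rewrite -powRM ?invr_ge0 ?(ltW u0)// mulfV ?gt_eqF// powR1.
  rewrite /G mulrBr => ->; rewrite uE; field; rewrite gt_eqF//.
have : (1 / 2) `^ p * G x0 <= u `^ p * G u^-1.
  by apply: ler_pM => //; rewrite ?powR_ge0 ?(ltW G0) ?Gm.
rewrite E; move: h1; rewrite (_ : t - u = - (1 - u)); last by rewrite /u; lra.
move: (u `^ p) (t `^ p) (_ `^ (p - 1)) ((1 / 2) `^ p) => A B D H; nra.
Qed.

Lemma midpoint_powR p t : 1 <= p -> 0 <= t -> ((1 + t) / 2) `^ p <= (1 + t `^ p) / 2.
Proof.
move=> p1 t0; set u := (1 + t) / 2; have u0 : 0 < u by rewrite /u; lra.
have h1 := powR_tangent p1 t0 u0; have h2 := powR_tangent p1 (ler01 : 0 <= 1 :> R) u0.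
rewrite powR1 in h2; have : t - u = - (1 - u) by rewrite /u; lra.
move: h1 h2; move: (u `^ p) (t `^ p) (u `^ (p - 1)) => A B D h1 h2 tu; rewrite tu in h1.
nra.
Qed.

Lemma sqr_cabs1D b : cabs (1 + b) ^+ 2 = (1 + cabs b) ^+ 2 - 2 * (cabs b - Re b).
Proof.
have := sqr_cabs b; rewrite (sqr_cabs (1 + b)) cReD cImD; move: (cabs b) => t.
by case: b => x y /=; nra.
Qed.
Lemma sqr_cabs1B b : cabs (1 - b) ^+ 2 = (1 - cabs b) ^+ 2 + 2 * (cabs b - Re b).
Proof.
have := sqr_cabs b; rewrite (sqr_cabs (1 - b)) cReD cImD cReN cImN; move: (cabs b) => t.
by case: b => x y /=; nra.
Qed.
Lemma cabs_half a : cabs (a / 2) = cabs a / 2.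
Proof.
rewrite cabsM cabsV; congr (_ / _).
by have := cabs_real (2 : R); rewrite ger0_norm// => <-; congr cabs; rewrite rmorph_nat.
Qed.

Lemma convexity_defect p (eps : R) : 1 < p -> 0 < eps <= 1 -> exists2 d : R, 0 < d &
  forall b, cabs b <= 1 -> eps <= cabs (1 - b) ->
    d <= (1 + cabs b `^ p) / 2 - cabs ((1 + b) / 2) `^ p.
Proof.
move=> p1 /andP[e0 e1]; have p1' := ltW p1; have p0 : 0 < p by lra.
have [|d1 d10 H1] := @radial_defect p (eps / 2) p1; first by apply/andP; split; lra.
(* Angular case, [t = |b| > 1 - eps / 2]. Let [s = 2 (t - Re b)]; then [|1 - b|^2 = (1 - t)^2 + s]
   gives [s >= eps^2 / 2], and [|1 + b|^2 = (1 + t)^2 - s] gives [|1 + b| / 2 <= u - s / 8]. Hence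
   the defect is at least [u^(p-1) s / 8], with [u >= 1 / 2]. *)
pose d2 := (1 / 2) `^ (p - 1) * (eps ^+ 2 / 16).
have d20 : 0 < d2 by rewrite /d2 !mulr_gt0 ?powR_gt0 ?exprn_gt0//; lra.
exists (Num.min d1 d2); first by rewrite lt_min d10.
move=> b b1 eb; rewrite cabs_half.
have t0 := cabs_ge0 b; have n0 := cabs_ge0 (1 + b).
have sD := sqr_cabs1D b; have sB := sqr_cabs1B b.
have s0 : 0 <= cabs b - Re b.
  by rewrite subr_ge0; apply: le_trans (ler_norm _) (ler_Re_cabs _).
have tri : cabs (1 + b) <= 1 + cabs b by have := cabsD 1 b; rewrite cabs1.
have mid := midpoint_powR p1' t0.
have [h|h] := leP (cabs b) (1 - eps / 2).
  rewrite ge_min; apply/orP; left.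
  apply: le_trans (H1 (cabs b) _) _; first by rewrite t0.
  by rewrite lerD2l lerN2 ler_powR2//; lra.
rewrite ge_min; apply/orP; right.
have e2 : eps ^+ 2 <= cabs (1 - b) ^+ 2 by rewrite lerXn2r ?nnegrE ?cabs_ge0// ltW.
move: (cabs b) (Re b) t0 b1 h sD sB s0 tri mid e2 => t x t0 t1 h sD sB s0 tri mid e2.
set N := cabs (1 + b) in n0 sD tri *.
pose u := (1 + t) / 2; pose s := 2 * (t - x).
have s1 : eps ^+ 2 / 2 <= s.
  have : (1 - t) ^+ 2 <= (eps / 2) ^+ 2 by rewrite lerXn2r ?nnegrE//; lra.
  by rewrite /s; lra.
have sN : s <= (1 + t) ^+ 2 by have := sqr_ge0 N; rewrite sD /s; lra.
have Nu : N / 2 <= u - s / 8.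
  have us : 0 <= u - s / 8 by rewrite /u; nra.
  rewrite -(@ler_pXn2r _ 2)// ?nnegrE//; last by lra.
  have -> : (N / 2) ^+ 2 = u ^+ 2 - s / 4 by rewrite exprMn sD /u /s; field.
  have u1 : u <= 1 by rewrite /u; lra.
  have := sqr_ge0 (s / 8); have : 0 <= s by rewrite /s; lra.
  nra.
have u12 : 1 / 2 <= u by rewrite /u; lra.
have D2 : d2 <= u `^ p - (N / 2) `^ p.
  have N20 : 0 <= N / 2 by lra.
  rewrite -(@mulr_powRB1 _ u p)// -?(@mulr_powRB1 _ (N / 2) p)//; last by lra.
  have q1 : (N / 2) `^ (p - 1) <= u `^ (p - 1).
    apply: ge0_ler_powR; rewrite ?nnegrE//; first by lra.
      by lra.
    have : 0 <= s by rewrite /s; lra.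
    lra.
  have q2 : (1 / 2) `^ (p - 1) <= u `^ (p - 1).
    by apply: ge0_ler_powR; rewrite ?nnegrE//; lra.
  have q0 : 0 <= (1 / 2) `^ (p - 1) by exact: powR_ge0.
  have : N / 2 * (N / 2) `^ (p - 1) <= N / 2 * u `^ (p - 1) by rewrite ler_wpM2l.
  rewrite /d2; move: ((N / 2) `^ (p - 1)) (u `^ (p - 1)) ((1 / 2) `^ (p - 1)) q1 q2 q0 => A B D q1 q2 q0 hh.
  have : D * (eps ^+ 2 / 16) <= B * (u - N / 2).
    apply: ler_pM => //; last by lra.
    by have := sqr_ge0 eps; lra.
  lra.
by rewrite /u in D2; lra.
Qed.

Lemma convexity_defect_ge0 p b : 1 <= p -> 0 <= (1 + cabs b `^ p) / 2 - cabs ((1 + b) / 2) `^ p.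
Proof.
move=> p1; rewrite subr_ge0; apply: le_trans (midpoint_powR p1 (cabs_ge0 b)).
rewrite cabs_half ler_powR2//; first by lra.
  by rewrite divr_ge0 ?cabs_ge0.
by have := cabsD 1 b; rewrite cabs1; lra.
Qed.

(** Stated without normalisation and linearly in the [p]-th powers, so that it can be integrated
    over a circle. Homogeneity reduces it to [a = 1], [|b| <= 1]. *)
Lemma uniform_convexity p (eps : R) : 1 < p -> 0 < eps -> exists2 K : R, 0 <= K &
  forall a b, cabs (a - b) `^ p <= eps * (cabs a `^ p + cabs b `^ p) +
    K * ((cabs a `^ p + cabs b `^ p) / 2 - cabs ((a + b) / 2) `^ p).
Proof.
move=> p1 e0; have p1' := ltW p1; have p0 : 0 < p by lra.
(* If [|1 - b| < e'], the first term alone suffices; otherwise the defect is at least [d], while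
   [|1 - b|^p <= 2^p], whence [K = 2^p / d]. *)
pose e' := Num.min 1 (eps `^ p^-1).
have e'01 : 0 < e' <= 1 by rewrite lt_min ltr01 powR_gt0// ge_min lexx.
have e'p : e' `^ p <= eps.
  have -> : eps = (eps `^ p^-1) `^ p by rewrite -powRrM mulVf ?gt_eqF// powRr1// ltW.
  by apply: ler_powR2 => //; [rewrite ltW//; case/andP: e'01|rewrite ge_min lexx orbT].
have [d d0 H] := convexity_defect p1 e'01.
exists (2 `^ p / d); first by rewrite divr_ge0 ?powR_ge0// ltW.
have H1 b : cabs b <= 1 -> cabs (1 - b) `^ p <= eps * (1 + cabs b `^ p) +
    2 `^ p / d * ((1 + cabs b `^ p) / 2 - cabs ((1 + b) / 2) `^ p).
  move=> b1; have q := convexity_defect_ge0 b p1'.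
  have bp := powR_ge0 (cabs b) p.
  have kd : 0 <= 2 `^ p / d by rewrite divr_ge0 ?powR_ge0// ltW.
  have [h|h] := leP e' (cabs (1 - b)).
    apply: (@le_trans _ _ (2 `^ p)).
      by apply: ler_powR2; rewrite ?cabs_ge0//; have := cabsB 1 b; rewrite cabs1; lra.
    have := ler_wpM2l kd (H b b1 h); rewrite divfK ?gt_eqF// => h2.
    by apply: le_trans h2 _; rewrite lerDr mulr_ge0 ?addr_ge0// ltW.
  apply: (@le_trans _ _ eps).
    by apply: le_trans e'p; apply: ler_powR2; rewrite ?cabs_ge0// ltW.
  apply: (@le_trans _ _ (eps * (1 + cabs b `^ p))).
    by rewrite mulrDr mulr1 lerDl mulr_ge0// ltW.
  by rewrite lerDl mulr_ge0.
have H2 a b : cabs b <= cabs a -> cabs (a - b) `^ p <= eps * (cabs a `^ p + cabs b `^ p) +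
    2 `^ p / d * ((cabs a `^ p + cabs b `^ p) / 2 - cabs ((a + b) / 2) `^ p).
  move=> ba; have [a0|a0] := eqVneq a 0.
    have b0 : b = 0 by apply/eqP; rewrite -cabs_eq0 eq_le cabs_ge0 andbT; move: ba; rewrite a0 cabs0.
    by rewrite a0 b0 subr0 addr0 mul0r cabs0 powR0 ?gt_eqF// addr0 mul0r subrr !mulr0 addr0.
  have ca : 0 < cabs a by rewrite cabs_gt0.
  have cb1 : cabs (b / a) <= 1 by rewrite cabsM cabsV ler_pdivrMr// mul1r.
  have bE : b = a * (b / a) by field.
  move: (b / a) bE cb1 {ba} => c -> c1.
  have -> : a - a * c = a * (1 - c) by ring.
  have -> : (a + a * c) / 2 = a * ((1 + c) / 2) by ring.
  rewrite (cabsM a) (cabsM a) (cabsM a) !powRM ?cabs_ge0//.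
  apply: le_trans (ler_wpM2l (powR_ge0 (cabs a) p) (H1 _ c1)) _.
  by rewrite le_eqVlt; apply/orP; left; apply/eqP; ring.
move=> a b; have [/H2//|/ltW/H2] := leP (cabs b) (cabs a).
by rewrite cabsBC [b + a]addrC [cabs b `^ p + _]addrC.
Qed.

Lemma ravg_le2 (u v : R -> R) : rcts 0 tpi u -> rcts 0 tpi v ->
  (forall t, 0 <= t <= tpi -> u t <= v t) -> ravg u <= ravg v.
Proof.
by move=> cu cv uv; rewrite /ravg ler_wpM2l ?invr_ge0 ?(ltW (tpi_gt0 R))//; apply: rint_le.
Qed.

Lemma mp_near_norm p f (d : R) : 0 < p -> Hardy p f -> 0 < d ->
  exists2 r : R, 0 <= r < 1 & hardy_norm p f `^ p - d < mp p f r.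
Proof.
move=> p0 Hf d0; apply: contrapT => no.
have H r : 0 <= r < 1 -> mp p f r <= hardy_norm p f `^ p - d.
  by move=> r01; rewrite leNgt; apply/negP => h; apply: no; exists r.
have M0 : 0 <= hardy_norm p f `^ p - d.
  by apply: le_trans (H 0 _); [exact: mp_ge0|rewrite lexx ltr01].
have := @hardy_norm_le _ p f ((hardy_norm p f `^ p - d) `^ p^-1) p0 Hf (powR_ge0 _ _).
rewrite -powRrM mulVf ?gt_eqF// powRr1// => /(_ H).
have := hardy_norm_ge0 p f; move: (hardy_norm p f) M0 => N M0 N0 h.
have := ler_powR2 p0 N0 h; rewrite -powRrM mulVf ?gt_eqF// powRr1//; lra.
Qed.

Lemma powR_sub_ge p (x a e B : R) : 1 <= p -> 0 <= x -> 0 <= a -> a <= B -> 0 <= e -> a - e <= x ->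
  a `^ p - p * B `^ (p - 1) * e <= x `^ p.
Proof.
move=> p1 x0 a0 aB e0 ae; have p0 : 0 < p by lra.
have K0 : 0 <= p * B `^ (p - 1) * e by rewrite !mulr_ge0 ?powR_ge0// ltW.
have [a00|a00] := eqVneq a 0.
  by rewrite a00 powR0 ?gt_eqF//; have := powR_ge0 x p; lra.
have ap : 0 < a by rewrite lt_def a00.
apply: le_trans (powR_tangent p1 x0 ap).
have AB : a `^ (p - 1) <= B `^ (p - 1).
  by apply: ge0_ler_powR; rewrite ?nnegrE//; lra.
rewrite lerD2l -[X in _ <= X]opprK lerN2 -mulrN.
apply: (@le_trans _ _ (p * a `^ (p - 1) * e)).
  by rewrite ler_wpM2l ?mulr_ge0 ?powR_ge0 ?(ltW p0)//; lra.
by rewrite ler_wpM2r// ler_wpM2l// ltW.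
Qed.

Definition dil r f : C -> C := fun z => f (r%:C%C * z).

Lemma dil_circ r s t : circ (r * s) t = r%:C%C * circ s t.
Proof. by rewrite /circ real_complexM mulrA. Qed.

Lemma mp_dil p r s f : mp p (dil r f) s = mp p f (r * s).
Proof. by apply: eq_ravg => t; rewrite /dil dil_circ. Qed.

Lemma analytic_dil r f : 0 <= r <= 1 -> analytic f -> analytic (dil r f).
Proof.
move=> /andP[r0 r1] af z zd.
have /cdifferentiableP[l dl] : cdifferentiable f (r%:C%C * z).
  apply: af; rewrite /disc /= cabsM cabs_real ger0_norm//.
  by apply: le_lt_trans zd; rewrite ler_piMl ?cabs_ge0.
apply: cder_cdiff; apply: (@cder_comp _ (fun z => r%:C%C * z) f _ _ _ _ dl).
by have := cder_affine r%:C%C 0 z; under [X in cder X]eq_fun do rewrite addr0; exact.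
Qed.

Lemma Hardy_dil p r f : 0 < p -> 0 <= r <= 1 -> Hardy p f -> Hardy p (dil r f).
Proof.
move=> p0 r01 Hf; have [af _] := Hf.
apply: (@HardyI _ _ _ (hardy_norm p f `^ p) p0); first exact: analytic_dil.
move=> s /andP[s0 s1]; case/andP: r01 => r0 r1.
rewrite mp_dil mp_le_norm// mulr_ge0//=; apply: le_lt_trans s1; by rewrite ler_piMl.
Qed.

Lemma mp_mono p f r s : 1 <= p -> analytic f -> 0 <= r <= s -> s < 1 -> mp p f r <= mp p f s.
Proof.
move=> p1 af /andP[r0]; rewrite le_eqVlt => /predU1P[->//|rs] s1.
by apply: mp_le => //; [rewrite r0|exact: analytic_closed].
Qed.

(** The arithmetic that closes [dil_converges]: [X], [Y], [Z] stand for the means of [|f|^p],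
    [|dil r f|^p] and of their midpoint. Half of [E] pays for the small multiple of [X + Y], half
    for the convexity defect. *)
Lemma convexity_budget (E M K X Y Z : R) : 0 < E -> 0 <= M -> 0 <= K -> X <= M -> Y <= M ->
  M - 2 * (E / (4 * (K + 1))) <= Z -> (E / (4 * (M + 1)) + K / 2) * (X + Y) - K * Z <= E.
Proof.
move=> E0 M0 K0 XM YM MZ; have M1 : 0 < M + 1 by lra.
have K1 : 0 < K + 1 by lra.
have e1 : E / (4 * (M + 1)) * (X + Y) <= E / 2.
  rewrite mulrAC ler_pdivrMr ?mulr_gt0//; nra.
have e2 : K * (M - Z) <= E / 2.
  apply: (@le_trans _ _ (K * (2 * (E / (4 * (K + 1)))))); first by rewrite ler_wpM2l//; lra.
  have -> : K * (2 * (E / (4 * (K + 1)))) = E * (2 * K) / (4 * (K + 1)) by ring.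
  rewrite ler_pdivrMr ?mulr_gt0//; nra.
nra.
Qed.

(** Choose [r0] where the mean of [|f|^p] is within [d] of its supremum [M]. For [r] near 1 the
    midpoint [g] of [f] and [dil r f] has mean at least [M - 2d] on that circle, hence on all larger
    ones, whereas the means of [f] and [dil r f] never exceed [M]. Uniform convexity then makes the
    mean of [|f - dil r f|^p] small on every circle. *)
Lemma dil_converges p f (e : R) : 1 < p -> Hardy p f -> 0 < e ->
  exists2 r : R, 0 < r < 1 & hardy_norm p (f - dil r f) <= e.
Proof.
move=> p1 Hf e0; have p1' := ltW p1; have p0 : 0 < p by lra.
have aux (X Y Z W : R) : Y - Z < X -> X - Z <= W -> Y - 2 * Z <= W by lra.
have [af _] := Hf; pose M := hardy_norm p f `^ p.
have M0 : 0 <= M by exact: powR_ge0.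
have ep0 : 0 < e `^ p by exact: powR_gt0.
have Meps : 0 < e `^ p / (4 * (M + 1)) by rewrite divr_gt0// mulr_gt0//; lra.
have [K K0 UC] := uniform_convexity p1 Meps.
pose d := e `^ p / (4 * (K + 1)).
have d0 : 0 < d by rewrite divr_gt0// mulr_gt0//; lra.
have [r0 r001 Mr0] := mp_near_norm p0 Hf d0; rewrite -/M in Mr0.
have /andP[r00 r01] := r001.
have [Lp Lp0 lip] := analytic_lipschitz r001 af.
have cf t : ccts f (circ r0 t) by exact: analytic_circ.
have [B B0 fB] := circle_bounded cf.
(* On the circle of radius [r0], [|g| >= |f| - Lp h] with [h = 1 - r]. By [powR_sub_ge] this costs
   at most [p B^(p-1) Lp h <= h Q <= d] in the [p]-th power. *)
pose Q := p * B `^ (p - 1) * Lp + 1.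
have Q0 : 0 < Q by rewrite addr_gt0// !mulr_gt0// powR_gt0.
pose h := Num.min (1 / 2) (d / Q).
have h0 : 0 < h by rewrite lt_min (divr_gt0 d0 Q0) andbT; lra.
have h12 : h <= 1 / 2 by rewrite ge_min lexx.
have hd : h * Q <= d by rewrite -ler_pdivlMr// ge_min lexx orbT.
pose r : R := 1 - h.
have r_01 : 0 <= r <= 1 by rewrite /r; apply/andP; split; lra.
exists r; first by rewrite /r; apply/andP; split; lra.
have Hd := Hardy_dil p0 r_01 Hf; have [ad _] := Hd.
have HB := HardyB p0 Hf Hd; have [aB _] := HB.
have mpM s : 0 <= s < 1 -> mp p f s <= M by exact: mp_le_norm.
have mpd s : 0 <= s < 1 -> mp p (dil r f) s <= M.
  move=> /andP[s0 s1]; rewrite mp_dil; apply: mpM; case/andP: r_01 => q0 q1.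
  by rewrite mulr_ge0//=; apply: le_lt_trans s1; rewrite ler_piMl.
pose g : C -> C := fun z => (f z + dil r f z) / 2.
have ag : analytic g.
  move=> z zd; have /cdifferentiableP[l dl] := af z zd; have /cdifferentiableP[m dm] := ad z zd.
  apply: cder_cdiff; apply: cderM; first by apply: cderD; [exact: dl|exact: dm].
  exact: cder_cst.
have g0 : M - 2 * d <= mp p g r0.
  have c1 := @rcts_mp _ p f r0 0 tpi p0 cf.
  have cg t : ccts g (circ r0 t) by exact: analytic_circ.
  have : mp p f r0 - d <= mp p g r0; last exact: aux Mr0.
  rewrite /mp -[X in _ - X]ravg_cst -mulN1r -ravgZ; last by move=> t _; exact: cvg_cst.
  have cc : rcts 0 tpi (fun=> -1 * d : R) by move=> t _; exact: cvg_cst.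
  rewrite -(ravgD c1 cc); apply: ravg_le2.
  - by move=> t tt; apply: cvgD; [exact: c1|exact: cc].
  - exact: rcts_mp.
  - move=> t tt; rewrite mulN1r; set z := circ r0 t.
    have zr : cabs z = r0 by rewrite cabs_circ.
    have rz : cabs (r%:C%C * z) <= r0.
      case/andP: r_01 => q0 q1; rewrite cabsM cabs_real ger0_norm// zr ler_piMl//.
    have dist : cabs (f z - dil r f z) <= Lp * h.
      apply: le_trans (lip _ _ _ rz) _; first by rewrite zr.
      have -> : z - r%:C%C * z = (1 - r)%:C%C * z.
        have E (x : R) : (1 - x)%:C%C = 1 - x%:C%C :> C by rewrite rmorphB rmorph1.
        by rewrite E mulrBl mul1r.
      have -> : 1 - r = h by rewrite /r; ring.
      rewrite cabsM cabs_real gtr0_norm// zr ler_wpM2l ?(ltW Lp0)// ler_piMr ?(ltW h0)// ltW//.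
    have dg : cabs (f z) - Lp * h <= cabs (g z).
      have -> : g z = f z - (f z - dil r f z) / 2 by rewrite /g; field.
      have := ler_cabs_sub (f z) ((f z - dil r f z) / 2); rewrite cabs_half.
      have := cabs_ge0 (f z - dil r f z); have h5 := ler_cabs_sub (f z) ((f z - dil r f z) / 2).
      have -> : cabs (f z - (f z - dil r f z) / 2) = cabs ((f z - dil r f z) / 2 - f z) by rewrite cabsBC.
      lra.
    have Lh : 0 <= Lp * h by rewrite mulr_ge0// ltW.
    apply: le_trans (powR_sub_ge p1' (cabs_ge0 _) (cabs_ge0 _) (fB t tt) Lh dg).
    rewrite lerD2l lerN2; apply: le_trans hd; rewrite /Q mulrDr mulr1.
    have -> : p * B `^ (p - 1) * (Lp * h) = h * (p * B `^ (p - 1) * Lp) by ring.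
    by rewrite lerDl ltW.
apply: (hardy_norm_le p0 HB (ltW e0)) => s s01; have /andP[s0 s1] := s01.
(* Means grow with the radius, so a bound at the larger radius [s'], where the lower bound for [g]
   is available, suffices. *)
pose s' := Num.max s r0.
have s'01 : 0 <= s' < 1 by rewrite /s'; have [_|_] := leP s r0; rewrite ?r001 ?s01.
have ss' : 0 <= s <= s' by rewrite s0 le_max lexx.
have r0s' : 0 <= r0 <= s' by rewrite r00 le_max lexx orbT.
have s'1 : s' < 1 by case/andP: s'01.
apply: le_trans (mp_mono p1' aB ss' s'1) _.
have gs' := le_trans g0 (mp_mono p1' ag r0s' s'1).
have cfs t : ccts f (circ s' t) by exact: analytic_circ.
have cds t : ccts (dil r f) (circ s' t) by exact: analytic_circ.
have cgs t : ccts g (circ s' t) by exact: analytic_circ.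
have cBs t : ccts (f - dil r f) (circ s' t) by exact: analytic_circ.
have k1 := @rcts_mp _ p f s' 0 tpi p0 cfs; have k2 := @rcts_mp _ p _ s' 0 tpi p0 cds.
have k3 := @rcts_mp _ p g s' 0 tpi p0 cgs; have k4 := @rcts_mp _ p _ s' 0 tpi p0 cBs.
pose eps := e `^ p / (4 * (M + 1)).
have key : mp p (f - dil r f) s' <= (eps + K / 2) * (mp p f s' + mp p (dil r f) s') - K * mp p g s'.
  rewrite /mp -ravgD// -ravgZ; last by move=> t tt; apply: cvgD; [exact: k1|exact: k2].
  rewrite -mulNr -ravgZ// -ravgD; last 2 first.
  - by move=> t tt; apply: cvgMr; apply: cvgD; [exact: k1|exact: k2].
  - by move=> t tt; apply: cvgMr; exact: k3.
  apply: ravg_le => //.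
    move=> t tt; apply: cvgD; apply: cvgMr; last exact: k3.
    by apply: cvgD; [exact: k1|exact: k2].
  move=> t; apply: le_trans (UC (f (circ s' t)) (dil r f (circ s' t))) _.
  rewrite -/eps /g; move: (cabs _ `^ p) (cabs (dil _ _ _) `^ p) (cabs (_ / _) `^ p) => X Y Z.
  by rewrite le_eqVlt; apply/orP; left; apply/eqP; field.
apply: le_trans key _.
have m1 := mpM _ s'01; have m2 := mpd _ s'01.
move: (mp p f s') (mp p (dil r f) s') (mp p g s') m1 m2 gs' => X Y Z m1 m2 gs'.
exact: (convexity_budget ep0 M0 K0 m1 m2 gs').
Qed.

Lemma hardy_bounded p f (B : R) : 0 < p -> 0 <= B -> analytic f -> (forall z, cabs z < 1 -> cabs (f z) <= B) ->
  Hardy p f /\ hardy_norm p f <= B.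
Proof.
move=> p0 B0 af fB.
have H r : 0 <= r < 1 -> mp p f r <= B `^ p.
  move=> r01; rewrite -[X in _ <= X]ravg_cst; apply: ravg_le.
  - by apply: rcts_mp => // t; exact: analytic_circ.
  - by move=> t _; exact: cvg_cst.
  - case/andP: r01 => r0 r1 t; apply: ler_powR2; rewrite ?cabs_ge0// fB// cabs_circ//.
have Hf : Hardy p f by exact: (HardyI p0 af H).
by split=> //; exact: hardy_norm_le.
Qed.

Lemma analytic_pow n : analytic (fun z : C => z ^+ n).
Proof.
move=> z _; suff [l d] : exists l, cder (fun z : C => z ^+ n) z l by exact: cder_cdiff d.
elim: n => [|n [l IH]].
  by exists 0; under [X in cder X]eq_fun do rewrite expr0; exact: cder_cst.
eexists; under [X in cder X]eq_fun do rewrite exprS.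
by apply: cderM; [exact: cder_id|exact: IH].
Qed.

Lemma Hardy_pow p n : 0 < p -> Hardy p (fun z : C => z ^+ n).
Proof.
move=> p0; apply: (@hardy_bounded p (fun z : C => z ^+ n) 1 p0 ler01 (@analytic_pow n) _).1.
by move=> z z1; rewrite cabsX exprn_ile1 ?cabs_ge0// ltW.
Qed.

Lemma dual_poly_zero p L : 1 < p -> Hardy_dual p L -> (forall n, L (fun z => z ^+ n) = 0) ->
  forall f, Hardy p f -> L f = 0.
Proof.
move=> p1 HL Ln f Hf; have p0 : 0 < p by lra.
have [af _] := Hf.
have LK := dbound_dual_norm p0 HL; have K0 := dual_norm_ge0 p0 HL.
have small (x : R) : (forall e : R, 0 < e -> e < 1 -> x <= dual_norm p L * e) -> x <= 0.
  exact: le_epsilon0.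
have Lpoly n (c : nat -> C) : Hardy p (fun z => \sum_(k < n) c k * z ^+ k) /\
    L (fun z => \sum_(k < n) c k * z ^+ k) = 0.
  elim: n => [|n [IH1 IH2]].
    rewrite (_ : (fun z => _) = 0); last by apply/funext => z; rewrite big_ord0.
    by split; [exact: Hardy0|exact: dual0 HL].
  rewrite (_ : (fun z => _) = c n *: (fun z : C => z ^+ n) + (fun z => \sum_(k < n) c k * z ^+ k)).
    split; first exact: (Hardy_lin _ p0 (Hardy_pow n p0) IH1).
    by rewrite (HL.1 _ _ _ (Hardy_pow n p0) IH1) Ln IH2 mulr0 addr0.
  by apply/funext => z; rewrite big_ord_recr addrC.
have Ldil r : 0 < r < 1 -> L (dil r f) = 0.
  move=> r01; have /andP[r0 r1] := r01.
  have Hd : Hardy p (dil r f) by apply: Hardy_dil => //; rewrite !ltW.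
  apply/eqP; rewrite -cabs_eq0 eq_le cabs_ge0 andbT; apply: small => e e0 _.
  have [n [c [_ H]]] := taylor_uniform r01 af e0.
  have [H1 H2] := Lpoly n c.
  rewrite -[L _]subr0 -H2 -(dualB HL)//.
  apply: le_trans (LK _ (HardyB p0 Hd H1)) _; rewrite ler_wpM2l//.
  have [|//] := @hardy_bounded p (dil r f - fun z => \sum_(k < n) c k * z ^+ k) e p0 (ltW e0) _ H.
  by have [] := HardyB p0 Hd H1.
apply/eqP; rewrite -cabs_eq0 eq_le cabs_ge0 andbT; apply: small => e e0 _.
have [r r01 H] := dil_converges p1 Hf e0.
have Hd : Hardy p (dil r f) by apply: Hardy_dil => //; case/andP: r01 => ? ?; rewrite !ltW.
rewrite -[L f]subr0 -(Ldil _ r01) -(dualB HL)//.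
by apply: le_trans (LK _ (HardyB p0 Hf Hd)) _; rewrite ler_wpM2l.
Qed.

End PolynomialDensity.

(** * The hyperbolic flow *)

Section Logarithm.
Variable R : realType.
Local Notation C := R[i].
Implicit Types (v w z : C).

(** The principal logarithm on the right half-plane. Written with [atan], its imaginary part lies in
    [(- pi/2, pi/2)] for every argument, so that bound needs no side condition. *)
Definition clog v : C := Complex (ln (cabs v)) (atan (Im v / Re v)).

Lemma cexp_clog v : 0 < Re v -> cexp (clog v) = v.
Proof.
case: v => x y /= x0.
have v0 : 0 < cabs (Complex x y) by rewrite cabs_gt0; apply/eqP => -[xe _]; rewrite xe ltxx in x0.
have E : cos (atan (y / x)) = x / cabs (Complex x y).
  rewrite cos_atan cabsE /=.
  have -> : x ^+ 2 + y ^+ 2 = x ^+ 2 * (1 + (y / x) ^+ 2) by field; rewrite gt_eqF.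
  have A0 : 0 < Num.sqrt (1 + (y / x) ^+ 2) by rewrite sqrtr_gt0 ltr_wpDr ?sqr_ge0.
  by rewrite sqrtrM ?sqr_ge0// sqrtr_sqr gtr0_norm//; move: (Num.sqrt _) A0 => A A0; field; rewrite !gt_eqF.
rewrite /cexp /clog /= lnK//.
have cx : cos (atan (y / x)) != 0 by rewrite E mulf_neq0 ?invr_eq0 ?gt_eqF.
have S : sin (atan (y / x)) = y / x * (x / cabs (Complex x y)).
  have := atanK (y / x); rewrite {1}/tan => /(congr1 (fun q => q * cos (atan (y / x)))).
  by rewrite divfK// E.
have -> : Num.sqrt (x ^+ 2 + y ^+ 2) = cabs (Complex x y) by [].
by rewrite E S; congr Complex; field; rewrite ?gt_eqF.
Qed.

Lemma Im_clog v : - (pi / 2) < Im (clog v) < pi / 2.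
Proof. by rewrite /= atan_gtNpi2 atan_ltpi2. Qed.

Lemma clogZ (t : R) v : 0 < t -> v != 0 -> clog (t%:C%C * v) = (ln t)%:C%C + clog v.
Proof.
move=> t0 v0; apply: complexP; rewrite ?cReD ?cImD ?Rec ?Imc.
  change (ln (cabs (t%:C%C * v)) = ln t + ln (cabs v)).
  by rewrite cabsM cabs_real gtr0_norm// lnM ?posrE ?cabs_gt0.
rewrite add0r /=; case: v v0 => x y _ /=; congr atan.
rewrite !mul0r subr0 addr0; have [->|x0] := eqVneq x 0; first by rewrite mulr0 invr0 !mulr0.
by field; rewrite x0 gt_eqF.
Qed.

Lemma Re_near_gt0 v : 0 < Re v -> \forall w \near cnbhs v, 0 < Re w.
Proof.
move=> v0; exists (Re v) => // w wv.
have := le_lt_trans (ler_Re_cabs (w - v)) wv; rewrite cReD cReN ltr_norml; lra.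
Qed.

Lemma ccts_clog v : 0 < Re v -> ccts clog v.
Proof.
move=> v0; have c1 : (@complex.Re R) @ cnbhs v --> Re v by exact: (clim_Re (@ccts_id R v)).
have c2 : (@complex.Im R) @ cnbhs v --> Im v by exact: (clim_Im (@ccts_id R v)).
have c3 : (@cabs R) @ cnbhs v --> cabs v by exact: (clim_cabs (@ccts_id R v)).
have va : 0 < cabs v by apply: lt_le_trans v0 (le_trans (ler_norm _) (ler_Re_cabs _)).
apply: clim_ReIm.
  exact: (@cvg_comp _ _ _ (@cabs R) (@ln R) (cnbhs v) (nbhs (cabs v)) _ c3 (continuous_ln va)).
apply: (@cvg_comp _ _ _ (fun w => Im w / Re w) (@atan R) (cnbhs v) (nbhs (Im v / Re v))).
  by apply: cvgM => //; apply: cvgV => //; rewrite gt_eqF.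
exact: continuous_atan.
Qed.

Lemma cder_clog v : 0 < Re v -> cder clog v v^-1.
Proof.
move=> v0; have H1 : \forall w \near cnbhs v, cexp (clog w) = w.
  by apply: filterS (Re_near_gt0 v0) => w /cexp_clog.
have vn : v != 0 by apply/eqP => ve; rewrite ve ltxx in v0.
have H2 : cder (@cexp R) (clog v) v by have := cder_cexp (clog v); rewrite cexp_clog.
exact: (cder_inv H1 (ccts_clog v0) H2 vn).
Qed.

End Logarithm.

Section ScalarParts.
Variable R : realType.
Lemma cReZ (x : R) (z : R[i]) : Re (x%:C%C * z) = x * Re z.
Proof. by case: z => a b /=; ring. Qed.
Lemma cImZ (x : R) (z : R[i]) : Im (x%:C%C * z) = x * Im z.
Proof. by case: z => a b /=; ring. Qed.
End ScalarParts.

(** * The half-plane model of the disc and the dilation flow *)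

Section Model.
Variable R : realType.
Local Notation C := R[i].
Local Notation tpi := ((pi : R) *+ 2).
Implicit Types (f g : C -> C) (p r s t : R) (z w : C).
Local Notation analytic := (analytic_on (@disc R)).
Variables z1 z2 : C.
Hypotheses (z1u : cabs z1 = 1) (z2u : cabs z2 = 1) (z12 : z1 != z2).

(* [hmap] sends [z1, z2] to [0, oo], hence conjugates an automorphism fixing them to a dilation. *)
Definition hmap z : C := (z1 - z) / (z - z2).
(* [Re (hrot * v) > 0] is the half-plane onto which [hmap] maps the disc. *)
Definition hrot : C := 1 - z2 * (z1^*)%C.
Definition hgap : R := cabs (z1 - z2) ^+ 2.

Lemma z1J : z1 * (z1^*)%C = 1. Proof. by rewrite mulcJ z1u expr1n. Qed.
Lemma z2J : z2 * (z2^*)%C = 1. Proof. by rewrite mulcJ z2u expr1n. Qed.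

Lemma hgap_gt0 : 0 < hgap.
Proof. by rewrite exprn_gt0// cabs_gt0 subr_eq0. Qed.

Lemma Re_hrot : Re hrot = hgap / 2.
Proof.
have := sqr_cabs z1; have := sqr_cabs z2; rewrite z1u z2u expr1n /hrot /hgap sqr_cabs.
by case: z1 z2 => a b [c d] /= h1 h2; move: h1 h2; rewrite ?expr2; lra.
Qed.

Lemma disc_neq z : cabs z < 1 -> z - z2 != 0 /\ z1 - z != 0.
Proof.
move=> h; split; rewrite subr_eq0; apply: contraTneq h => e.
  by rewrite e z2u ltxx.
by rewrite -e z1u ltxx.
Qed.

(** The sign of [1 - |z|^2] is that of [Re (hrot * hmap z)], so the disc corresponds exactly to a
    half-plane. The exact value also measures how far the flow stays from the circle. *)
Lemma Re_hmap z : z - z2 != 0 ->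
  Re (hrot * hmap z) = (1 - cabs z ^+ 2) * (hgap / 2) / cabs (z - z2) ^+ 2.
Proof.
move=> zn; have nz : ((z - z2)^*)%C != 0 by rewrite -cabs_gt0 cabsJ cabs_gt0.
have -> : hrot * hmap z = hrot * (z1 - z) * ((z - z2)^*)%C * ((cabs (z - z2) ^+ 2)^-1)%:C%C.
  have -> : ((cabs (z - z2) ^+ 2)^-1)%:C%C = ((z - z2) * ((z - z2)^*)%C)^-1 :> C.
    by rewrite mulcJ fmorphV.
  rewrite /hmap; move: ((z - z2)^*)%C nz => zJ nz; field; rewrite zn nz//.
rewrite cReM Rec Imc mulr0 subr0; congr (_ / _); rewrite -Re_hrot.
have := z1J; have := z2J => /(congr1 Re) h2 /(congr1 Re); move: h2.
rewrite sqr_cabs /hrot.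
case: z1 z2 z {zn nz} => a b [c d] [x y] /=.
move=> h2 h1.
have e1 : a ^+ 2 = 1 - b ^+ 2 by rewrite !expr2; lra.
have e2 : c ^+ 2 = 1 - d ^+ 2 by rewrite !expr2; lra.
ring: e1 e2.
Qed.

Lemma hmap_gt0 z : cabs z < 1 -> 0 < Re (hrot * hmap z).
Proof.
move=> zd; have [zn _] := disc_neq zd; rewrite Re_hmap//.
rewrite divr_gt0 ?exprn_gt0 ?cabs_gt0// mulr_gt0 ?divr_gt0 ?hgap_gt0//.
by rewrite subr_gt0 exprn_ilt1 ?cabs_ge0.
Qed.

Lemma hmap_lt1 z : z - z2 != 0 -> 0 < Re (hrot * hmap z) -> cabs z < 1.
Proof.
move=> zn; rewrite Re_hmap// pmulr_lgt0 ?invr_gt0 ?exprn_gt0 ?cabs_gt0//.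
rewrite pmulr_lgt0 ?divr_gt0 ?hgap_gt0// subr_gt0 => h.
by rewrite -(@expr_lt1 _ 2)// cabs_ge0.
Qed.

Lemma hmap_inj z w : z - z2 != 0 -> w - z2 != 0 -> hmap z = hmap w -> z = w.
Proof.
move=> zn wn h; have : (z1 - z) * (w - z2) = (z1 - w) * (z - z2).
  move: h; rewrite /hmap => /eqP; rewrite eqr_div// => /eqP //.
move=> e; have : (z1 - z2) * (w - z) = 0.
  have -> : (z1 - z2) * (w - z) = (z1 - z) * (w - z2) - (z1 - w) * (z - z2) by ring.
  by rewrite e subrr.
by move/eqP; rewrite mulf_eq0 subr_eq0 (negPf z12) /= subr_eq0 => /eqP.
Qed.

Lemma hrot_gt0 : 0 < Re hrot.
Proof. by rewrite Re_hrot divr_gt0 ?hgap_gt0. Qed.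

(** A branch of [log hmap]: the rotation by [hrot] brings the values into the right half-plane,
    where [clog] is an inverse of [cexp], and subtracting [clog hrot] undoes it. *)
Definition hlog z : C := clog (hrot * hmap z) - clog hrot.

Lemma cexp_hlog z : cabs z < 1 -> cexp (hlog z) = hmap z.
Proof.
move=> zd; rewrite /hlog cexpD cexpN !cexp_clog ?hrot_gt0 ?hmap_gt0//.
rewrite mulrC mulKf//; apply/eqP => e; have := hrot_gt0; rewrite e ltxx //.
Qed.

(** Both logarithms have imaginary part below [pi/2] in modulus. For [hrot] this is a fixed number,
    so the sum stays uniformly below [pi], the strict bound required by [antiperiodic_zero]. *)
Lemma hlog_Im : exists2 kap : R, kap < pi & forall z, `|Im (hlog z)| <= kap.
Proof.
exists (pi / 2 + `|Im (clog hrot)|).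
  have := Im_clog hrot => /andP[h1 h2].
  have : `|Im (clog hrot)| < pi / 2 by rewrite ltr_norml h1.
  lra.
move=> z; rewrite /hlog cImD cImN; apply: le_trans (ler_normB _ _) _; rewrite lerD2r.
by have /andP[h1 h2] := Im_clog (hrot * hmap z); rewrite ler_norml !ltW.
Qed.

Lemma cder_hmap z : z - z2 != 0 -> exists l, cder hmap z l.
Proof.
move=> zn; eexists; apply: cderM.
  by apply: cderB; [exact: cder_cst|exact: cder_id].
by apply: cderV => //; apply: cderB; [exact: cder_id|exact: cder_cst].
Qed.

Lemma analytic_clog_hmap : analytic (fun z => clog (hrot * hmap z)).
Proof.
move=> z zd; have [zn _] := disc_neq zd; have [l dl] := cder_hmap zn.
have d1 := cderZ hrot dl; have d2 := cder_clog (hmap_gt0 zd).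
exact: cder_cdiff (cder_comp d1 d2).
Qed.

Lemma analytic_hlog : analytic hlog.
Proof.
move=> z zd; have /cdifferentiableP[l dl] := analytic_clog_hmap zd.
by apply: cder_cdiff; apply: cderB; [exact: dl|exact: cder_cst].
Qed.

Lemma analytic_comp_cexp f : analytic f -> analytic (fun z => cexp (f z)).
Proof.
move=> af z zd; have /cdifferentiableP[l dl] := af z zd.
exact: cder_cdiff (cder_comp dl (cder_cexp (f z))).
Qed.

Lemma analyticM f g : analytic f -> analytic g -> analytic (fun z => f z * g z).
Proof.
move=> af ag z zd; have /cdifferentiableP[l dl] := af z zd; have /cdifferentiableP[m dm] := ag z zd.
by apply: cder_cdiff; apply: cderM; [exact: dl|exact: dm].
Qed.
Lemma analyticZ (c : C) f : analytic f -> analytic (fun z => c * f z).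
Proof. by apply: analyticM => z _; apply: cder_cdiff; exact: cder_cst. Qed.

Lemma analytic_expl (c : C) : analytic (fun z => cexp (c * hlog z)).
Proof. by apply: analytic_comp_cexp; apply: analyticZ; exact: analytic_hlog. Qed.

(* [|hmap|^a] is dominated by a multiple of the real part of the analytic function
   [(hrot * hmap)^a], whose circular means are constant. *)
Lemma expR_hlog_mean (a : R) : `|a| < 1 -> exists2 B : R, 0 < B &
  forall r, 0 <= r < 1 -> ravg (fun t => expR (a * Re (hlog (circ r t)))) <= B.
Proof.
move=> a1; pose lam z := clog (hrot * hmap z).
pose F z := cexp (a%:C%C * lam z).
have aF : analytic F by apply: analytic_comp_cexp; apply: analyticZ; exact: analytic_clog_hmap.
pose c := cos (a * (pi / 2)).
have pi0 := pi_gt0 R.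
have c0 : 0 < c.
  apply: cos_gt0_pihalf; rewrite -ltr_norml normrM (ger0_norm (_ : 0 <= pi / 2)); last by lra.
  by rewrite gtr_pMl//; lra.
have cle u : `|u| <= pi / 2 -> c <= cos (a * u).
  move=> uh; rewrite /c.
  have cn (x : R) : cos x = cos `|x| by have [h|h] := leP 0 x; [rewrite ger0_norm|rewrite ltr0_norm// cosN].
  have pih : 0 <= pi / 2 :> R by lra.
  rewrite (cn (a * u)) (cn (a * (pi / 2))) !normrM.
  have -> : `|pi| * `|2^-1| = pi / 2 :> R by rewrite -normrM ger0_norm.
  have h1 : `|a| * `|u| <= `|a| * (pi / 2) by rewrite ler_wpM2l.
  have h2 : `|a| * (pi / 2) <= pi by have := ler_wpM2r (_ : 0 <= pi / 2) (ltW a1); lra.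
  have h0 : 0 <= `|a| * `|u| by rewrite mulr_ge0.
  have [->//|ne] := eqVneq (`|a| * `|u|) (`|a| * (pi / 2)).
  have h3 : `|a| * `|u| < `|a| * (pi / 2) by rewrite lt_neqAle ne.
  have i1 : `|a| * `|u| \in `[0, pi] by rewrite in_itv /= h0 (le_trans h1 h2).
  have i2 : `|a| * (pi / 2) \in `[0, pi] by rewrite in_itv /= (le_trans h0 h1) h2.
  by apply: ltW; rewrite ltr_cos.
pose K := expR (- (a * Re (clog hrot))) / c.
have K0 : 0 < K by rewrite divr_gt0// expR_gt0.
exists (K * cabs (F 0)); first by rewrite mulr_gt0// cabs_gt0 cexp_neq0.
move=> r r01; have /andP[r0 r1] := r01.
have cF t : ccts F (circ r t) by exact: analytic_circ.
have ch t : ccts hlog (circ r t) by apply: analytic_circ => //; exact: analytic_hlog.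
have cu : rcts 0 tpi (fun t => Re (F (circ r t))) by apply: icts_Re; exact: icts_comp_circ.
apply: (@le_trans _ _ (ravg (fun t => K * Re (F (circ r t))))).
  apply: ravg_le.
  - have := icts_Re (@icts_comp_circ _ 0 tpi _ r ch) => c1 t tt.
    apply: (@cvg_comp _ _ _ (fun t => a * Re (hlog (circ r t))) (@expR R) (nbhs t)
      (nbhs (a * Re (hlog (circ r t))))); last exact: continuous_expR.
    by apply: cvgMr; exact: c1.
  - by move=> t tt; apply: cvgMr; exact: cu.
  - move=> t; set z := circ r t.
    have -> : Re (F z) = expR (a * Re (lam z)) * cos (a * Im (lam z)).
      by rewrite -cReZ -cImZ.
    have -> : Re (hlog z) = Re (lam z) - Re (clog hrot) by rewrite /hlog cReD cReN.
    have hc : c <= cos (a * Im (lam z)).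
      apply: cle; have /andP[h1 h2] := Im_clog (hrot * hmap z).
      by rewrite ler_norml !ltW.
    have -> : K * (expR (a * Re (lam z)) * cos (a * Im (lam z))) =
      expR (a * Re (lam z)) * expR (- (a * Re (clog hrot))) * (cos (a * Im (lam z)) / c) by rewrite /K; ring.
    by rewrite mulrBr expRD ler_peMr ?mulr_ge0 ?expR_ge0// ler_pdivlMr// mul1r.
rewrite ravgZ// ler_pM2l//.
rewrite -[ravg _](@Re_cavg _ (F \o circ r)) mean_value//; last exact: analytic_closed aF r1.
by apply: le_trans (ler_norm _) (ler_Re_cabs _).
Qed.

(** On the disc this is [|hmap|^sg + |hmap|^(- sg)], a majorant that allows growth at both fixed
    points. *)
Definition emaj (sg : R) z : R := expR (sg * Re (hlog z)) + expR (- sg * Re (hlog z)).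

Lemma emaj_gt0 sg z : 0 < emaj sg z.
Proof. by rewrite addr_gt0// expR_gt0. Qed.

(** The membership criterion for all functions built from [hlog]. One constant [K] serves every [F],
    which gives bounds uniform along a strip of exponents. *)
Lemma hardy_emaj p sg : 0 < p -> 0 < sg -> sg * p < 1 -> exists2 K : R, 0 < K &
  forall F (A : R), 0 <= A -> analytic F -> (forall z, cabs z < 1 -> cabs (F z) <= A * emaj sg z) ->
    Hardy p F /\ hardy_norm p F <= A * K.
Proof.
move=> p0 sg0 sgp.
have a1 : `|sg * p| < 1 by rewrite ger0_norm// mulr_ge0 ?ltW.
have a2 : `|- (sg * p)| < 1 by rewrite normrN.
have [B1 B10 H1] := expR_hlog_mean a1; have [B2 B20 H2] := expR_hlog_mean a2.
have Q0 : 0 < 2 `^ p * (B1 + B2) by rewrite mulr_gt0 ?powR_gt0// addr_gt0.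
exists ((2 `^ p * (B1 + B2)) `^ p^-1); first exact: powR_gt0.
move=> F A A0 aF FA.
have H r : 0 <= r < 1 -> mp p F r <= (A * (2 `^ p * (B1 + B2)) `^ p^-1) `^ p.
  move=> r01; have /andP[r0 r1] := r01.
  rewrite powRM ?powR_ge0// -powRrM mulVf ?gt_eqF// powRr1 ?(ltW Q0)//.
  have ce (k : R) : rcts 0 tpi (fun t => expR (k * Re (hlog (circ r t)))).
    have ch t : ccts hlog (circ r t) by apply: analytic_circ => //; exact: analytic_hlog.
    have := icts_Re (@icts_comp_circ _ 0 tpi _ r ch) => c1 t tt.
    apply: (@cvg_comp _ _ _ (fun t => k * Re (hlog (circ r t))) (@expR R) (nbhs t)
      (nbhs (k * Re (hlog (circ r t))))); last exact: continuous_expR.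
    by apply: cvgMr; exact: c1.
  have c1 := ce (sg * p); have c2 := ce (- (sg * p)).
  have c12 : rcts 0 tpi (fun t => expR (sg * p * Re (hlog (circ r t))) +
      expR (- (sg * p) * Re (hlog (circ r t)))).
    by move=> t tt; apply: cvgD; [exact: c1|exact: c2].
  have cF t : ccts F (circ r t) by exact: analytic_circ.
  have := lerD (H1 r r01) (H2 r r01); rewrite -ravgD// => H12.
  have k0 : 0 <= A `^ p * 2 `^ p by rewrite mulr_ge0 ?powR_ge0.
  rewrite mulrA; apply: le_trans (ler_wpM2l k0 H12); rewrite -ravgZ//.
  apply: ravg_le; first exact: rcts_mp.
    by move=> t tt; apply: cvgMr; exact: c12.
  move=> t; have zd : cabs (circ r t) < 1 by rewrite cabs_circ.
  apply: le_trans (ler_powR2 p0 (cabs_ge0 _) (FA _ zd)) _.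
  rewrite powRM ?(ltW (emaj_gt0 _ _))// -mulrA ler_wpM2l ?powR_ge0//.
  apply: le_trans (powR_add_le p0 (expR_ge0 _) (expR_ge0 _)) _.
  by rewrite ler_wpM2l ?powR_ge0// -!expRM mulrAC [- sg * _ * p]mulrAC mulNr.
have HF : Hardy p F by exact: (HardyI p0 aF H).
by split => //; apply: hardy_norm_le => //; rewrite mulr_ge0 ?powR_ge0.
Qed.

Definition hden t z : C := (z - z2) + (expR t)%:C%C * (z1 - z).
(** The solution [w] of [hmap w = exp t * hmap z]. *)
Definition flow t z : C := (z1 * (z - z2) + (expR t)%:C%C * (z1 - z) * z2) / hden t z.

Lemma expRC_neq0 t : (expR t)%:C%C != 0 :> C.
Proof. by rewrite -cabs_gt0 cabs_real gtr0_norm expR_gt0. Qed.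

(** A zero would mean [hmap z = - exp (- t)]; but [hrot] has positive real part, so this negative
    number lies in the opposite half-plane. *)
Lemma hden_neq0 t z : cabs z < 1 -> hden t z != 0.
Proof.
move=> zd; have [zn _] := disc_neq zd; apply/eqP => d0.
have e : hmap z = - (expR (- t))%:C%C.
  have e0 := expRC_neq0 t.
  rewrite expRN fmorphV /hmap; apply: (mulIf zn); rewrite divfK//.
  apply: (mulfI e0); rewrite mulNr mulrN mulVKf//.
  by apply/eqP; rewrite -addr_eq0 addrC; apply/eqP.
have := hmap_gt0 zd; rewrite e mulrN cReN cReM Rec Imc mulr0 subr0.
by rewrite oppr_gt0 pmulr_llt0 ?expR_gt0// ltNge (ltW hrot_gt0).
Qed.

Lemma flow_sub2 t z : cabs z < 1 -> flow t z - z2 = (z1 - z2) * (z - z2) / hden t z.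
Proof. by move=> /(hden_neq0 t) d0; rewrite /flow /hden in d0 *; field. Qed.
Lemma flow_sub1 t z : cabs z < 1 ->
  z1 - flow t z = (expR t)%:C%C * (z1 - z) * (z1 - z2) / hden t z.
Proof. by move=> /(hden_neq0 t) d0; rewrite /flow /hden in d0 *; field. Qed.

Lemma z12_neq0 : z1 - z2 != 0. Proof. by rewrite subr_eq0. Qed.

Lemma flow_neq t z : cabs z < 1 -> flow t z - z2 != 0.
Proof.
move=> zd; have [zn _] := disc_neq zd.
by rewrite flow_sub2// !mulf_neq0 ?invr_eq0 ?hden_neq0 ?z12_neq0.
Qed.

Lemma hmap_flow t z : cabs z < 1 -> hmap (flow t z) = (expR t)%:C%C * hmap z.
Proof.
move=> zd; have [zn _] := disc_neq zd.
rewrite /hmap flow_sub1// flow_sub2//; field.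
by rewrite zn hden_neq0 ?z12_neq0.
Qed.

Lemma Re_hmap_flow t z : cabs z < 1 -> Re (hrot * hmap (flow t z)) = expR t * Re (hrot * hmap z).
Proof.
by move=> zd; rewrite hmap_flow// mulrCA cReZ.
Qed.

Lemma flow_disc t z : cabs z < 1 -> cabs (flow t z) < 1.
Proof.
move=> zd; apply: hmap_lt1; first exact: flow_neq.
by rewrite Re_hmap_flow// mulr_gt0 ?expR_gt0 ?hmap_gt0.
Qed.

Lemma one_sub_flow t z : cabs z < 1 ->
  1 - cabs (flow t z) ^+ 2 = expR t * (1 - cabs z ^+ 2) * hgap / cabs (hden t z) ^+ 2.
Proof.
move=> zd; have [zn _] := disc_neq zd; have fn := flow_neq t zd.
have := Re_hmap_flow t zd; rewrite (Re_hmap fn) (Re_hmap zn) flow_sub2//.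
rewrite cabsM cabsV cabsM /hgap.
have d0 : 0 < cabs (hden t z) by rewrite cabs_gt0 hden_neq0.
have q0 : 0 < cabs (z - z2) by rewrite cabs_gt0.
have g0 : 0 < cabs (z1 - z2) by rewrite cabs_gt0 z12_neq0.
move: (cabs (hden t z)) (cabs (z - z2)) (cabs (z1 - z2)) (cabs z) (cabs (flow t z)) (expR t) d0 q0 g0.
move=> D Q G X Y E D0 Q0 G0 H.
apply: (mulIf (_ : D ^+ 2 / (2 * Q ^+ 2) != 0)).
  by rewrite mulf_neq0 ?invr_eq0 ?mulf_neq0 ?expf_neq0 ?gt_eqF.
transitivity ((1 - Y ^+ 2) * (G ^+ 2 / 2) / (G * Q / D) ^+ 2).
  by field; rewrite !gt_eqF.
by rewrite H; field; rewrite !gt_eqF.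
Qed.

Lemma cabs_hden t z : cabs z < 1 -> cabs (hden t z) <= 2 * (1 + expR t).
Proof.
move=> zd; apply: le_trans (cabsD _ _) _; rewrite cabsM cabs_real gtr0_norm ?expR_gt0//.
have h1 := cabsB z z2; have h2 := cabsB z1 z; rewrite z2u in h1; rewrite z1u in h2.
have : expR t * cabs (z1 - z) <= expR t * 2 by rewrite ler_wpM2l ?expR_ge0//; lra.
lra.
Qed.

Lemma analytic_flow t : analytic (flow t).
Proof.
move=> z zd; have d0 := hden_neq0 t zd; apply/cdifferentiableP; eexists.
have dz : cder (fun z => z - z2) z (1 - 0) by apply: cderB; [exact: cder_id|exact: cder_cst].
have dz1 : cder (fun z => (expR t)%:C%C * (z1 - z)) z ((expR t)%:C%C * (0 - 1)).
  by apply: cderZ; apply: cderB; [exact: cder_cst|exact: cder_id].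
apply: cderM.
  apply: cderD; first by apply: cderZ; exact: dz.
  by apply: cderM; [exact: dz1|exact: cder_cst].
by apply: cderV => //; apply: cderD; [exact: dz|exact: dz1].
Qed.

Lemma flowD s t z : cabs z < 1 -> flow s (flow t z) = flow (s + t) z.
Proof.
move=> zd; have fd := flow_disc t zd.
apply: hmap_inj; [exact: flow_neq|exact: flow_neq|].
by rewrite !hmap_flow// mulrA -real_complexM -expRD.
Qed.

Lemma flow0 z : cabs z < 1 -> flow 0 z = z.
Proof.
move=> zd; have [zn _] := disc_neq zd; apply: hmap_inj => //; first exact: flow_neq.
by rewrite hmap_flow// expR0 rmorph1 mul1r.
Qed.

Lemma hlog_flow t z : cabs z < 1 -> hlog (flow t z) = hlog z + t%:C%C.
Proof.
move=> zd; rewrite /hlog hmap_flow// mulrCA clogZ ?expR_gt0//.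
  by rewrite expRK; ring.
apply/eqP => e; have := hmap_gt0 zd; rewrite e ltxx //.
Qed.

(** Subordination gives the factor [(rho + a) / (rho - a)] with [a = |flow t 0|], and [one_sub_flow]
    bounds [1 - a^2] below by a multiple of [exp (- |t|)]. Taking the [p]-th root leaves the rate
    [exp (|t| / p)]. *)
Lemma flow_norm p : 1 <= p -> exists2 K : R, 0 < K & forall t f, Hardy p f ->
  Hardy p (f \o flow t) /\ hardy_norm p (f \o flow t) <= K * expR (`|t| / p) * hardy_norm p f.
Proof.
move=> p1; have p0 : 0 < p by lra.
(* From [hgap <= 16 (1 - a^2) exp |t| <= 32 (1 - a) exp |t|] one gets [Q exp |t| (1 - a) >= 4]. As
   [rho - a >= (1 - a) / 2], this yields [Q exp |t| (rho - a) >= 2 >= rho + a]. *)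
have g0 := hgap_gt0; pose Q := 128 / hgap; have Q0 : 0 < Q by rewrite divr_gt0.
exists (Q `^ p^-1); first exact: powR_gt0.
move=> t f Hf; have [af _] := Hf; have n0 := hardy_norm_ge0 p f.
have ac : analytic (f \o flow t).
  move=> z zd; have /cdifferentiableP[l dl] := analytic_flow t zd.
  have /cdifferentiableP[m dm] := af _ (flow_disc t zd).
  exact: cder_cdiff (cder_comp dl dm).
pose N := hardy_norm p f `^ p.
have E t0 : 0 < expR t0 := expR_gt0 t0.
have et : (1 + expR t) ^+ 2 <= 4 * expR t * expR `|t|.
  have e1 : 1 <= expR `|t| by have := expR_ge1Dx `|t|; have := normr_ge0 t; lra.
  have [t0|t0] := leP 0 t.
    rewrite ger0_norm// in e1 *; have := E t; nra.
  rewrite ltr0_norm// in e1 *; have ee : expR t * expR (- t) = 1 by rewrite -expRD subrr expR0.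
  have := E t; have := E (- t); nra.
have H r : 0 <= r < 1 -> mp p (f \o flow t) r <= Q * expR `|t| * N.
  move=> /andP[r0 r1].
  pose a := cabs (flow t 0).
  have d0 : cabs (0 : C) < 1 by rewrite cabs0.
  have a1 : a < 1 by exact: flow_disc.
  have a0 : 0 <= a by exact: cabs_ge0.
  pose dl := expR t * (1 - r ^+ 2) * hgap / (2 * (1 + expR t)) ^+ 2.
  have r21 : 0 < 1 - r ^+ 2 by rewrite subr_gt0 exprn_ilt1.
  have D0 : 0 < 2 * (1 + expR t) by rewrite mulr_gt0// addr_gt0.
  have dl0 : 0 < dl := divr_gt0 (mulr_gt0 (mulr_gt0 (E t) r21) g0) (exprn_gt0 2 D0).
  have fdl z : cabs z <= r -> dl <= 1 - cabs (flow t z) ^+ 2.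
    move=> zr; have zd := le_lt_trans zr r1; rewrite one_sub_flow// /dl.
    have h1 : 0 < cabs (hden t z) by rewrite cabs_gt0 hden_neq0.
    have n1 : 0 <= expR t * (1 - r ^+ 2) * hgap by rewrite ltW// (mulr_gt0 (mulr_gt0 (E t) r21) g0).
    have n2 : 0 <= (2 * (1 + expR t)) ^- 2 by rewrite ltW// invr_gt0 (exprn_gt0 2 D0).
    apply: ler_pM => //.
      apply: (ler_wpM2r (ltW g0)); apply: (ler_wpM2l (ltW (E t))); rewrite lerD2l lerN2.
      by rewrite lerXn2r ?nnegrE ?cabs_ge0.
    by rewrite lef_pV2 ?posrE ?exprn_gt0// lerXn2r ?nnegrE ?cabs_ge0 ?(ltW D0)// cabs_hden.
  (* The first term keeps [rho] away from [a]; the second makes the disc of radius [rho] contain the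
     image of [|z| <= r], since [1 - |flow t z|^2 >= dl] there. *)
  pose rho := Num.max ((1 + a) / 2) (1 - dl / 4).
  have rho1 : rho < 1 by rewrite gt_max; apply/andP; split; lra.
  have rhoa : (1 + a) / 2 <= rho by rewrite le_max lexx.
  have rhod : 1 - dl / 4 <= rho by rewrite le_max lexx orbT.
  have rho0 : 0 < rho by lra.
  have fl z : cabs z <= r -> cdifferentiable (flow t) z /\ cabs (flow t z) < rho.
    move=> zr; have zd := le_lt_trans zr r1; split; first exact: analytic_flow.
    have := fdl z zr; have := cabs_ge0 (flow t z); move: (cabs _) => y y0 hy.
    have dl1 : dl <= 1 by have := sqr_ge0 y; lra.
    apply: lt_le_trans rhod; rewrite ltNge; apply/negP => h.
    have : (1 - dl / 4) ^+ 2 <= y ^+ 2 by rewrite lerXn2r ?nnegrE//; lra.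
    have := sqr_ge0 (dl / 4); nra.
  apply: le_trans (mp_comp p1 r0 (analytic_closed af rho1) fl) _; rewrite -/a.
  have rN : mp p f rho <= N by apply: mp_le_norm => //; rewrite (ltW rho0).
  apply: ler_pM => //; first by rewrite divr_ge0//; lra.
    exact: mp_ge0.
  rewrite ler_pdivrMr; last by lra.
  have A := one_sub_flow t d0; rewrite -/a cabs0 expr0n subr0 mulr1 in A.
  have h0 : 0 < cabs (hden t 0) by rewrite cabs_gt0 hden_neq0.
  have hd := cabs_hden t d0.
  have A2 : expR t * hgap <= (1 - a ^+ 2) * (16 * expR t * expR `|t|).
    have : cabs (hden t 0) ^+ 2 <= 16 * expR t * expR `|t|.
      apply: le_trans (_ : (2 * (1 + expR t)) ^+ 2 <= _).
        by rewrite lerXn2r ?nnegrE ?cabs_ge0 ?(ltW D0).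
      by rewrite exprMn; lra.
    have : 0 <= 1 - a ^+ 2 by rewrite subr_ge0 exprn_ile1// ltW.
    move=> q1 q2.
    have -> : expR t * hgap = (1 - a ^+ 2) * cabs (hden t 0) ^+ 2.
      by rewrite A divfK// gt_eqF// exprn_gt0.
    by rewrite ler_wpM2l.
  have A3 : hgap <= (1 - a ^+ 2) * (16 * expR `|t|).
    by rewrite -(ler_pM2l (E t)); lra.
  have A4 : 4 <= (1 - a) * (Q * expR `|t|).
    have -> : (1 - a) * (Q * expR `|t|) = (1 - a) * (128 * expR `|t|) / hgap by rewrite /Q; ring.
    rewrite ler_pdivlMr//; apply: le_trans (ler_wpM2l (ler0n R 4) A3) _.
    have : 0 <= (1 - a) * (1 - a) * expR `|t| by rewrite mulr_ge0 ?expR_ge0// -expr2 sqr_ge0.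
    lra.
  have : 0 <= Q * expR `|t| * (rho - (1 + a) / 2) by rewrite mulr_ge0 ?subr_ge0// mulr_ge0 ?expR_ge0 ?(ltW Q0).
  lra.
have Hc : Hardy p (f \o flow t) by exact: (HardyI p0 ac H).
split=> //; apply: hardy_norm_le => //.
  by rewrite mulr_ge0// mulr_ge0 ?powR_ge0 ?expR_ge0.
move=> r r01; apply: le_trans (H r r01) _.
have k1 : 0 <= Q `^ p^-1 by exact: powR_ge0.
have k2 : 0 <= expR (`|t| / p) by exact: expR_ge0.
rewrite (powRM _ (mulr_ge0 k1 k2) n0) (powRM _ k1 k2) -expRM -powRrM mulVf ?gt_eqF//.
by rewrite powRr1 ?(ltW Q0)// divfK ?gt_eqF.
Qed.

End Model.

(** * Antiperiodic functions of small exponential type *)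

Section Liouville.
Variable R : realType.
Local Notation C := R[i].
Local Notation ii := (Complex 0 1 : C).
Implicit Types (s a z w : C).

Lemma expR_lin_small (K c : R) : 0 <= K -> 0 < c -> (forall y : R, 1 < y -> K <= expR (- (c * y))) -> K <= 0.
Proof.
move=> K0 c0 H; apply: (@le_epsilon0 _ K c^-1 1) => // e e0 e1.
have y1 : 1 < e^-1 by rewrite invf_gt1.
apply: le_trans (H _ y1) _; rewrite expRN -[leRHS]invrK lef_pV2 ?posrE ?expR_gt0 ?invr_gt0 ?mulr_gt0 ?invr_gt0//.
rewrite invfM invrK; have := expR_ge1Dx (c * e^-1); lra.
Qed.

(** Serves both ends of the strip: the numerator has a part of growth [exp (kap y)] and a part that
    decays like [exp (- pi y)], the denominator grows like [exp (pi y)]. The quotient decays at any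
    rate up to the smaller of [pi - kap] and [2 pi]. *)
Lemma quotient_decay (c kap B G y : R) (x v : C) : c <= pi - kap -> c <= 2 * pi -> 1 < y ->
  0 <= B -> 0 <= G -> cabs x <= B * expR (kap * y) + G * expR (- (pi * y)) ->
  expR (pi * y) / 2 <= cabs v -> cabs (x / v) <= 2 * (B + G) * expR (- (c * y)).
Proof.
move=> c1 c2 y1 B0 G0 hx hv; have y0 : 0 < y by exact: lt_trans y1.
have p1 := expR_gt0 (pi * y); have v0 : 0 < cabs v by apply: lt_le_trans hv; rewrite divr_gt0.
rewrite cabsM cabsV ler_pdivrMr//.
have e1 : 0 <= 2 * (B + G) * expR (- (c * y)) by rewrite !mulr_ge0 ?expR_ge0// addr_ge0.
apply: le_trans (ler_wpM2l e1 hv); apply: le_trans hx _.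
have -> : 2 * (B + G) * expR (- (c * y)) * (expR (pi * y) / 2) =
   B * expR (pi * y - c * y) + G * expR (pi * y - c * y).
  by rewrite expRD; field.
by apply: lerD; rewrite ler_wpM2l// ler_expR; nra.
Qed.

Lemma expR_sub_ge (y : R) : 1 < y -> expR (pi * y) / 2 <= expR (pi * y) - expR (- (pi * y)).
Proof.
move=> y1; have h1 : 1 < pi * y by have := pi_ge2 R; nra.
have := expR_ge1Dx (pi * y); have : expR (- (pi * y)) < 1 by rewrite expR_lt1 oppr_lt0; lra.
lra.
Qed.

(* [E s = exp (i pi (s - a))]: the quotient [h = (g - g(a) E) / (E - E^-1)] has period 1, extends
   continuously to [a], and tends to [0] and to [- g(a)] at the two ends of the strip; its
   integral over a period does not depend on the height. *)
Lemma antiperiodic_zero (g : C -> C) (eta kap K : R) a :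
  0 < eta -> eta <= 1 -> kap < pi -> 0 <= K ->
  (forall s, - eta < Re s < 1 + eta -> cdifferentiable g s) ->
  (forall s, - eta < Re s < eta -> g (s + 1) = - g s) ->
  (forall s, (Re a - eta) / 2 <= Re s <= (Re a - eta) / 2 + 1 -> cabs (g s) <= K * expR (kap * `|Im s|)) ->
  - eta < Re a < eta -> g a = 0.
Proof.
move=> eta0 eta1 kp K0 dg per bd /andP[a1 a2]; have pi0 := pi_gt0 R.
(* Recentres the growth bound at the height of [a], at the cost of a constant factor. *)
have gK s : (Re a - eta) / 2 <= Re s <= (Re a - eta) / 2 + 1 -> 1 < `|Im s - Im a| ->
   cabs (g s) <= K * expR (`|kap| * `|Im a|) * expR (kap * `|Im s - Im a|).
  move=> sr y1; apply: le_trans (bd s sr) _; rewrite -mulrA -expRD ler_wpM2l// ler_expR.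
  have t1 : `|Im s| <= `|Im s - Im a| + `|Im a| by rewrite -{1}(subrK (Im a) (Im s)) ler_normD.
  have t2 : `|Im s - Im a| <= `|Im s| + `|Im a| by exact: ler_normB.
  have [k0|k0] := leP 0 kap; first by rewrite (ger0_norm k0); nra.
  rewrite (ltr0_norm k0); nra.
pose c : R := pi - kap; have c0 : 0 < c by rewrite subr_gt0.
(* The midpoint of [- eta] and [Re a]: the window [[x0, x0 + 1]] lies in the domain of [g], contains
   [a] in its interior and therefore contains no other integer translate of [a]. *)
pose x0 : R := (Re a - eta) / 2.
have x0a : x0 < Re a by rewrite /x0; lra.
have ax0 : Re a < x0 + 1 by rewrite /x0; lra.
have x01 : - eta < x0 by rewrite /x0; lra.
have x02 : x0 < 0 by rewrite /x0; lra.
pose k : C := ii * pi%:C%C.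
have kRe (u : C) : Re (k * u) = - pi * Im u.
  by rewrite /k !cReM !cImM /=; case: u => x y /=; ring.
have kIm (u : C) : Im (k * u) = pi * Re u.
  by rewrite /k cImM (cReM ii) (cImM ii) /=; case: u => x y /=; ring.
pose E s := cexp (k * (s - a)).
have E1 s : E (s + 1) = - E s.
  have -> : E (s + 1) = E s * cexp k by rewrite /E -cexpD; congr cexp; ring.
  have -> : k = Complex 0 pi by rewrite /k; apply: complexP; rewrite ?cReM ?cImM /=; ring.
  have -> : cexp (Complex 0 pi) = -1 :> C.
    by rewrite cexpi /expi cospi sinpi; apply: complexP; rewrite /= ?oppr0.
  by rewrite mulrN1.
have En s : E s != 0 by exact: cexp_neq0.
have Ea : E a = 1 by rewrite /E subrr mulr0 cexp0.
have dE s : cder E s (E s * k).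
  have d1 : cder (fun s => k * (s - a)) s k.
    have := cder_affine k (- (k * a)) s; congr cder; apply/funext => u; ring.
  exact: (cder_comp d1 (cder_cexp (k * (s - a)))).
pose N s := g s - g a * E s.
pose S s := E s - (E s)^-1.
have N1 s : - eta < Re s < eta -> N (s + 1) = - N s by move=> h; rewrite /N per// E1; ring.
have S1 s : S (s + 1) = - S s by rewrite /S E1 invrN; ring.
have dN s : - eta < Re s < 1 + eta -> exists l, cder N s l.
  move=> /dg/cdifferentiableP[l dl]; eexists; apply: cderB; first exact: dl.
  exact: cderZ (dE s).
have dS s : cder S s (E s * k - - (E s * k) / E s ^+ 2).
  by apply: cderB; [exact: dE|exact: cderV (En s) (dE s)].
have aR : - eta < Re a < 1 + eta by apply/andP; split; lra.
have [l [n [na nl Nn]]] := dN a aR.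
have [m [ma ml Sm]] := dS a.
have Na : N a = 0 by rewrite /N Ea mulr1 subrr.
have Sa : S a = 0 by rewrite /S Ea invr1 subrr.
have kn : k != 0.
  by rewrite -cabs_gt0 /k cabsM cabs_real (_ : cabs ii = 1) ?mul1r ?gtr0_norm// cabsE /= expr0n add0r expr1n sqrtr1.
have man : m a != 0.
  rewrite ma Ea expr1n divr1 mul1r opprK -mulr2n mulrn_eq0 /=; exact: kn.
(* [E s = (E s)^-1] means [E s ^ 2 = 1], that is, [s - a] is an integer; in the window only 0
   remains. *)
have S_neq0 s : `|Re s - Re a| < 1 -> s != a -> S s != 0.
  move=> sa; apply: contraNneq => /eqP; rewrite /S subr_eq0 => /eqP EV.
  have EE : cexp (k * (s - a) *+ 2) = 1.
    by rewrite cexpMn expr2 -/(E s) {1}EV mulVf.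
  have re0 : Im (s - a) = 0.
    have := cabs_cexp (k * (s - a) *+ 2); rewrite EE cabs1 => h.
    have : Re (k * (s - a) *+ 2) = 0 by apply: expR_inj; rewrite -h expR0.
    rewrite mulr2n cReD kRe => h2; apply: (mulfI (lt0r_neq0 pi0)); rewrite mulr0; lra.
  have : expi (pi *+ 2 * Re (s - a)) = 1 :> C.
    rewrite -EE -cexpi; congr cexp; apply: complexP; rewrite mulr2n ?cReD ?cImD /=.
      by rewrite kRe re0; ring.
    by rewrite kIm; ring.
  move=> /expi_eq1; rewrite normrM (gtr0_norm (tpi_gt0 R)) cReD cReN.
  rewrite gtr_pMr ?tpi_gt0// => /(_ sa) /eqP; rewrite mulf_eq0 gt_eqF ?tpi_gt0//= => /eqP r0.
  apply/eqP/complexP; first by lra.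
  by move: re0; rewrite cImD cImN; lra.
(* Dividing the Caratheodory quotients at [a] instead of [N] and [S] gives the continuous extension
   to [a] at once. *)
pose h s := n s / m s.
have hE s : s != a -> h s = N s / S s.
  move=> sa; have d0 : s - a != 0 by rewrite subr_eq0.
  by rewrite /h (Nn s) (Sm s) Na Sa !add0r invfM mulrACA mulfV// mulr1.
have inst s : x0 <= Re s <= x0 + 1 -> - eta < Re s < 1 + eta.
  by move=> /andP[h1 h2]; apply/andP; split; lra.
have close s : x0 <= Re s <= x0 + 1 -> `|Re s - Re a| < 1.
  move=> /andP[h1 h2]; rewrite ltr_norml; apply/andP; split; last by lra.
  by rewrite /x0 in h1 h2 *; lra.
have dh s : x0 <= Re s <= x0 + 1 -> s != a -> cdifferentiable h s.
  move=> sr sa; have [q dq] := dN s (inst s sr).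
  apply: cder_cdiff; apply: (@cder_eq _ (fun s => N s / S s)).
    have := @ccts_near_neq0 _ (fun s => s - a) s; rewrite subr_eq0 => /(_ _ sa) H.
    have : \forall w \near cnbhs s, w - a != 0.
      by apply: H; apply: climB; [exact: ccts_id|exact: clim_cst].
    by apply: filterS => w; rewrite subr_eq0 => /hE ->.
  apply: cderM; first exact: dq.
  by apply: cderV; [exact: S_neq0 (close s sr) sa|exact: dS].
have ch s : x0 <= Re s <= x0 + 1 -> ccts h s.
  move=> sr; have [->|sa] := eqVneq s a; last exact/cdiff_ccts/dh.
  apply: climM; first by rewrite na.
  by apply: climV => //; rewrite ma.
have perh y : h (Complex (x0 + 1) y) = h (Complex x0 y).
  have -> : Complex (x0 + 1) y = Complex x0 y + 1 by apply: complexP; rewrite ?cReD ?cImD /=; ring.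
  rewrite !hE; last 2 first.
  - by apply/eqP => e; move: x0a; rewrite -e /= ltxx.
  - apply/eqP => e; have : Re (Complex x0 y + 1) = Re a by rewrite e.
    by rewrite cReD /=; lra.
  rewrite N1 ?S1; last by clear -x01 x02 eta0; apply/andP; split => /=; lra.
  by rewrite invrN mulrNN.
have I (Y : R) : 0 <= Y -> cint x0 (x0 + 1) (fun t => h (Complex t (Im a - Y))) =
   cint x0 (x0 + 1) (fun t => h (Complex t (Im a + Y))).
  move=> Y0; have := @periodic_cint _ h x0 (Im a - Y) 1 (2 * Y) a (a + 1).
  have -> : Im a - Y + 2 * Y = Im a + Y by ring.
  apply => //; first by rewrite mulr_ge0.
  - by move=> z [zr _]; exact: ch.
  - by rewrite cReD /= ltrDl.
  - by move=> z [zr _] za _; exact: dh.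
pose A : R := K * expR (`|kap| * `|Im a|) + cabs (g a).
have A0 : 0 <= A by rewrite addr_ge0 ?cabs_ge0// mulr_ge0// expR_ge0.
pose c1 : R := Num.min c (2 * pi); have c10 : 0 < c1 by rewrite lt_min c0 mulr_gt0.
have cE s : cabs (E s) = expR (- (pi * (Im s - Im a))).
  by rewrite /E cabs_cexp kRe cImD cImN mulNr.
have top (Y : R) t : 1 < Y -> x0 <= t <= x0 + 1 -> cabs (h (Complex t (Im a + Y))) <= 2 * A * expR (- (c1 * Y)).
  move=> Y1 tr; set s := Complex t (Im a + Y).
  have sY : Im s - Im a = Y by rewrite /s /=; ring.
  have sa : s != a by clear -sY Y1; apply/eqP => e; move: sY; rewrite e subrr; lra.
  rewrite hE//; apply: (quotient_decay (kap := kap)) => //.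
  - by rewrite ge_min lexx.
  - by rewrite ge_min lexx orbT.
  - by rewrite mulr_ge0// expR_ge0.
  - exact: cabs_ge0.
  - rewrite /N; apply: le_trans (cabsB _ _) _; rewrite cabsM cE sY lerD2r.
    by have := gK s tr; rewrite sY gtr0_norm ?(lt_trans ltr01)//; apply.
  - apply: le_trans (expR_sub_ge Y1) _; rewrite /S cabsBC.
    have := ler_cabs_sub (E s)^-1 (E s); rewrite cabsV !cE sY expRN invrK//.
have bot (Y : R) t : 1 < Y -> x0 <= t <= x0 + 1 ->
    cabs (h (Complex t (Im a - Y)) + g a) <= 2 * A * expR (- (c1 * Y)).
  move=> Y1 tr; set s := Complex t (Im a - Y).
  have sY : Im s - Im a = - Y by rewrite /s /=; ring.
  have sa : s != a by clear -sY Y1; apply/eqP => e; move: sY; rewrite e subrr; lra.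
  have Sn := S_neq0 s (close s tr) sa.
  have -> : h s + g a = (g s - g a * (E s)^-1) / S s.
    by rewrite hE// -[X in _ + X](mulfK Sn) -mulrDl; congr (_ / _); rewrite /N /S; ring.
  apply: (quotient_decay (kap := kap)) => //.
  - by rewrite ge_min lexx.
  - by rewrite ge_min lexx orbT.
  - by rewrite mulr_ge0// expR_ge0.
  - exact: cabs_ge0.
  - apply: le_trans (cabsB _ _) _; rewrite cabsM cabsV cE sY mulrN opprK -expRN lerD2r.
    by have := gK s tr; rewrite sY normrN gtr0_norm ?(lt_trans ltr01)//; apply.
  - apply: le_trans (expR_sub_ge Y1) _; rewrite /S.
    have := ler_cabs_sub (E s) (E s)^-1; rewrite cabsV !cE sY mulrN opprK expRN//.
have cI (Y : R) : icts x0 (x0 + 1) (fun t => h (Complex t Y)).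
  by apply: icts_horizontal => t tr; exact: ch.
have fin (Y : R) : 1 < Y -> cabs (g a) <= 8 * A * expR (- (c1 * Y)).
  move=> Y1; have x11 : x0 <= x0 + 1 by rewrite lerDl.
  have IY := I Y (ltW (lt_trans ltr01 Y1)).
  have b1 := cabs_cint x11 (cI (Im a + Y)) (top Y ^~ Y1).
  have cg : icts x0 (x0 + 1) (fun=> g a) by exact: icts_cst.
  have b2 := cabs_cint x11 (ictsD (cI (Im a - Y)) cg) (bot Y ^~ Y1).
  rewrite cintD// IY cint_cst// in b2.
  have e1 : x0 + 1 - x0 = 1 by ring.
  rewrite e1 rmorph1 !mulr1 in b1 b2.
  move: (cint x0 (x0 + 1) (fun t => h (Complex t (Im a + Y)))) b1 b2 => J b1 b2.
  have := cabsB (J + g a) J; rewrite (addrC J) addrK => /le_trans; apply.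
  rewrite addrC in b2; apply: le_trans (lerD b2 b1) _.
  by rewrite le_eqVlt; apply/orP; left; apply/eqP; ring.
apply/eqP; rewrite -cabs_eq0 eq_le cabs_ge0 andbT.
have [A00|A00] := eqVneq A 0.
  by have := fin 2; rewrite A00 mulr0 mul0r; apply; rewrite ltr1n.
have Ap : 0 < 8 * A by rewrite mulr_gt0// lt_def A00.
have := @expR_lin_small (cabs (g a) / (8 * A)) c1; rewrite divr_ge0 ?cabs_ge0 ?(ltW Ap)// => /(_ isT c10) H.
have := H; rewrite pmulr_lle0 ?invr_gt0//; apply=> y y1.
by rewrite ler_pdivrMr// mulrC fin.
Qed.

(** The identity theorem on a strip, by a chain of discs centred on the segment from [s0] to [s1].
    The common radius [rho] is admissible for all centres because the strip is convex; [n] makes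
    consecutive centres closer than [rho / 2]. *)
Lemma strip_zero (g : C -> C) (eta d : R) s0 : 
  (forall s, - eta < Re s < eta -> cdifferentiable g s) -> - eta < Re s0 < eta -> 0 < d ->
  (forall s, cabs (s - s0) < d -> g s = 0) -> forall s, - eta < Re s < eta -> g s = 0.
Proof.
move=> dg s0r d0 gd s1 s1r.
pose rho : R := Num.min (eta - `|Re s0|) (eta - `|Re s1|).
have rho0 : 0 < rho by rewrite lt_min !subr_gt0 !ltr_norml s0r.
have r0 : rho <= eta - `|Re s0| by rewrite ge_min lexx.
have r1 : rho <= eta - `|Re s1| by rewrite ge_min lexx orbT.
pose pt (x : R) : C := s0 + x%:C%C * (s1 - s0).
have ptr (x : R) s : 0 <= x <= 1 -> cabs (s - pt x) < rho -> - eta < Re s < eta.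
  move=> /andP[x0 x1] h; have := le_lt_trans (ler_Re_cabs _) h.
  have -> : Re (s - pt x) = Re s - (Re s0 + x * (Re s1 - Re s0)).
    by rewrite cReD cReN /pt cReD cReZ cReD cReN.
  move: r0 r1; have := ler_norm (Re s0); have := ler_norm (Re s1).
  have := ler_norm (- Re s0); have := ler_norm (- Re s1); rewrite !normrN.
  move: (`|Re s0|) (`|Re s1|) (Re s0) (Re s1) (Re s) => A B a b u h1 h2 h3 h4 r0 r1.
  rewrite ltr_norml => /andP[q1 q2].
  have c1 : (1 - x) * a + x * b <= (1 - x) * (eta - rho) + x * (eta - rho).
    by clear -x0 x1 r0 r1 h1 h2 h3 h4; apply: lerD; apply: ler_wpM2l; lra.
  have c2 : (1 - x) * (- a) + x * (- b) <= (1 - x) * (eta - rho) + x * (eta - rho).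
    by clear -x0 x1 r0 r1 h1 h2 h3 h4; apply: lerD; apply: ler_wpM2l; lra.
  by apply/andP; split; lra.
have step (x e : R) : 0 <= x <= 1 -> 0 < e -> (forall s, cabs (s - pt x) < e -> g s = 0) ->
   forall s, cabs (s - pt x) < rho -> g s = 0.
  move=> x01 e0 ge s hs.
  pose f z := g (rho%:C%C * z + pt x).
  have af : analytic_on (@disc R) f.
    move=> z zd; have /cdifferentiableP[l dl] : cdifferentiable g (rho%:C%C * z + pt x).
      apply: dg; apply: (ptr x) => //; rewrite addrK cabsM cabs_real gtr0_norm//.
      by rewrite -[ltRHS]mulr1 ltr_pM2l.
    exact: cder_cdiff (cder_comp (cder_affine rho%:C%C (pt x) z) dl).
  have rn : rho%:C%C != 0 :> C by rewrite -cabs_gt0 cabs_real gtr0_norm.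
  have f0 z : cabs z < e / rho -> f z = 0.
    move=> ze; apply: ge; rewrite addrK cabsM cabs_real gtr0_norm//.
    by rewrite mulrC -ltr_pdivlMr.
  have := analytic_zero af (divr_gt0 e0 rho0) f0 (z := (s - pt x) / rho%:C%C).
  rewrite cabsM cabsV cabs_real gtr0_norm// ltr_pdivrMr// mul1r => /(_ hs).
  by rewrite /f mulrC divfK// subrK.
have [n nb] : exists n : nat, cabs (s1 - s0) / rho * 2 < n.+1%:R.
  have [n _ H] : \forall n \near \oo, cabs (s1 - s0) / rho * 2 < n%:R by exact: nbhs_infty_gtr.
  by exists n; apply: H => /=.
have n0 : 0 < n.+1%:R :> R by rewrite ltr0n.
have ind k : (k <= n.+1)%N -> exists2 e : R, 0 < e & forall s, cabs (s - pt (k%:R / n.+1%:R)) < e -> g s = 0.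
  elim: k => [|k IH] kn.
    exists d => // s; rewrite /pt mul0r.
    have -> : 0%:C%C * (s1 - s0) = 0 :> C by rewrite mul0r.
    by rewrite addr0; exact: gd.
  have [e e0 ge] := IH (ltnW kn).
  have x01 : 0 <= (k%:R / n.+1%:R : R) <= 1.
    by rewrite divr_ge0//= ler_pdivrMr// mul1r ler_nat ltnW.
  have G := step _ _ x01 e0 ge.
  exists (rho / 2); first by rewrite divr_gt0.
  move=> s hs; apply: G.
  have -> : s - pt (k%:R / n.+1%:R) = (s - pt (k.+1%:R / n.+1%:R)) + (n.+1%:R^-1)%:C%C * (s1 - s0).
    rewrite /pt -[k.+1]addn1 natrD mulrDl mul1r real_complexD; ring.
  apply: le_lt_trans (cabsD _ _) _; rewrite cabsM cabs_real gtr0_norm ?invr_gt0//.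
  rewrite (splitr rho); apply: ltrD => //.
  by rewrite ltr_pdivrMl// mulrA ltr_pdivlMr// -ltr_pdivrMr// mulrAC.
have [e e0 ge] := ind n.+1 (leqnn _); apply: ge.
rewrite divff ?gt_eqF// /pt rmorph1 mul1r.
by have -> : s1 - (s0 + (s1 - s0)) = 0; [ring|rewrite cabs0].
Qed.

End Liouville.

(** * The exponential functions in the Hardy space *)

Section Annihilation.
Variable R : realType.
Local Notation C := R[i].
Implicit Types (f g q : C -> C) (p t : R) (z w s h : C).
Local Notation analytic := (analytic_on (@disc R)).
Variables z1 z2 : C.
Hypotheses (z1u : cabs z1 = 1) (z2u : cabs z2 = 1) (z12 : z1 != z2).
Local Notation ell := (hlog z1 z2).
Local Notation emaj := (emaj z1 z2).

Definition hexp s z : C := cexp (s * ell z).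

Lemma analytic_hexp s : analytic (hexp s).
Proof. exact: analytic_expl. Qed.

Lemma hexpD s w z : hexp (s + w) z = hexp s z * hexp w z.
Proof. by rewrite /hexp mulrDl cexpD. Qed.

Lemma cabs_hexp (kap : R) s z : `|Im (ell z)| <= kap ->
  cabs (hexp s z) <= expR (Re s * Re (ell z)) * expR (kap * `|Im s|).
Proof.
move=> k; rewrite /hexp cabs_cexp cReM expRD ler_pM2l ?expR_gt0// ler_expR.
apply: le_trans (ler_norm _) _; rewrite normrN normrM mulrC ler_wpM2r//.
Qed.

Lemma sqr_le_expR (x : R) : 0 <= x -> x ^+ 2 <= 4 * expR x.
Proof.
move=> x0; have h := expR_ge1Dx (x / 2).
have -> : expR x = expR (x / 2) ^+ 2 by rewrite -expRM_natl; congr expR; field.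
have : (1 + x / 2) ^+ 2 <= expR (x / 2) ^+ 2.
  by rewrite ler_pXn2r// nnegrE ?expR_ge0// addr_ge0// divr_ge0.
rewrite !expr2; nra.
Qed.

(** The expansion of [s |-> hexp s * q] in [H^p] to first order with quadratic remainder. The spare
    factor [exp (d |Re ell|)] in the hypothesis pays for the powers of [ell] and for [exp (h ell)]
    with [|h| <= d / 2]. *)
Lemma hexp_expansion p sg (d : R) (A : R) q s :
  0 < p -> 0 < sg -> sg * p < 1 -> 0 < d -> 0 <= A -> analytic q ->
  (forall z, cabs z < 1 -> cabs (hexp s z * q z) * expR (d * `|Re (ell z)|) <= A * emaj sg z) ->
  [/\ Hardy p (fun z => hexp s z * q z), Hardy p (fun z => ell z * (hexp s z * q z)) &
   exists2 M : R, 0 <= M & forall h, cabs h <= d / 2 ->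
     Hardy p (fun z => hexp (s + h) z * q z - hexp s z * q z - h * (ell z * (hexp s z * q z))) /\
     hardy_norm p (fun z => hexp (s + h) z * q z - hexp s z * q z - h * (ell z * (hexp s z * q z)))
       <= M * cabs h ^+ 2].
Proof.
move=> p0 sg0 sgp d0 A0 aq bd; have [K K0 HK] := hardy_emaj z1u z2u z12 p0 sg0 sgp.
have [kap kp kI] := hlog_Im z1 z2.
have k0 : 0 <= kap by apply: le_trans (kI 0).
have al : analytic ell by exact: analytic_hlog.
have ae : analytic (fun z => hexp s z * q z) by apply: analyticM => //; exact: analytic_hexp.
have ele z : cabs (ell z) <= `|Re (ell z)| + kap.
  by apply: le_trans (ler_cabs_ReIm _) _; rewrite lerD2l.
(* Two copies of [exp (d |ell| / 2)]: one absorbs [exp (|h| |ell|)], the other the factor [|ell|] or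
   [|ell|^2]. *)
have egt z : expR (d / 2 * cabs (ell z)) * expR (d / 2 * cabs (ell z)) <=
    expR (d * kap) * expR (d * `|Re (ell z)|).
  rewrite -!expRD ler_expR -mulrDl -splitr -mulrDr ler_pM2l// addrC; exact: ele.
have e1 z : 1 <= expR (d / 2 * cabs (ell z)).
  by rewrite -[leLHS]expR0 ler_expR mulr_ge0 ?cabs_ge0// divr_ge0// ltW.
have bd2 z : cabs z < 1 -> cabs (hexp s z * q z) *
    (expR (d / 2 * cabs (ell z)) * expR (d / 2 * cabs (ell z))) <= expR (d * kap) * A * emaj sg z.
  move=> zd; apply: le_trans (ler_wpM2l (cabs_ge0 _) (egt z)) _.
  by rewrite mulrCA -mulrA ler_pM2l ?expR_gt0// bd.
set A' := expR (d * kap) * A in bd2; have A'0 : 0 <= A' by rewrite mulr_ge0// expR_ge0.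
split.
- apply: (HK _ A' A'0 ae _).1 => z zd; apply: le_trans (bd2 z zd).
  by rewrite ler_peMr ?cabs_ge0// mulr_ege1.
- have B0 : 0 <= 2 / d * A' by rewrite mulr_ge0// divr_ge0// ltW.
  apply: (HK _ _ B0 _ _).1; first exact: analyticM.
  move=> z zd; rewrite -(mulrA _ A'); apply: le_trans (ler_wpM2l _ (bd2 z zd)); last by rewrite divr_ge0// ltW.
  rewrite cabsM mulrC mulrCA; apply: ler_wpM2l; first exact: cabs_ge0.
  have h1 := expR_ge1Dx (d / 2 * cabs (ell z)).
  have h2 : cabs (ell z) = 2 / d * (d / 2 * cabs (ell z)) by field; rewrite gt_eqF.
  rewrite [leLHS]h2; apply: ler_wpM2l; first by rewrite divr_ge0// ltW.
  have := e1 z; have := cabs_ge0 (ell z); move: h1; move: (expR _) => E; nra.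
(* The 3 is that of [cexp_sub1_le]; with [y = d |ell| / 2] one has [|ell|^2 = 4 y^2 / d^2] and
   [y^2 <= 4 exp y], whence [16 / d^2]. *)
exists (3 * (16 / d ^+ 2) * A' * K).
  by rewrite !mulr_ge0 ?invr_ge0 ?exprn_ge0// ltW.
move=> h hd.
have E z : hexp (s + h) z * q z - hexp s z * q z - h * (ell z * (hexp s z * q z)) =
    hexp s z * q z * (cexp (h * ell z) - 1 - h * ell z).
  by rewrite hexpD {2}/hexp; ring.
have an : analytic (fun z => hexp (s + h) z * q z - hexp s z * q z - h * (ell z * (hexp s z * q z))).
  move=> z zd; have /cdifferentiableP[l1 h1] := analytic_hexp (s + h) zd.
  have /cdifferentiableP[l2 h2] := ae z zd; have /cdifferentiableP[l3 h3] := aq z zd.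
  have /cdifferentiableP[l4 h4] := al z zd.
  apply: cder_cdiff; apply: cderB; first apply: cderB.
  - exact: (cderM h1 h3).
  - exact: h2.
  - exact: cderZ (cderM h4 h2).
have B0 : 0 <= 3 * (16 / d ^+ 2) * A' * cabs h ^+ 2.
  by rewrite !mulr_ge0 ?invr_ge0 ?exprn_ge0 ?cabs_ge0// ltW.
rewrite (mulrAC _ K); apply: (HK _ _ B0 an _) => z zd; rewrite E cabsM.
have -> : 3 * (16 / d ^+ 2) * A' * cabs h ^+ 2 * emaj sg z =
  3 * (16 / d ^+ 2) * cabs h ^+ 2 * (A' * emaj sg z) by ring.
apply: le_trans (ler_wpM2l _ (bd2 z zd)); last by rewrite !mulr_ge0 ?invr_ge0 ?exprn_ge0 ?cabs_ge0// ltW.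
rewrite [leRHS]mulrCA; apply: ler_wpM2l; first exact: cabs_ge0.
apply: le_trans (cexp_sub1_le _) _; rewrite cabsM exprMn.
set y := d / 2 * cabs (ell z).
have y0 : 0 <= y by rewrite mulr_ge0 ?cabs_ge0// divr_ge0// ltW.
have l2 : cabs (ell z) ^+ 2 = 4 / d ^+ 2 * y ^+ 2.
  by rewrite /y; field; rewrite gt_eqF.
have -> : 3 * (cabs h ^+ 2 * cabs (ell z) ^+ 2) * expR (cabs h * cabs (ell z)) =
   3 * (4 / d ^+ 2) * cabs h ^+ 2 * (y ^+ 2 * expR (cabs h * cabs (ell z))) by rewrite l2; ring.
have -> : 3 * (16 / d ^+ 2) * cabs h ^+ 2 * (expR y * expR y) =
   3 * (4 / d ^+ 2) * cabs h ^+ 2 * (4 * expR y * expR y) by field; rewrite gt_eqF.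
apply: ler_wpM2l; first by rewrite !mulr_ge0 ?invr_ge0 ?exprn_ge0 ?cabs_ge0// ltW.
apply: ler_pM; rewrite ?sqr_ge0 ?expR_ge0//; first exact: sqr_le_expR.
by rewrite ler_expR ler_wpM2r// cabs_ge0.
Qed.

Lemma dual_hexp_diff p L sg (d A : R) q s :
  0 < p -> Hardy_dual p L -> 0 < sg -> sg * p < 1 -> 0 < d -> 0 <= A -> analytic q ->
  (forall z, cabs z < 1 -> cabs (hexp s z * q z) * expR (d * `|Re (ell z)|) <= A * emaj sg z) ->
  cdifferentiable (fun s => L (fun z => hexp s z * q z)) s.
Proof.
move=> p0 HL sg0 sgp d0 A0 aq bd.
have [H1 H2 [M M0 HM]] := hexp_expansion p0 sg0 sgp d0 A0 aq bd.
exists (L (fun z => ell z * (hexp s z * q z))) => e e0.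
have N0 := dual_norm_ge0 p0 HL; set N := dual_norm p L in N0.
have NM : 0 < N * M + 1 by rewrite ltr_wpDl// mulr_ge0.
exists (Num.min (d / 2) (e / (N * M + 1))); first by rewrite lt_min !divr_gt0.
move=> h; rewrite lt_min => /andP[hd he]; have [H3 H4] := HM h (ltW hd).
set r := (fun z => _) in H3 H4.
have Er : (fun z => hexp (s + h) z * q z) =
    r + (h *: (fun z => ell z * (hexp s z * q z)) + (fun z => hexp s z * q z)).
  apply/funext => z; rewrite /r.
  rewrite -[RHS]/(hexp (s + h) z * q z - hexp s z * q z - h * (ell z * (hexp s z * q z)) +
    (h * (ell z * (hexp s z * q z)) + hexp s z * q z)); ring.
rewrite Er (dualD HL H3 (Hardy_lin h p0 H2 H1)) HL.1//.
set a := L r; set b := L _; set c := L _.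
have -> : a + (h * b + c) - c - b * h = a by ring.
apply: le_trans (dbound_dual_norm p0 HL H3) _; rewrite -/N.
apply: le_trans (ler_wpM2l N0 H4) _.
rewrite expr2 !mulrA; apply: ler_wpM2r; first exact: cabs_ge0.
move: he; rewrite ltr_pdivlMr//; have := cabs_ge0 h; nra.
Qed.

Lemma emaj_ge sg (d u : R) z : 0 <= d -> `|u| + d <= sg ->
  expR (u * Re (ell z)) * expR (d * `|Re (ell z)|) <= emaj sg z.
Proof.
move=> d0 h; rewrite -expRD /emaj; move: (Re (ell z)) => x.
have h1 := ler_norm u; have := ler_norm (- u); rewrite normrN => h2.
have [x0|x0] := leP 0 x.
  rewrite (ger0_norm x0) -mulrDl; apply: (@le_trans _ _ (expR (sg * x))).
    by rewrite ler_expR ler_wpM2r//; lra.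
  by rewrite lerDl expR_ge0.
rewrite (ltr0_norm x0) mulrN -mulrBl; apply: (@le_trans _ _ (expR (- sg * x))).
  by rewrite ler_expR ler_wnM2r ?(ltW x0)//; lra.
by rewrite lerDr expR_ge0.
Qed.

Lemma hexp_bounded q (B kap sg d : R) s z : (forall z, `|Im (ell z)| <= kap) -> 0 <= B ->
  (forall z, cabs z < 1 -> cabs (q z) <= B) -> 0 <= d -> `|Re s| + d <= sg -> cabs z < 1 ->
  cabs (hexp s z * q z) * expR (d * `|Re (ell z)|) <= B * expR (kap * `|Im s|) * emaj sg z.
Proof.
move=> k B0 qB d0 h zd; rewrite cabsM mulrAC mulrC -!mulrA; apply: ler_pM; rewrite ?cabs_ge0 ?qB//.
  by rewrite mulr_ge0 ?cabs_ge0 ?expR_ge0.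
apply: le_trans (ler_wpM2r (expR_ge0 _) (cabs_hexp s (k z))) _.
by rewrite mulrAC mulrC ler_pM2l ?expR_gt0// emaj_ge.
Qed.

(** Where [Re ell >= 0], one factor [exp ell = hmap] is absorbed by [z - z2], as
    [(z - z2) * hmap z = z1 - z] is bounded. This shifts the right end of the admissible strip by
    1. *)
Lemma hexp_bounded_sub q (B kap sg d : R) s z : (forall z, `|Im (ell z)| <= kap) -> 0 <= B ->
  (forall z, cabs z < 1 -> cabs (q z) <= B) -> 0 <= d -> d - sg <= Re s <= 1 + sg - d -> cabs z < 1 ->
  cabs (hexp s z * ((z - z2) * q z)) * expR (d * `|Re (ell z)|) <=
    2 * B * expR (kap * `|Im s|) * emaj sg z.
Proof.
move=> k B0 qB d0 /andP[h1 h2] zd; have [zn _] := disc_neq z1u z2u zd.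
set x := Re (ell z).
have b1 : cabs (z - z2) <= 2 by apply: le_trans (cabsB _ _) _; rewrite z2u; lra.
have b2 : cabs (z - z2) * expR x <= 2.
  have -> : expR x = cabs (hmap z1 z2 z) by rewrite -(cexp_hlog z1u z2u z12 zd) cabs_cexp.
  rewrite -cabsM /hmap mulrC divfK//; apply: le_trans (cabsB _ _) _; rewrite z1u; lra.
have main : expR (Re s * x) * cabs (z - z2) * expR (d * `|x|) <= 2 * emaj sg z.
  rewrite /emaj -/x; have [x0|x0] := leP 0 x.
    rewrite (ger0_norm x0); have -> : Re s * x = x + (Re s - 1) * x by ring.
    have e : expR ((Re s - 1 + d) * x) = expR ((Re s - 1) * x) * expR (d * x).
      by rewrite -expRD; congr expR; ring.
    have -> : expR (x + (Re s - 1) * x) * cabs (z - z2) * expR (d * x) =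
        cabs (z - z2) * expR x * expR ((Re s - 1 + d) * x).
      by rewrite e expRD; move: (expR x) (expR (d * x)) (expR _) => E1 E2 E3; ring.
    apply: ler_pM; rewrite ?expR_ge0 ?mulr_ge0 ?cabs_ge0 ?expR_ge0//.
    apply: (@le_trans _ _ (expR (sg * x))); last by rewrite lerDl expR_ge0.
    by rewrite ler_expR ler_wpM2r//; lra.
  rewrite (ltr0_norm x0) mulrAC mulrC; apply: ler_pM; rewrite ?cabs_ge0 ?mulr_ge0 ?expR_ge0//.
  rewrite -expRD; apply: (@le_trans _ _ (expR (- sg * x))); last by rewrite lerDr expR_ge0.
  by rewrite ler_expR mulrN -mulrBl ler_wnM2r ?(ltW x0)//; lra.
rewrite !cabsM.
have h3 := cabs_hexp s (k z); rewrite -/x in h3.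
have e0 := expR_ge0 (d * `|x|); have Q0 := cabs_ge0 (q z); have Z0 := cabs_ge0 (z - z2).
apply: (@le_trans _ _ (expR (Re s * x) * expR (kap * `|Im s|) * (cabs (z - z2) * B) * expR (d * `|x|))).
  apply: ler_wpM2r => //; apply: ler_pM; rewrite ?cabs_ge0 ?mulr_ge0//.
  by apply: ler_wpM2l => //; exact: qB.
have -> : expR (Re s * x) * expR (kap * `|Im s|) * (cabs (z - z2) * B) * expR (d * `|x|) =
  B * expR (kap * `|Im s|) * (expR (Re s * x) * cabs (z - z2) * expR (d * `|x|)) by ring.
have -> : 2 * B * expR (kap * `|Im s|) * emaj sg z = B * expR (kap * `|Im s|) * (2 * emaj sg z) by ring.
by apply: ler_wpM2l main; rewrite mulr_ge0// expR_ge0.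
Qed.

(* With [g s = L (hexp s * (z - z2) * z^n)], [g (s + 1) + g s = (z1 - z2) * L (hexp s * z^n)]
   because [exp ell = hmap]; so if the latter vanishes, [g] is antiperiodic, hence zero. *)
Lemma dual_hexp_kill p L s0 (d : R) : 1 < p -> Hardy_dual p L -> - p^-1 < Re s0 < p^-1 -> 0 < d ->
  (forall s, cabs (s - s0) < d -> L (hexp s) = 0) -> forall f, Hardy p f -> L f = 0.
Proof.
move=> p1 HL s0r d0 L0; have p0 : 0 < p by lra.
have [kap kp kI] := hlog_Im z1 z2; set eta := p^-1.
have eta0 : 0 < eta by rewrite invr_gt0.
have eta1 : eta <= 1 by rewrite invf_le1// ltW.
have q1 n z : cabs z < 1 -> cabs (z ^+ n) <= 1.
  by move=> zd; rewrite cabsX exprn_ile1 ?cabs_ge0// ltW.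
have sgp (x : R) : x < eta -> x * p < 1 by move=> xe; rewrite -ltr_pdivlMr// div1r.
have D1 n s : - eta < Re s < eta -> cdifferentiable (fun s => L (fun z => hexp s z * z ^+ n)) s.
  move=> sr; have sr' : `|Re s| < eta by rewrite ltr_norml.
  have n0 := normr_ge0 (Re s).
  apply: (@dual_hexp_diff p L ((`|Re s| + eta) / 2) ((eta - `|Re s|) / 2) (1 * expR (kap * `|Im s|))) => //; try lra.
  - apply: sgp; lra.
  - exact: analytic_pow.
  by move=> z zd; apply: (@hexp_bounded (fun z => z ^+ n) 1 kap) => //; [exact: q1|lra|lra].
have Hs n s : - eta < Re s < eta -> Hardy p (fun z => hexp s z * z ^+ n).
  move=> sr; have sr' : `|Re s| < eta by rewrite ltr_norml.
  have n0 := normr_ge0 (Re s).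
  have [] // := @hexp_expansion p ((`|Re s| + eta) / 2) ((eta - `|Re s|) / 2)
    (1 * expR (kap * `|Im s|)) (fun z => z ^+ n) s; try lra.
  - apply: sgp; lra.
  - exact: analytic_pow.
  by move=> z zd; apply: (@hexp_bounded (fun z => z ^+ n) 1 kap) => //; [exact: q1|lra|lra].
have aq n : analytic (fun z => (z - z2) * z ^+ n).
  apply: analyticM; last exact: analytic_pow.
  by move=> z _; apply: cder_cdiff; apply: cderB; [exact: cder_id|exact: cder_cst].
have expn n s : - eta < Re s < 1 + eta -> exists sg dd : R, 0 < sg /\ sg * p < 1 /\ 0 < dd /\
   forall z, cabs z < 1 -> cabs (hexp s z * ((z - z2) * z ^+ n)) * expR (dd * `|Re (ell z)|) <=
     2 * 1 * expR (kap * `|Im s|) * emaj sg z.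
  (* [m] is the distance from [Re s] to [[0, 1]]; it is below [eta], and [sg] and [dd] share the
     room between them. *)
  move=> /andP[s1 s2]; pose m : R := Num.max 0 (Num.max (- Re s) (Re s - 1)).
  have m0 : 0 <= m by rewrite le_max lexx.
  have m1 : - Re s <= m by rewrite !le_max lexx orbT.
  have m2 : Re s - 1 <= m by rewrite !le_max lexx !orbT.
  have m3 : m < eta by rewrite !gt_max; apply/and3P; split; lra.
  exists ((m + eta) / 2), ((eta - m) / 2); split; first lra.
  split; first by apply: sgp; lra.
  split; first lra.
  move=> z zd; apply: (@hexp_bounded_sub (fun z => z ^+ n) 1 kap) => //; [exact: q1|clear -m3; lra|clear -m1 m2 m3; apply/andP; split; lra].
have D2 n s : - eta < Re s < 1 + eta -> cdifferentiable (fun s => L (fun z => hexp s z * ((z - z2) * z ^+ n))) s.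
  move=> sr; have [sg [dd [g1 [g2 [g3 g4]]]]] := expn n s sr.
  by apply: (dual_hexp_diff p0 HL g1 g2 g3 _ (aq n) g4); rewrite !mulr_ge0// expR_ge0.
have Hs2 n s : - eta < Re s < 1 + eta -> Hardy p (fun z => hexp s z * ((z - z2) * z ^+ n)).
  move=> sr; have [sg [dd [g1 [g2 [g3 g4]]]]] := expn n s sr.
  by have [] // := hexp_expansion p0 g1 g2 g3 _ (aq n) g4; rewrite !mulr_ge0// expR_ge0.
have main n s : - eta < Re s < eta -> L (fun z => hexp s z * z ^+ n) = 0.
  elim: n s => [|n IH].
    apply: (strip_zero (D1 0%N) s0r d0) => s sd; rewrite -[RHS](L0 s sd); congr L.
    by apply/funext => z; rewrite expr0 mulr1.
  pose g s := L (fun z => hexp s z * ((z - z2) * z ^+ n)).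
  have g0 a : - eta < Re a < eta -> g a = 0.
    (* With this [sg] the window of [antiperiodic_zero] is [[- sg, 1 - sg]], so a single majorant
       and a single [K] bound [g] on all of it, with spare exponent 0. *)
    move=> ar; have /andP[a1 a2] := ar; pose sg := (eta - Re a) / 2.
    have sg0 : 0 < sg by rewrite /sg; lra.
    have sge : sg < eta by rewrite /sg; lra.
    have [K K0 HK] := hardy_emaj z1u z2u z12 p0 sg0 (sgp sg sge).
    apply: (@antiperiodic_zero _ g eta kap (dual_norm p L * (2 * 1 * K)) a) => //.
    - by rewrite mulr_ge0 ?dual_norm_ge0// !mulr_ge0// ltW.
    - exact: D2.
    - move=> s sr; have /andP[s1 s2] := sr.
      have H1 : Hardy p (fun z => hexp (s + 1) z * ((z - z2) * z ^+ n)).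
        by apply: Hs2; rewrite cReD /=; clear -s1 s2; apply/andP; split; lra.
      have H2 : Hardy p (fun z => hexp s z * ((z - z2) * z ^+ n)).
        by apply: Hs2; clear -s1 s2; apply/andP; split; lra.
      have : L (1 *: (fun z => hexp (s + 1) z * ((z - z2) * z ^+ n)) +
          (fun z => hexp s z * ((z - z2) * z ^+ n))) = 0.
        rewrite -[RHS](mulr0 (z1 - z2)) -(IH s sr) -(dualZ p0 HL (z1 - z2) (Hs n s sr)).
        apply/esym; apply: (dual_eq p0 HL); first exact: (HardyZ (z1 - z2) p0 (Hs n s sr)).
        move=> z zd; have [zn _] := disc_neq z1u z2u zd.
        rewrite -[LHS]/((z1 - z2) * (hexp s z * z ^+ n)).
        rewrite -[RHS]/(1 * (hexp (s + 1) z * ((z - z2) * z ^+ n)) + hexp s z * ((z - z2) * z ^+ n)).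
        have h1 : hexp 1 z = hmap z1 z2 z by rewrite /hexp mul1r (cexp_hlog z1u z2u z12 zd).
        rewrite hexpD h1 /hmap; field; exact: zn.
      by rewrite HL.1// mul1r => /eqP; rewrite addr_eq0 => /eqP.
    - move=> s /andP[s1 s2]; rewrite /g.
      have B0 : 0 <= 2 * 1 * expR (kap * `|Im s|) by rewrite !mulr_ge0// expR_ge0.
      have [||Hf nf] := HK (fun z => hexp s z * ((z - z2) * z ^+ n)) _ B0.
      + by apply: analyticM; [exact: analytic_hexp|exact: aq].
      + move=> z zd; have := @hexp_bounded_sub (fun z => z ^+ n) 1 kap sg 0 s z kI ler01 (q1 n) (lexx 0) _ zd.
        by rewrite mul0r expR0 mulr1; apply; rewrite /sg; clear -s1 s2 a1 a2; apply/andP; split; lra.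
      apply: le_trans (dbound_dual_norm p0 HL Hf) _.
      apply: le_trans (ler_wpM2l (dual_norm_ge0 p0 HL) nf) _.
      by rewrite le_eqVlt; apply/orP; left; apply/eqP; ring.
  move=> s sr; have s2r : - eta < Re s < 1 + eta by clear -sr; have /andP[s1 s2] := sr; apply/andP; split; lra.
  have -> : (fun z => hexp s z * z ^+ n.+1) =
     z2 *: (fun z => hexp s z * z ^+ n) + (fun z => hexp s z * ((z - z2) * z ^+ n)).
    apply/funext => z.
    rewrite -[RHS]/(z2 * (hexp s z * z ^+ n) + hexp s z * ((z - z2) * z ^+ n)) exprS; ring.
  rewrite HL.1; [|exact: Hs|exact: Hs2].
  by rewrite IH// mulr0 add0r; exact: g0.
apply: (dual_poly_zero p1 HL) => n; rewrite -[RHS](main n 0); last first.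
  by rewrite /= oppr_lt0 eta0.
by congr L; apply/funext => z; rewrite /hexp mul0r cexp0 mul1r.
Qed.

End Annihilation.

(** * Neumann series for the flow *)

Section GeometricSeries.
Variable R : realType.
Local Notation C := R[i].
Implicit Types (a : nat -> C) (l : C) (M q : R).

Lemma geometric_partial_le M q n : 0 <= M -> 0 <= q < 1 ->
  \sum_(0 <= k < n) M * q ^+ k <= M / (1 - q).
Proof.
move=> M0 /andP[q0 q1]; rewrite -mulr_sumr ler_wpM2l//.
have d0 : 0 < 1 - q by lra.
rewrite -[leRHS]mul1r ler_pdivlMr// mulrC big_mkord -opprB mulNr -subrX1 opprB.
by rewrite gerBl exprn_ge0.
Qed.

Lemma ler_geometric M (x y : R) : 0 <= M -> x <= y -> y < 1 -> M / (1 - x) <= M / (1 - y).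
Proof. by move=> M0 xy y1; rewrite ler_wpM2l// lef_pV2 ?posrE; lra. Qed.

Lemma clim_geometric a M q : 0 <= M -> 0 <= q < 1 -> (forall k, cabs (a k) <= M * q ^+ k) ->
  exists l, clim \oo (fun n => \sum_(0 <= k < n) a k) l.
Proof.
move=> M0 q01 aM; have /andP[q0 q1] := q01.
have H (u : nat -> R) : (forall k, `|u k| <= M * q ^+ k) -> cvgn (series u).
  move=> uM; apply: normed_cvg; apply: (@series_le_cvg _ _ (geometric M q)) => //.
  - by move=> n /=; exact: normr_ge0.
  - by move=> n /=; rewrite mulr_ge0// exprn_ge0.
  - by apply: is_cvg_geometric_series; rewrite ger0_norm.
have S (f : C -> R) (f0 : f 0 = 0) (fD : {morph f : x y / x + y}) n :
    f (\sum_(0 <= k < n) a k) = series (fun k => f (a k)) n.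
  by rewrite /series /=; apply: (big_morph f fD f0).
have hr := H (fun k => Re (a k)) (fun k => le_trans (ler_Re_cabs _) (aM k)).
have hi := H (fun k => Im (a k)) (fun k => le_trans (ler_Im_cabs _) (aM k)).
exists (Complex (limn (series (fun k => Re (a k)))) (limn (series (fun k => Im (a k))))).
apply: clim_ReIm => /=.
- by under eq_fun do rewrite (S _ erefl (@cReD R)); exact: hr.
- by under eq_fun do rewrite (S _ erefl (@cImD R)); exact: hi.
Qed.

Lemma clim_geometric_le a M q l : 0 <= M -> 0 <= q < 1 -> (forall k, cabs (a k) <= M * q ^+ k) ->
  clim \oo (fun n => \sum_(0 <= k < n) a k) l -> cabs l <= M / (1 - q).
Proof.
move=> M0 q01 aM al; apply: (cvgr_to_le (clim_cabs al)); apply: nearW => n.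
apply: le_trans (geometric_partial_le n M0 q01).
by apply: le_trans (cabs_sum _ _ _) _; apply: ler_sum.
Qed.

Lemma clim_succ (f : nat -> C) l : clim \oo f l -> clim \oo (fun n => f n.+1) l.
Proof.
move=> fl e e0; have [N _ H] := fl e e0; exists N => // n /= Nn; apply: H.
exact: leq_trans Nn (leqnSn n).
Qed.

End GeometricSeries.

(** * Resolvents of the adjoint away from the annulus *)

Section FlowResolvent.
Variable R : realType.
Local Notation C := R[i].
Implicit Types (f g : C -> C) (t : R) (z w : C) (L Q : (C -> C) -> C).
Variables z1 z2 : C.
Hypotheses (z1u : cabs z1 = 1) (z2u : cabs z2 = 1) (z12 : z1 != z2).
Local Notation flow := (flow z1 z2).
Variables (p : R) (p0 : 0 < p).
Variables (K : R) (K0 : 0 < K).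
Hypothesis HK : forall t f, Hardy p f ->
  Hardy p (f \o flow t) /\ hardy_norm p (f \o flow t) <= K * expR (`|t| / p) * hardy_norm p f.

Lemma Hardy_flow t f : Hardy p f -> Hardy p (f \o flow t).
Proof. by move=> /(HK t)[]. Qed.

(** The [n]-th iterate is itself a flow map, of time [n t], so [K] appears once instead of as [K^n].
    This is why the series converge up to the exact radius [exp (|t| / p)]. *)
Lemma dual_flow_iter L (c : R) t f n : dbound p L c -> 0 <= c -> Hardy p f ->
  cabs (L (f \o flow (n%:R * t))) <= K * c * hardy_norm p f * expR (`|t| / p) ^+ n.
Proof.
move=> Lc c0 Hf; have [H1 H2] := HK (n%:R * t) Hf.
apply: le_trans (Lc _ H1) _; apply: le_trans (ler_wpM2l c0 H2) _.
have -> : expR (`|n%:R * t| / p) = expR (`|t| / p) ^+ n.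
  by rewrite normrM ger0_norm// -mulrA expRM_natl.
by rewrite le_eqVlt; apply/orP; left; apply/eqP; ring.
Qed.

Lemma flow_succ L t f n : Hardy_dual p L -> Hardy p f ->
  L ((f \o flow t) \o flow (n%:R * t)) = L (f \o flow (n.+1%:R * t)).
Proof.
move=> HL Hf; apply: (dual_eq p0 HL); first exact/Hardy_flow/Hardy_flow.
move=> z zd; rewrite /comp (flowD z1u z2u z12)//; congr (f (flow _ z)).
by rewrite -[in RHS]natr1; ring.
Qed.

Lemma dual_flow0 L t f : Hardy_dual p L -> Hardy p f -> L (f \o flow (0%:R * t)) = L f.
Proof.
move=> HL Hf; apply/esym/(dual_eq p0 HL) => // z zd.
by rewrite /comp mul0r (flow0 z1u z2u z12).
Qed.

(** Iterating the equation gives [L f = zeta^n * L (f o flow (n t))], which decays geometrically. *)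
Lemma neumann_unique L (zeta : C) t : Hardy_dual p L -> cabs zeta * expR (`|t| / p) < 1 ->
  (forall f, Hardy p f -> L f = zeta * L (f \o flow t)) -> forall f, Hardy p f -> L f = 0.
Proof.
move=> HL q1 E f Hf.
have it n : L f = zeta ^+ n * L (f \o flow (n%:R * t)).
  elim: n f Hf => [|n IH] f Hf; first by rewrite expr0 mul1r dual_flow0.
  by rewrite (E f Hf) (IH _ (Hardy_flow t Hf)) (flow_succ t n HL Hf) exprS mulrA.
set q := cabs zeta * expR (`|t| / p) in q1.
have q01 : 0 <= q < 1 by rewrite q1 andbT mulr_ge0 ?cabs_ge0// expR_ge0.
have N0 := dual_norm_ge0 p0 HL.
pose c := K * dual_norm p L * hardy_norm p f.
apply/eqP; rewrite -cabs_eq0 eq_le cabs_ge0 andbT.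
apply: (@le_epsilon0 _ _ c 1) => // e e0 _; have [n qn] := exists_expn_lt q01 e0.
have c0 : 0 <= c by rewrite mulr_ge0 ?hardy_norm_ge0// mulr_ge0// ltW.
apply: le_trans (ler_wpM2l c0 (ltW qn)).
rewrite (it n) cabsM cabsX /q exprMn mulrCA; apply: ler_wpM2l; first by rewrite exprn_ge0// cabs_ge0.
exact: (dual_flow_iter t n (dbound_dual_norm p0 HL) N0 Hf).
Qed.

(** The series [sum_k zeta^k L (f o flow (k t))] is summed pointwise, as numbers for each [f];
    linearity and the functional equation pass to the limit. Where the series has no limit, [xget]
    returns the default 0. *)
Lemma neumann L (c : R) (zeta : C) t : Hardy_dual p L -> 0 <= c -> dbound p L c ->
  cabs zeta * expR (`|t| / p) < 1 ->
  exists N, [/\ Hardy_dual p N, dbound p N (K / (1 - cabs zeta * expR (`|t| / p)) * c) &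
    forall f, Hardy p f -> N f = L f + zeta * N (f \o flow t)].
Proof.
move=> HL c0 Lc q1; set q := cabs zeta * expR (`|t| / p) in q1 *.
have q01 : 0 <= q < 1 by rewrite q1 andbT mulr_ge0 ?cabs_ge0// expR_ge0.
pose a f k := zeta ^+ k * L (f \o flow (k%:R * t)).
have aM f k : Hardy p f -> cabs (a f k) <= K * c * hardy_norm p f * q ^+ k.
  move=> Hf; rewrite cabsM cabsX /q exprMn mulrCA; apply: ler_wpM2l; first by rewrite exprn_ge0// cabs_ge0.
  exact: dual_flow_iter.
have M0 f : 0 <= K * c * hardy_norm p f.
  by rewrite mulr_ge0 ?hardy_norm_ge0// mulr_ge0// ltW.
pose N f := xget 0 [set l | clim \oo (fun n => \sum_(0 <= k < n) a f k) l].
have Ncv f : Hardy p f -> clim \oo (fun n => \sum_(0 <= k < n) a f k) (N f).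
  move=> Hf; have [l hl] := clim_geometric (M0 f) q01 (fun k => aM f k Hf).
  exact: (@xgetPex _ 0 [set l | clim \oo (fun n => \sum_(0 <= k < n) a f k) l] (ex_intro _ l hl)).
have Nb : dbound p N (K / (1 - q) * c).
  move=> f Hf; apply: le_trans (clim_geometric_le (M0 f) q01 (fun k => aM f k Hf) (Ncv f Hf)) _.
  by rewrite le_eqVlt; apply/orP; left; apply/eqP; ring.
exists N; split; [split; last by exists (K / (1 - q) * c)|exact: Nb|].
- move=> b f g Hf Hg; have Hfg := Hardy_lin b p0 Hf Hg.
  apply: (clim_unique (Ncv _ Hfg)).
  have H : clim \oo (fun n => b * \sum_(0 <= k < n) a f k + \sum_(0 <= k < n) a g k) (b * N f + N g).
    by apply: climD (Ncv _ Hg); apply: climM (Ncv _ Hf); exact: clim_cst.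
  apply: clim_near H; apply: nearW => n /=; rewrite mulr_sumr -big_split /=.
  apply: eq_bigr => k _; rewrite /a.
  rewrite -[(b *: f + g) \o _]/(b *: (f \o flow (k%:R * t)) + (g \o flow (k%:R * t))).
  rewrite HL.1; [ring|exact: Hardy_flow|exact: Hardy_flow].
- move=> f Hf; have Hft := Hardy_flow t Hf.
  apply: (clim_unique (clim_succ (Ncv f Hf))).
  have H : clim \oo (fun n => L f + zeta * \sum_(0 <= k < n) a (f \o flow t) k)
      (L f + zeta * N (f \o flow t)).
    by apply: climD; [exact: clim_cst|apply: climM (Ncv _ Hft); exact: clim_cst].
  apply: clim_near H; apply: nearW => n /=.
  rewrite big_nat_recl// mulr_sumr; congr (_ + _); first by rewrite /a expr0 mul1r (dual_flow0 t HL Hf).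
  by apply: eq_bigr => k _; rewrite /a (flow_succ t k HL Hf) exprS mulrA.
Qed.

Variable tau : R.
Local Notation rho := (expR (`|tau| / p)).

(** Solvability with a bound, and uniqueness, of the equation [(adjoint - w) Q = L]. The constant
    [c] is meant to be uniform in [w] over an open set, which gives differentiability of the
    resolvent. *)
Definition resolvent_bounded (c : R) w :=
  (forall L b, Hardy_dual p L -> 0 <= b -> dbound p L b -> exists Q, [/\ Hardy_dual p Q,
     dbound p Q (c * b) & forall f, Hardy p f -> Q (f \o flow tau) - w * Q f = L f]) /\
  (forall Q, Hardy_dual p Q -> (forall f, Hardy p f -> Q (f \o flow tau) = w * Q f) ->
     forall f, Hardy p f -> Q f = 0).

Lemma dbound_le L (b c : R) : dbound p L b -> b <= c -> dbound p L c.
Proof.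
move=> Lb bc f Hf; apply: le_trans (Lb f Hf) _.
by apply: ler_wpM2r bc; exact: hardy_norm_ge0.
Qed.

Lemma Hardy_dualZ (c : C) L : Hardy_dual p L -> Hardy_dual p (c *: L).
Proof.
move=> HL; rewrite -[c *: L]addr0; apply: (Hardy_dual_lin c p0 HL).
by split=> [*|]; [rewrite -[LHS]/(0 : C) -[RHS]/(_ * 0 + 0) mulr0 addr0|exists 0 => f _; rewrite cabs0 mul0r].
Qed.

Lemma dboundZ (c : C) L (b : R) : dbound p L b -> dbound p (c *: L) (cabs c * b).
Proof.
move=> Lb f Hf; rewrite -[(c *: L) f]/(c * L f) cabsM -mulrA.
by apply: ler_wpM2l; [exact: cabs_ge0|exact: Lb].
Qed.

Lemma resolvent_outside (r : R) : rho < r ->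
  exists2 c : R, 0 <= c & forall w, r < cabs w -> resolvent_bounded c w.
Proof.
move=> rr; have rho0 : 0 < rho by exact: expR_gt0.
have r0 : 0 < r by exact: lt_trans rr.
have d0 : 0 < 1 - rho / r by rewrite subr_gt0 ltr_pdivrMr// mul1r.
exists (r^-1 * (K / (1 - rho / r))).
  by rewrite mulr_ge0 ?invr_ge0 ?(ltW r0)// divr_ge0 ?(ltW K0) ?(ltW d0).
move=> w rw; have w0 : 0 < cabs w by exact: lt_trans rw.
have wn : w != 0 by rewrite -cabs_gt0.
have zr : cabs w^-1 * rho <= rho / r.
  by rewrite cabsV mulrC ler_pM2l// lef_pV2 ?posrE// ltW.
have q1 : cabs w^-1 * rho < 1 by apply: le_lt_trans zr _; rewrite -subr_gt0.
have q2 : (cabs w)^-1 * rho < 1 by rewrite -cabsV.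
split=> [L b HL b0 Lb|Q HQ E].
- have [N [HN Nb NE]] := neumann HL b0 Lb q1.
  exists (- w^-1 *: N); split; first exact: Hardy_dualZ.
    apply: (dbound_le (dboundZ _ Nb)); rewrite cabsN cabsV mulrA ler_wpM2r//.
    apply: ler_pM; rewrite ?invr_ge0 ?(ltW w0)//.
    - by rewrite divr_ge0 ?(ltW K0)// subr_ge0 (ltW q2).
    - by rewrite lef_pV2 ?posrE// ltW.
    - apply: ler_geometric; [exact: ltW|by rewrite -cabsV|by rewrite -subr_gt0].
  move=> f Hf; rewrite -[(_ *: N) (f \o _)]/(- w^-1 * N (f \o flow tau)).
  rewrite -[(_ *: N) f]/(- w^-1 * N f) (NE f Hf); field; exact: wn.
- apply: (neumann_unique HQ q1) => f Hf; rewrite (E f Hf) mulrA mulVf// mul1r; reflexivity.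
Qed.

(** Composition with the inverse map [flow (- tau)] turns the equation into [Q f = L (f o flow (-
    tau)) + w * Q (f o flow (- tau))], a Neumann series in [w]. For [r <= 0] there is no such
    [w]. *)
Lemma resolvent_inside (r : R) : r < rho^-1 ->
  exists2 c : R, 0 <= c & forall w, cabs w < r -> resolvent_bounded c w.
Proof.
move=> rr; have rho0 : 0 < rho by exact: expR_gt0.
have [r0|r0] := leP r 0.
  by exists 0 => // w wr; have := lt_le_trans wr r0; rewrite ltNge cabs_ge0.
have d0 : 0 < 1 - r * rho by rewrite subr_gt0 -ltr_pdivlMr// mul1r.
exists (K / (1 - r * rho) * (K * rho)).
  by rewrite !mulr_ge0 ?(ltW K0) ?(ltW rho0)// invr_ge0 ltW.
move=> w wr.
have zr : cabs w * expR (`|- tau| / p) <= r * rho by rewrite normrN ler_pM2r// ltW.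
have q1 : cabs w * expR (`|- tau| / p) < 1 by apply: le_lt_trans zr _; rewrite -subr_gt0.
have flowNK f : Hardy p f -> forall L, Hardy_dual p L -> L ((f \o flow tau) \o flow (- tau)) = L f.
  move=> Hf L HL; apply/esym/(dual_eq p0 HL) => // z zd.
  by rewrite /comp (flowD z1u z2u z12)// subrr (flow0 z1u z2u z12).
have flowKN f : Hardy p f -> forall L, Hardy_dual p L -> L ((f \o flow (- tau)) \o flow tau) = L f.
  move=> Hf L HL; apply/esym/(dual_eq p0 HL) => // z zd.
  by rewrite /comp (flowD z1u z2u z12)// addNr (flow0 z1u z2u z12).
split=> [L b HL b0 Lb|Q HQ E].
- pose L' f := L (f \o flow (- tau)).
  have b'0 : 0 <= K * rho * b by rewrite !mulr_ge0 ?(ltW K0) ?(ltW rho0).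
  have L'b : dbound p L' (K * rho * b).
    move=> f Hf; have [h1 h2] := HK (- tau) Hf; apply: le_trans (Lb _ h1) _.
    apply: le_trans (ler_wpM2l b0 h2) _; rewrite normrN.
    by rewrite le_eqVlt; apply/orP; left; apply/eqP; ring.
  have HL' : Hardy_dual p L'.
    split; last by exists (K * rho * b).
    move=> a f g Hf Hg; rewrite /L'.
    rewrite -[(a *: f + g) \o _]/(a *: (f \o flow (- tau)) + (g \o flow (- tau))).
    exact: (HL.1 a _ _ (Hardy_flow _ Hf) (Hardy_flow _ Hg)).
  have [N [HN Nb NE]] := neumann HL' b'0 L'b q1.
  exists N; split; first exact: HN.
    apply: (dbound_le Nb); rewrite (mulrA _ _ b) ler_wpM2r//; apply: ler_wpM2r.
      by rewrite mulr_ge0 ?(ltW K0) ?(ltW rho0).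
    by apply: ler_geometric; [exact: ltW|exact: zr|rewrite -subr_gt0].
  move=> f Hf; have Hft := Hardy_flow tau Hf.
  by rewrite (NE _ Hft) (flowNK f Hf N HN) /L' (flowNK f Hf L HL) addrK.
- apply: (neumann_unique HQ q1) => f Hf.
  by rewrite -(E _ (Hardy_flow _ Hf)) (flowKN f Hf Q HQ).
Qed.

(** If [S] solves the equation for [L], then [Q - h S] solves the homogeneous one, hence vanishes,
    and [Q] inherits the bound of [h S]. *)
Lemma dual_norm_sub_resolvent (c : R) w L Q (h : C) b : 0 <= c -> 0 <= b ->
  resolvent_bounded c w -> Hardy_dual p L -> dbound p L b -> Hardy_dual p Q ->
  (forall f, Hardy p f -> Q (f \o flow tau) - w * Q f = h * L f) ->
  dbound p Q (cabs h * (c * b)).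
Proof.
move=> c0 b0 [ex un] HL Lb HQ E; have [S [HS Sb SE]] := ex L b HL b0 Lb.
have HD : Hardy_dual p ((- h) *: S + Q) by exact: (Hardy_dual_lin (- h) p0 HS HQ).
have Z : forall f, Hardy p f -> ((- h) *: S + Q) f = 0.
  apply: (un _ HD) => f Hf.
  rewrite -[LHS]/(- h * S (f \o flow tau) + Q (f \o flow tau)) -[X in w * X]/(- h * S f + Q f).
  have := E f Hf; rewrite -(SE f Hf) => /eqP; rewrite subr_eq => /eqP ->; ring.
move=> f Hf; have := Z f Hf; rewrite -[LHS]/(- h * S f + Q f) => /eqP.
rewrite addrC mulNr subr_eq0 => /eqP ->; rewrite cabsM -mulrA.
by apply: ler_wpM2l; [exact: cabs_ge0|exact: Sb].
Qed.

End FlowResolvent.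

(** * Local spectra *)

Section LocalSpectra.
Variable R : realType.
Local Notation C := R[i].
Implicit Types (f g : C -> C) (t : R) (z w h : C) (L Q : (C -> C) -> C).
Variables z1 z2 : C.
Hypotheses (z1u : cabs z1 = 1) (z2u : cabs z2 = 1) (z12 : z1 != z2).
Local Notation flow := (flow z1 z2).
Local Notation ell := (hlog z1 z2).
Local Notation hexp := (hexp z1 z2).
Variables (tau : R) (tau0 : tau != 0) (phi : C -> C).
Hypothesis phiE : forall z, cabs z < 1 -> phi z = flow tau z.

Lemma hexp_phi s z : cabs z < 1 -> hexp s (phi z) = cexp (s * tau%:C%C) * hexp s z.
Proof.
move=> zd; rewrite -[LHS]/(cexp (s * ell (phi z))) -[X in _ = _ * X]/(cexp (s * ell z)) phiE//.
by rewrite (hlog_flow z1u z2u z12)// mulrDr cexpD mulrC.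
Qed.

Lemma Hardy_dualB p L Q : 0 < p -> Hardy_dual p L -> Hardy_dual p Q -> Hardy_dual p (L - Q).
Proof. by move=> p0 HL HQ; have := Hardy_dual_lin (-1) p0 HQ HL; rewrite scaleN1r addrC; exact. Qed.

Lemma hexp_taylor p s : 0 < p -> `|Re s| < p^-1 ->
  [/\ Hardy p (hexp s), Hardy p (fun z => ell z * hexp s z) &
    exists d M : R, [/\ 0 < d, 0 <= M & forall h, cabs h <= d ->
      Hardy p (fun z => hexp (s + h) z - hexp s z - h * (ell z * hexp s z)) /\
      hardy_norm p (fun z => hexp (s + h) z - hexp s z - h * (ell z * hexp s z)) <= M * cabs h ^+ 2]].
Proof.
move=> p0 sp; have [kap kp kI] := hlog_Im z1 z2; have n0 := normr_ge0 (Re s).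
pose sg := (`|Re s| + p^-1) / 2; pose d := (p^-1 - `|Re s|) / 2.
have sg0 : 0 < sg by rewrite /sg; lra.
have sgp : sg * p < 1 by rewrite -ltr_pdivlMr// div1r /sg; lra.
have d0 : 0 < d by rewrite /d; lra.
have A0 : 0 <= 1 * expR (kap * `|Im s|) by rewrite mulr_ge0// expR_ge0.
have a1 : analytic_on (@disc R) (fun=> 1 : C) by move=> z _; exact: cder_cdiff (cder_cst 1 z).
have bd z : cabs z < 1 -> cabs (hexp s z * 1) * expR (d * `|Re (ell z)|) <=
    1 * expR (kap * `|Im s|) * emaj z1 z2 sg z.
  move=> zd; apply: (@hexp_bounded _ _ _ (fun=> 1) 1 kap) => //.
  - by move=> *; rewrite cabs1.
  - exact: ltW.
  - by rewrite /d /sg; lra.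
have E1 u : (fun z => hexp u z * 1) = hexp u by apply/funext => z; rewrite mulr1.
have E2 : (fun z => ell z * (hexp s z * 1)) = (fun z => ell z * hexp s z).
  by apply/funext => z; rewrite mulr1.
have [H1 H2 [M M0 HM]] := hexp_expansion z1u z2u z12 p0 sg0 sgp d0 A0 a1 bd.
rewrite E1 in H1; rewrite E2 in H2; split; [exact: H1|exact: H2|].
exists (d / 2), M; split; [by rewrite divr_gt0|exact: M0|].
move=> h hd; have := HM h hd.
have -> : (fun z => hexp (s + h) z * 1 - hexp s z * 1 - h * (ell z * (hexp s z * 1))) =
  (fun z => hexp (s + h) z - hexp s z - h * (ell z * hexp s z)) by apply/funext => z; rewrite !mulr1.
exact.
Qed.

(* [mu |-> exp (log mu / tau * ell)] is an analytic family of eigenfunctions near [mu = 1]. *)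
Lemma comp_flow_not_SVEP p : 1 <= p -> ~ SVEP (Hardy p) (@hardy_norm R p) (comp_op phi).
Proof.
move=> p1 sv; have p0 : 0 < p by lra.
have [kap _ kI] := hlog_Im z1 z2.
have pV0 : 0 < p^-1 by rewrite invr_gt0.
have tn : 0 < `|tau| by rewrite normr_gt0.
pose sm mu : C := clog mu / tau%:C%C.
have R1 : 0 < Re (1 : C) by [].
have cl1 : clog (1 : C) = 0.
  by rewrite /clog cabs1 ln1 /= mul0r atan0.
have [d d0 hd] := ccts_clog R1 (mulr_gt0 tn pV0).
(* The bound 1 keeps [mu] in the right half-plane, where [clog] inverts [cexp]; [d] keeps
   [|clog mu| < |tau| / p], so that the exponent stays in the strip. *)
pose r := Num.min d 1; have r0 : 0 < r by rewrite lt_min d0 ltr01.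
pose U : set C := [set mu | cabs (mu - 1) < r].
have oU : copen U.
  move=> mu Um; exists (r - cabs (mu - 1)); first by rewrite subr_gt0.
  move=> w wm; rewrite /U /=; have -> : w - 1 = (w - mu) + (mu - 1) by ring.
  by apply: le_lt_trans (cabsD _ _) _; rewrite -ltrBrDr.
have ReU mu : U mu -> 0 < Re mu.
  rewrite /U /= lt_min => /andP[_ h]; have := le_lt_trans (ler_Re_cabs _) h.
  by rewrite ltr_norml cReD cReN /= => /andP[]; lra.
have tC : tau%:C%C != 0 :> C by rewrite -cabs_gt0 cabs_real.
have smU mu : U mu -> `|Re (sm mu)| < p^-1.
  rewrite /U /= lt_min => /andP[h _]; have := hd _ h; rewrite cl1 subr0 => h2.
  have h3 := ler_Re_cabs (sm mu); apply: le_lt_trans h3 _; rewrite /sm cabsM cabsV cabs_real.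
  by rewrite ltr_pdivrMr// mulrC.
have U1 : U 1 by change (cabs (1 - 1 : C) < r); rewrite subrr cabs0.
(* Evaluation at 0 is bounded by the norm and [hexp] never vanishes, so norm 0 at [mu = 1] is
   absurd. *)
suff H : forall mu, U mu -> hardy_norm p (hexp (sm mu)) = 0.
  have [H1 _ _] := hexp_taylor p0 (smU 1 U1).
  have := cabs0_le_hardy_norm p0 H1; rewrite (H 1 U1).
  by apply/negP; rewrite -ltNge cabs_gt0 cexp_neq0.
apply: (sv U (fun mu => hexp (sm mu)) oU).
- by move=> mu Um; have [] := hexp_taylor p0 (smU mu Um).
- move=> mu Um; have [H1 H2 [d1 [M [d10 M0 HM]]]] := hexp_taylor p0 (smU mu Um).
  set s := sm mu in H1 H2 HM; set H := fun z => ell z * hexp s z in H2.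
  exists ((tau%:C%C * mu)^-1 *: H); first exact: HardyZ.
  move=> e e0; have m0 := ReU mu Um.
  have mn : mu != 0 by apply: contraTneq m0 => ->; rewrite ltxx.
  pose N := hardy_norm p H; have N0 : 0 <= N by exact: hardy_norm_ge0.
  pose Q : R := 2 * 2 `^ p^-1; have Q0 : 0 < Q by rewrite mulr_gt0// powR_gt0.
  have ch : cder sm mu (tau%:C%C * mu)^-1.
    have := cderZ tau%:C%C^-1 (cder_clog m0); rewrite -invfM.
    by congr cder; apply/funext => u; rewrite mulrC.
  (* Half of [e] is spent on the linear error of the change of parameter [sm], half on the quadratic
     remainder of [hexp]; [Q] is the quasi-triangle constant. *)
  pose e' : R := e / (2 * Q * (N + 1)); have N1 : 0 < N + 1 by lra.
  have e'0 : 0 < e' by rewrite divr_gt0// !mulr_gt0.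
  have [d2 d20 H3] := (cderP _ _ _).1 ch e' e'0.
  pose c : R := e' + cabs (tau%:C%C * mu)^-1.
  have c0 : 0 < c by rewrite ltr_pwDl// cabs_ge0.
  have Mc : 0 < 2 * Q * (M * c ^+ 2 + 1).
    by rewrite !mulr_gt0// ltr_wpDl// mulr_ge0// exprn_ge0// ltW.
  exists (Num.min d2 (Num.min (d1 / c) (e / (2 * Q * (M * c ^+ 2 + 1))))).
    by rewrite !lt_min d20 !divr_gt0.
  move=> h; rewrite !lt_min => /and3P[h2 h1 he] _.
  have k2 := H3 h h2; set k := sm (mu + h) - sm mu in k2.
  have kc : cabs k <= c * cabs h.
    have -> : k = (k - (tau%:C%C * mu)^-1 * h) + (tau%:C%C * mu)^-1 * h by rewrite subrK.
    apply: le_trans (cabsD _ _) _; rewrite /c mulrDl cabsM lerD2r; exact: k2.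
  have kd : cabs k <= d1 by apply: le_trans kc _; rewrite mulrC -ler_pdivlMr// ltW.
  have [H4 H5] := HM k kd; set rem := (fun z => _) in H4 H5.
  have -> : hexp (sm (mu + h)) - hexp (sm mu) - h *: ((tau%:C%C * mu)^-1 *: H) =
      rem + (k - (tau%:C%C * mu)^-1 * h) *: H.
    have -> : sm (mu + h) = s + k by rewrite /k /s; ring.
    apply/funext => z.
    rewrite -[LHS]/(hexp (s + k) z - hexp s z - h * ((tau%:C%C * mu)^-1 * H z)).
    rewrite -[RHS]/(hexp (s + k) z - hexp s z - k * (ell z * hexp s z) + (k - (tau%:C%C * mu)^-1 * h) * H z).
    rewrite /H; ring.
  have H6 := HardyZ (k - (tau%:C%C * mu)^-1 * h) p0 H2.
  apply: le_trans (hardy_normD_le p0 H4 H6) _; rewrite -/Q.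
  apply: (@le_trans _ _ (Q * (M * (c * cabs h) ^+ 2 + e' * cabs h * N))).
    apply: ler_wpM2l; first exact: ltW.
    apply: lerD.
      apply: le_trans H5 _; apply: ler_wpM2l => //.
      by rewrite lerXn2r ?nnegrE ?cabs_ge0// mulr_ge0 ?cabs_ge0// ltW.
    apply: le_trans (hardy_normZ_le _ p0 H2) _.
    by apply: ler_wpM2r k2.
  have hh := cabs_ge0 h; move: he; rewrite ltr_pdivlMr// => he.
  have h7 : Q * (e' * cabs h * N) <= e / 2 * cabs h.
    have -> : e / 2 = Q * e' * (N + 1) by rewrite /e'; field; rewrite !gt_eqF.
    have -> : Q * (e' * cabs h * N) = Q * e' * N * cabs h by ring.
    apply: ler_wpM2r => //; apply: ler_wpM2l; last by rewrite lerDl.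
    by rewrite mulr_ge0// ltW.
  have h8 : Q * (M * (c * cabs h) ^+ 2) <= e / 2 * cabs h.
    have -> : Q * (M * (c * cabs h) ^+ 2) = Q * (M * c ^+ 2) * cabs h * cabs h by ring.
    apply: ler_wpM2r => //; have := mulr_ge0 (ltW Q0) hh; nra.
  by rewrite mulrDr; lra.
- move=> mu Um; apply: (hardy_norm_eq0 p0) => z zd.
  rewrite -[LHS]/(hexp (sm mu) (phi z) - mu * hexp (sm mu) z) hexp_phi//.
  by rewrite /sm divfK// cexp_clog ?subrr//; exact: ReU.
Qed.

(** At most three multiplications by [i] rotate a nonzero [w] into the right half-plane, where
    [clog] applies. *)
Lemma exists_clog w : w != 0 -> exists l, cexp l = w.
Proof.
move=> w0; pose i : C := Complex 0 1.
have ci : cexp (Complex 0 (pi / 2)) = i by rewrite cexpi /expi cos_pihalf sin_pihalf.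
have step u : (exists l, cexp l = i * u) -> exists l, cexp l = u.
  move=> [l hl]; exists (l - Complex 0 (pi / 2)).
  have i0 : i != 0 by rewrite -ci cexp_neq0.
  by rewrite cexpD cexpN hl ci mulrC mulKf.
have pos u : 0 < Re u -> exists l, cexp l = u by move=> u0; exists (clog u); exact: cexp_clog.
have iRe u : Re (i * u) = - Im u by rewrite cReM /=; ring.
have iIm u : Im (i * u) = Re u by rewrite cImM /=; ring.
case: (ltrgtP (Re w) 0) => [n|/pos //|z0].
  by apply/step/step/pos; rewrite iRe iIm oppr_gt0.
case: (ltrgtP (Im w) 0) => [n|n|y0].
- by apply/step/pos; rewrite iRe oppr_gt0.
- by apply/step/step/step/pos; rewrite iRe iIm iRe opprK.
- by move: w0; have -> : w = 0; [apply: complexP; [exact: z0|exact: y0]|rewrite eqxx].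
Qed.

Section Adjoint.
Variables (p : R) (p1 : 1 < p) (K : R) (K0 : 0 < K).
Hypothesis HK : forall t f, Hardy p f ->
  Hardy p (f \o flow t) /\ hardy_norm p (f \o flow t) <= K * expR (`|t| / p) * hardy_norm p f.
Let p0 : 0 < p. Proof. exact: lt_trans ltr01 p1. Qed.
Local Notation T := (adjoint (comp_op phi)).

Lemma adjointE L f : Hardy_dual p L -> Hardy p f -> T L f = L (f \o flow tau).
Proof.
move=> HL Hf; apply/esym/(dual_eq p0 HL); first exact: (HK tau Hf).1.
by move=> z zd; rewrite -[RHS]/(f (phi z)) phiE.
Qed.

Lemma Hardy_dual_adjoint L : Hardy_dual p L -> Hardy_dual p (T L).
Proof.
move=> HL; split.
  move=> a f g Hf Hg; have Hfg := Hardy_lin a p0 Hf Hg.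
  rewrite !adjointE//.
  exact: (HL.1 a _ _ (HK tau Hf).1 (HK tau Hg).1).
exists (dual_norm p L * (K * expR (`|tau| / p))) => f Hf; rewrite adjointE//.
have [h1 h2] := HK tau Hf; apply: le_trans (dbound_dual_norm p0 HL h1) _.
rewrite -mulrA; apply: ler_wpM2l h2; exact: dual_norm_ge0.
Qed.

(** The solutions [F w] form an analytic family: [F (w + h) - F w] solves the equation with
    right-hand side [h F (w + h)], and the derivative [G] solves it with right-hand side [F w]. Two
    uses of [dual_norm_sub_resolvent] make the remainder of order [c^3 |h|^2]. *)
Lemma resolvent_local (U : set C) (c : R) L z : copen U -> 0 <= c ->
  (forall w, U w -> resolvent_bounded z1 z2 p tau c w) -> Hardy_dual p L -> U z ->
  local_resolvent (Hardy_dual p) (@dual_norm R p) T L z.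
Proof.
move=> oU c0 res HL Uz; set b := dual_norm p L.
have b0 : 0 <= b by exact: dual_norm_ge0.
have Lb : dbound p L b by exact: dbound_dual_norm.
pose good w Q := [/\ Hardy_dual p Q, dbound p Q (c * b) &
  forall f, Hardy p f -> Q (f \o flow tau) - w * Q f = L f].
pose F w := xget 0 (good w).
have FP w : U w -> good w (F w).
  by move=> Uw; have [Q hQ] := (res w Uw).1 L b HL b0 Lb; exact: (xgetPex 0 (ex_intro _ Q hQ)).
exists U, F; split; [exact: oU|exact: Uz| | |].
- by move=> w /FP[].
- move=> w Uw; have [H1 H2 H3] := FP w Uw; have cb0 : 0 <= c * b by exact: mulr_ge0.
  have [G [HG Gb GE]] := (res w Uw).1 (F w) _ H1 cb0 H2; exists G; first exact: HG.
  move=> e e0; pose B := c * (c * (c * b)).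
  have B0 : 0 <= B by rewrite !mulr_ge0.
  have B1 : 0 < B + 1 by lra.
  exists (e / (B + 1)); first exact: divr_gt0.
  move=> h; rewrite ltr_pdivlMr// => he Uwh; have [J1 J2 J3] := FP _ Uwh.
  have HD : Hardy_dual p (F (w + h) - F w).
    exact: Hardy_dualB.
  have Db : dbound p (F (w + h) - F w) (cabs h * (c * (c * b))).
    apply: (@dual_norm_sub_resolvent _ z1 z2 p p0 tau c w (F (w + h)) _ h (c * b)) => //.
      exact: res.
    move=> f Hf; rewrite -[X in X - _]/(F (w + h) (f \o flow tau) - F w (f \o flow tau)).
    rewrite -[X in w * X]/(F (w + h) f - F w f).
    have := J3 f Hf; rewrite -(H3 f Hf) => /eqP; rewrite subr_eq => /eqP ->; ring.
  have HD2 : Hardy_dual p (F (w + h) - F w - h *: G).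
    exact: (Hardy_dualB p0 HD (Hardy_dualZ p0 h HG)).
  have hb0 : 0 <= cabs h * (c * (c * b)) by rewrite mulr_ge0 ?cabs_ge0// mulr_ge0.
  have := @dual_norm_sub_resolvent _ z1 z2 p p0 tau c w (F (w + h) - F w)
    (F (w + h) - F w - h *: G) h _ c0 hb0 (res w Uw) HD Db HD2.
  move=> D2; apply: le_trans (dual_norm_le p0 _ (D2 _)) _.
  + by rewrite mulr_ge0 ?cabs_ge0// mulr_ge0.
  + move=> f Hf.
    rewrite -[X in X - _]/(F (w + h) (f \o flow tau) - F w (f \o flow tau) - h * G (f \o flow tau)).
    rewrite -[X in w * X]/(F (w + h) f - F w f - h * G f).
    rewrite -[X in _ = h * X]/(F (w + h) f - F w f).
    have := J3 f Hf; rewrite -(H3 f Hf) => /eqP; rewrite subr_eq => /eqP ->.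
    have := GE f Hf => /eqP; rewrite subr_eq => /eqP ->; ring.
  + have -> : cabs h * (c * (cabs h * (c * (c * b)))) = cabs h * B * cabs h by rewrite /B; ring.
    apply: ler_wpM2r; first exact: cabs_ge0.
    by apply: le_trans (ltW he); apply: ler_wpM2l; [exact: cabs_ge0|rewrite lerDl].
- move=> w Uw; have [H1 H2 H3] := FP w Uw.
  have HT := Hardy_dual_adjoint H1.
  have HD : Hardy_dual p (T (F w) - w *: F w - L).
    exact: (Hardy_dualB p0 (Hardy_dualB p0 HT (Hardy_dualZ p0 w H1)) HL).
  apply/(dual_norm0 p0 HD) => f Hf.
  rewrite -[LHS]/(T (F w) f - w * F w f - L f) adjointE// H3// subrr //.
Qed.

(** Evaluate [(T - mu) F mu = L] at the eigenfunction [hexp s] with [mu = exp (s tau)]: the left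
    side vanishes, so [L (hexp s) = 0] for all [s] near [s0 = log w / tau]. The annulus condition on
    [w] is [|Re s0| < 1/p]. *)
Lemma local_resolvent_kill L w : Hardy_dual p L ->
  expR (- (`|tau| / p)) < cabs w < expR (`|tau| / p) ->
  local_resolvent (Hardy_dual p) (@dual_norm R p) T L w -> forall f, Hardy p f -> L f = 0.
Proof.
move=> HL wr [U [F [oU Uw HF _ FE]]].
have w0 : w != 0 by rewrite -cabs_gt0; case/andP: wr => h _; apply: lt_trans h; exact: expR_gt0.
have [l hl] := exists_clog w0.
have tC : tau%:C%C != 0 :> C by rewrite -cabs_gt0 cabs_real normr_gt0.
have tn : 0 < `|tau| by rewrite normr_gt0.
pose s0 := l / tau%:C%C.
have l0 : l = tau%:C%C * s0 by rewrite /s0 mulrC divfK.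
have s0r : `|Re s0| < p^-1.
  move: wr; rewrite -hl cabs_cexp !ltr_expR -ltr_norml l0 cReZ normrM.
  by rewrite ltr_pM2l.
have cc : ccts (fun s => cexp (s * tau%:C%C)) s0.
  have d1 : cder (fun s => s * tau%:C%C) s0 tau%:C%C.
    have := cder_affine tau%:C%C 0 s0; congr cder; apply/funext => u; ring.
  exact: cder_ccts (cder_comp d1 (cder_cexp _)).
have [e e0 Ue] := oU w Uw; have [d d0 hd] := cc e e0.
pose d' := Num.min d (p^-1 - `|Re s0|).
have d'0 : 0 < d' by rewrite lt_min d0 subr_gt0.
have s0r' : - p^-1 < Re s0 < p^-1 by rewrite -ltr_norml.
apply: (dual_hexp_kill z1u z2u z12 p1 HL s0r' d'0) => s; rewrite lt_min => /andP[sd sp].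
have Ums : U (cexp (s * tau%:C%C)).
  by apply: Ue; have := hd s sd; rewrite (mulrC s0) -l0 hl.
have sp' : `|Re s| < p^-1.
  have := le_lt_trans (ler_Re_cabs _) sp; rewrite cReD cReN.
  have := ler_normD (Re s - Re s0) (Re s0); rewrite subrK; lra.
have [Hs _ _] := hexp_taylor p0 sp'.
set mu := cexp _ in Ums; have HFm := HF mu Ums.
have HT := Hardy_dual_adjoint HFm.
have HD : Hardy_dual p (T (F mu) - mu *: F mu - L).
  exact: (Hardy_dualB p0 (Hardy_dualB p0 HT (Hardy_dualZ p0 mu HFm)) HL).
have := (dual_norm0 p0 HD).1 (FE mu Ums) _ Hs.
rewrite -[LHS]/(T (F mu) (hexp s) - mu * F mu (hexp s) - L (hexp s)).
have -> : T (F mu) (hexp s) = mu * F mu (hexp s).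
  rewrite -(dualZ p0 HFm mu Hs); apply/esym/(dual_eq p0 HFm); first exact: HardyZ.
  by move=> z zd; rewrite -[RHS]/(hexp s (phi z)) hexp_phi.
by rewrite subrr sub0r => /eqP; rewrite oppr_eq0 => /eqP.
Qed.

Lemma copen_cabs_gt (r : R) : copen [set z : C | r < cabs z].
Proof.
move=> z /= rz; exists (cabs z - r); first by rewrite subr_gt0.
by move=> w wz /=; have := ler_cabs_sub z w; rewrite cabsBC; lra.
Qed.

Lemma copen_cabs_lt (r : R) : copen [set z : C | cabs z < r].
Proof.
move=> z /= rz; exists (r - cabs z); first by rewrite subr_gt0.
by move=> w wz /=; have := ler_cabs_sub w z; lra.
Qed.

Lemma adjoint_property_C : property_C (Hardy_dual p) (@dual_norm R p) T.
Proof.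
move=> F cF x Hx app.
set E := expR (`|tau| / p).
have tn : 0 < `|tau| by rewrite normr_gt0.
have E1 : 1 < E by rewrite expR_gt1 divr_gt0.
have EV : expR (- (`|tau| / p)) = E^-1 by rewrite expRN.
have EV1 : E^-1 < 1 by rewrite invf_lt1//; lra.
split=> //.
(* If [F] misses a point of the open annulus, all approximants are zero, hence so is [x], and its
   local spectrum is empty with the zero function as witness. *)
have [[w [wF wr]]|no] := pselect (exists w, ~ F w /\ E^-1 < cabs w < E).
  have x0 f : Hardy p f -> x f = 0.
    move=> Hf; apply/eqP; rewrite -cabs_eq0 eq_le cabs_ge0 andbT.
    apply: (@le_epsilon0 _ _ (hardy_norm p f) 1) => // e e0 _.
    have [y [Hy sy] xy] := app e e0.
    have yf : y f = 0.
      apply: (local_resolvent_kill Hy _ _ Hf (w := w)); first by rewrite EV.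
      by apply: contrapT => ny; apply/wF/sy.
    have HD : Hardy_dual p (x - y).
      exact: Hardy_dualB.
    have := dbound_dual_norm p0 HD Hf; rewrite -[(x - y) f]/(x f - y f) yf subr0 => h.
    apply: le_trans h _; rewrite mulrC; apply: ler_wpM2l (ltW xy); exact: hardy_norm_ge0.
  move=> z nz; exfalso; apply: nz.
  have H0 : Hardy_dual p (0 : (C -> C) -> C).
    split; last by exists 0 => f _; rewrite cabs0 mul0r.
    by move=> a f g _ _; rewrite -[LHS]/(0 : C) -[RHS]/(a * 0 + 0) mulr0 addr0.
  exists setT, (fun=> 0); split => //.
  - by move=> u _; exists 1.
  - move=> u _; exists 0 => // e e0; exists 1 => // h _ _.
    rewrite scaler0 !subr0; apply: le_trans (_ : 0 <= _); last by rewrite mulr_ge0 ?cabs_ge0// ltW.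
    by apply: dual_norm_le => // f _; rewrite cabs0 mul0r.
  - move=> u _; have HT := Hardy_dual_adjoint H0.
    have HD : Hardy_dual p (T 0 - u *: 0 - x).
      by rewrite scaler0 subr0; exact: Hardy_dualB.
    apply/(dual_norm0 p0 HD) => f Hf.
    by rewrite -[LHS]/(0 - u * 0 - x f) x0// mulr0 !subr0.
have inF w : E^-1 < cabs w < E -> F w.
  by move=> wr; apply: contrapT => nF; apply: no; exists w.
move=> z nz; apply: contrapT => zF; apply: nz.
have [e e0 he] := cF z zF.
(* [F] contains the open annulus and is closed, hence contains the closed one: a [z] in the latter
   is moved into the open annulus by a real factor [lam] near 1, pushing it towards the unit
   circle. *)
have [zo|zi] : E < cabs z \/ cabs z < E^-1.
  apply: contrapT => /not_orP[/negP]; rewrite -leNgt => z1' /negP; rewrite -leNgt => z2'.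
  have z0 : 0 < cabs z by apply: lt_le_trans z2'; rewrite invr_gt0; lra.
  (* The second term keeps [lam z] within [e] of [z], the first keeps [lam] positive; the minimum
     with [(E - 1) / 2] or [(1 - E^-1) / 2] below prevents overshooting. *)
  pose x1 : R := Num.min (1 / 2) (e / (2 * cabs z)).
  have x10 : 0 < x1 by rewrite lt_min !divr_gt0// mulr_gt0.
  have key (lam : R) : 0 < lam -> `|lam - 1| <= x1 -> E^-1 < lam * cabs z < E -> False.
    move=> lam0 l1 lr; apply: (he (lam%:C%C * z)).
      have -> : lam%:C%C * z - z = (lam - 1)%:C%C * z.
        by rewrite (_ : (lam - 1)%:C%C = lam%:C%C - 1 :> C) ?rmorphB//; ring.
      rewrite cabsM cabs_real; apply: le_lt_trans (ler_wpM2r (ltW z0) l1) _.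
      have : x1 * (2 * cabs z) <= e by rewrite -ler_pdivlMr ?mulr_gt0// ge_min lexx orbT.
      nra.
    by apply: inF; rewrite cabsM cabs_real gtr0_norm.
  have x12 : x1 <= 1 / 2 by rewrite ge_min lexx.
  have [zl|zg] := leP (cabs z) 1.
    pose lam := 1 + Num.min x1 ((E - 1) / 2).
    have m0 : 0 < Num.min x1 ((E - 1) / 2) by rewrite lt_min x10; lra.
    have m1 : Num.min x1 ((E - 1) / 2) <= x1 by rewrite ge_min lexx.
    have m2 : Num.min x1 ((E - 1) / 2) <= (E - 1) / 2 by rewrite ge_min lexx orbT.
    apply: (key lam); rewrite /lam; first lra.
      by rewrite addrAC subrr add0r ger0_norm// ltW.
    by apply/andP; split; nra.
  pose lam := 1 - Num.min x1 ((1 - E^-1) / 2).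
  have m0 : 0 < Num.min x1 ((1 - E^-1) / 2) by rewrite lt_min x10; lra.
  have m1 : Num.min x1 ((1 - E^-1) / 2) <= x1 by rewrite ge_min lexx.
  have m2 : Num.min x1 ((1 - E^-1) / 2) <= (1 - E^-1) / 2 by rewrite ge_min lexx orbT.
  apply: (key lam); rewrite /lam; first lra.
    by rewrite addrAC subrr add0r normrN ger0_norm// ltW.
  by apply/andP; split; nra.
- have [c c0 res] := resolvent_outside z1u z2u z12 p0 K0 HK (r := (E + cabs z) / 2) (tau := tau) ltac:(rewrite -/E; lra).
  by apply: (resolvent_local (@copen_cabs_gt ((E + cabs z) / 2)) c0 res Hx) => /=; lra.
- have [c c0 res] := resolvent_inside z1u z2u z12 p0 K0 HK (r := (E^-1 + cabs z) / 2) (tau := tau) ltac:(rewrite -/E; lra).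
  by apply: (resolvent_local (@copen_cabs_lt ((E^-1 + cabs z) / 2)) c0 res Hx) => /=; lra.
Qed.

End Adjoint.
End LocalSpectra.

(** Since [phi] fixes [z1] and [z2], in the coordinate [hmap] it is multiplication by a constant
    [k]. As [phi] preserves the disc, [k] maps the right half-plane to itself, which forces [k > 0],
    so that [tau = ln k]. *)
Lemma hyperbolic_flow (R : realType) (phi : R[i] -> R[i]) : hyperbolic_automorphism phi ->
  exists z1 z2 (tau : R), [/\ cabs z1 = 1, cabs z2 = 1, z1 != z2, tau != 0 &
    forall z, cabs z < 1 -> phi z = flow z1 z2 tau z].
Proof.
move=> [[a [b [c [d [D0 phiE]]]]] dd _ _ [z1 [z2 [z12 [z1u [z2u [f1 [f2 fix_only]]]]]]]].
have n1 : z1 != 0 by rewrite -cabs_gt0 z1u.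
have n2 : z2 != 0 by rewrite -cabs_gt0 z2u.
(* With [x / 0 = 0] a vanishing denominator would give [phi z1 = 0], contrary to [|z1| = 1]. *)
have N1 : c * z1 + d != 0 by apply: contra_neq n1 => e; rewrite -f1 phiE e invr0 mulr0.
have N2 : c * z2 + d != 0 by apply: contra_neq n2 => e; rewrite -f2 phiE e invr0 mulr0.
have e1 : a * z1 + b = z1 * (c * z1 + d) by move: f1; rewrite phiE => /(canRL (divfK N1)).
have e2 : a * z2 + b = z2 * (c * z2 + d) by move: f2; rewrite phiE => /(canRL (divfK N2)).
(* At a zero of the denominator, [|phi| < 1] at the nearby points [z + e] bounds the numerator by
   [|c| e], so the numerator vanishes too, against the nonzero determinant. *)
have np z : cabs z < 1 -> c * z + d != 0.
  move=> zd; apply/eqP => cz.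
  have cn : c != 0.
    apply: contraNneq D0 => c0; move: cz; by rewrite c0 mul0r add0r => ->; rewrite !mulr0 subrr.
  suff : a * z + b = 0.
    move=> az; move/eqP: D0; apply; apply: (mulfI cn); rewrite mulr0.
    have -> : d = - (c * z) by apply/eqP; rewrite -addr_eq0 addrC cz.
    have -> : b = - (a * z) by apply/eqP; rewrite -addr_eq0 addrC az.
    ring.
  apply/eqP; rewrite -cabs_eq0 eq_le cabs_ge0 andbT.
  apply: (@le_epsilon0 _ _ (cabs a + cabs c) (1 - cabs z)); first by rewrite subr_gt0.
  move=> e e0 ez; have zd' : cabs (z + e%:C%C) < 1.
    by apply: le_lt_trans (cabsD _ _) _; rewrite cabs_real gtr0_norm//; lra.
  have := dd _ zd'; rewrite /disc /= phiE.
  have -> : c * (z + e%:C%C) + d = c * e%:C%C by rewrite -[RHS]add0r -cz; ring.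
  rewrite cabsM cabsV cabsM cabs_real gtr0_norm// ltr_pdivrMr ?mulr_gt0 ?cabs_gt0// mul1r => h.
  have -> : a * z + b = a * (z + e%:C%C) + b - a * e%:C%C by ring.
  apply: le_trans (cabsB _ _) _; rewrite cabsM cabs_real gtr0_norm//; lra.
pose k : R[i] := (c * z2 + d) / (c * z1 + d).
have hk z : cabs z < 1 -> hmap z1 z2 (phi z) = k * hmap z1 z2 z.
  move=> zd; have cz := np z zd; have [zn _] := disc_neq z1u z2u zd.
  have s2 : (phi z - z2) * ((c * z + d) * (c * z2 + d)) = (a * d - b * c) * (z - z2).
    have -> : (phi z - z2) * ((c * z + d) * (c * z2 + d)) =
      (a * z + b) * (c * z2 + d) - (z2 * (c * z2 + d)) * (c * z + d).
      by rewrite phiE; field.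
    rewrite -e2; ring.
  have s1 : (z1 - phi z) * ((c * z + d) * (c * z1 + d)) = (a * d - b * c) * (z1 - z).
    have -> : (z1 - phi z) * ((c * z + d) * (c * z1 + d)) =
      (z1 * (c * z1 + d)) * (c * z + d) - (a * z + b) * (c * z1 + d).
      by rewrite phiE; field.
    rewrite -e1; ring.
  have p2 : phi z - z2 != 0 by have [] := disc_neq z1u z2u (dd z zd).
  rewrite /hmap /k mulf_div; apply/eqP; rewrite eqr_div ?mulf_neq0//; apply/eqP.
  apply: (mulfI (mulf_neq0 cz D0)).
  have -> : (c * z + d) * (a * d - b * c) * ((z1 - phi z) * ((c * z1 + d) * (z - z2))) =
    ((z1 - phi z) * ((c * z + d) * (c * z1 + d))) * ((a * d - b * c) * (z - z2)) by ring.
  rewrite s1 -s2; ring.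
have onto v : 0 < Re (hrot z1 z2 * v) -> exists2 z, cabs z < 1 & hmap z1 z2 z = v.
  move=> v0; have v1 : 1 + v != 0.
    apply: contraTneq v0 => /eqP; rewrite addrC addr_eq0 => /eqP ->.
    by rewrite mulrN1 cReN oppr_gt0 -leNgt ltW// (hrot_gt0 z1u z2u z12).
  pose z := (z1 + v * z2) / (1 + v).
  have zz2 : z - z2 = (z1 - z2) / (1 + v) by rewrite /z; field.
  have zn : z - z2 != 0 by rewrite zz2 mulf_neq0 ?invr_eq0 ?subr_eq0.
  have hz : hmap z1 z2 z = v.
    rewrite /hmap zz2 /z; field; by rewrite subr_eq0 z12 v1.
  by exists z => //; apply: (hmap_lt1 z1u z2u z12) => //; rewrite hz.
have half w : 0 < Re w -> 0 < Re (k * w).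
  move=> w0; have r0 : hrot z1 z2 != 0.
    by apply: contraTneq (hrot_gt0 z1u z2u z12) => ->; rewrite ltxx.
  have [z zd hz] : exists2 z, cabs z < 1 & hmap z1 z2 z = w / hrot z1 z2.
    by apply: onto; rewrite mulrC divfK.
  have := hmap_gt0 z1u z2u z12 (dd z zd); rewrite hk// hz.
  by have -> : hrot z1 z2 * (k * (w / hrot z1 z2)) = k * w by field.
have kR : 0 < Re k by have := half 1 ltr01; rewrite mulr1.
have kI : Im k = 0.
  (* This test point, of real part 1, is chosen so that its product with [k] has real part [-1]. *)
  apply/eqP/negPn/negP => kn; have := half (Complex 1 ((Re k + 1) / Im k)) ltr01.
  by rewrite cReM /= mulr1 mulrC divfK//; lra.
have kE : k = (expR (ln (Re k)))%:C%C.
  by rewrite lnK ?posrE//; apply: complexP.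
exists z1, z2, (ln (Re k)); split => //.
  (* [k = 1] would make [phi] fix 0, which is neither [z1] nor [z2]. *)
  apply/eqP => l0; rewrite l0 expR0 in kE.
  have d0 : cabs (0 : R[i]) < 1 by rewrite cabs0.
  have p0 : phi 0 = 0.
    have [q1 _] := disc_neq z1u z2u (dd 0 d0); have [q2 _] := disc_neq z1u z2u d0.
    by apply: (hmap_inj z12 q1 q2); rewrite hk// kE mul1r.
  by have [e|e] := fix_only 0 (ltW d0) p0; [move: n1|move: n2]; rewrite -e eqxx.
move=> z zd; have [q1 _] := disc_neq z1u z2u (dd z zd).
apply: (hmap_inj z12 q1); first exact: flow_neq.
by rewrite hk// (hmap_flow z1u z2u z12)// -kE.
Qed.

Theorem theorem3p1 (R : realType) (phi : R[i] -> R[i]) :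
  hyperbolic_automorphism phi ->
  (forall p : R, 1 <= p ->
     ~ SVEP (Hardy p) (@hardy_norm R p) (comp_op phi)) /\
  (forall p : R, 1 < p ->
     property_C (Hardy_dual p) (@dual_norm R p) (adjoint (comp_op phi))).
Proof.
move=> /hyperbolic_flow[z1 [z2 [tau [z1u z2u z12 tau0 phiE]]]]; split=> p p1.
  exact: (comp_flow_not_SVEP z1u z2u z12 tau0 phiE p1).
have [K K0 HK] := flow_norm z1u z2u z12 (ltW p1).
exact: (adjoint_property_C z1u z2u z12 tau0 phiE p1 K0 HK).
Qed.
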